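(* Let $d\ge 2$ and let ${\boldsymbol\mu}=(\mu_1,\dots,\mu_\nu)$ be a list of positive integers with $\sum_{i=1}^\nu\mu_i=2d-2$. Then $\mathbf{Rat}^{\boldsymbol\mu}_d$ is an embedded (complex) submanifold of $\mathbf{Rat}_d$ of dimension $\nu+3$, and the functions defined by the critical values form a partial holomorphic local coordinate system on it; that is, near each point of $\mathbf{Rat}^{\boldsymbol\mu}_d$ the map $$\mathbf{Rat}^{\boldsymbol\mu}_d\ni f\mapsto (f(c_1),\dots,f(c_\nu))$$ has rank $\nu$ and can be completed by $3$ other coordinates to a holomorphic local coordinate system, where $c_1=c_1(f),\dots,c_\nu=c_\nu(f)$ are the distinct critical points of $f$.
   Context: $\mathbf{Rat}_d$ is the space of all rational maps $f:\overline{\mathbb C}\to\overline{\mathbb C}$ of degree $d$, naturally identified (through coefficients of numerator and denominator) with an open subset of the complex projective space $P\mathbb C^{2d+1}$. For a non-ordered list ${\boldsymbol\mu}=(\mu_1,\dots,\mu_\nu)$ with $\sum_i\mu_i=2d-2$, $\mathbf{Rat}^{\boldsymbol\mu}_d$ is the set of $f\in\mathbf{Rat}_d$ having precisely $\nu$ distinct critical points $c_1,\dots,c_\nu\in\overline{\mathbb C}$, with multiplicities $\mu_1,\dots,\mu_\nu$ respectively (multiplicity $\mu$ means local degree $\mu+1$). Locally on $\mathbf{Rat}^{\boldsymbol\mu}_d$ the critical points are labelled by continuation: for $g\in\mathbf{Rat}^{\boldsymbol\mu}_d$ close to $f$, $c_i(g)$ is the unique critical point of $g$ near $c_i(f)$,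 and it has multiplicity $\mu_i$. Critical values lie in the Riemann sphere $\overline{\mathbb C}$, a one-dimensional complex manifold. *)

(* Defs.v *)
From HB Require Import structures.
From mathcomp Require Import all_boot all_order all_algebra generic_quotient.
From mathcomp Require Import complex.
From mathcomp Require Import all_classical all_reals all_analysis.

Set Implicit Arguments.
Unset Strict Implicit.
Unset Printing Implicit Defensive.

Import Order.TTheory GRing.Theory Num.Theory numFieldNormedType.Exports.

Local Open Scope quotient_scope.
Local Open Scope classical_set_scope.
Local Open Scope ring_scope.

(* The usual topology of the complex numbers. *)
HB.instance Definition _ (R : realType) :=
  PseudoPointedMetric.copy R[i] R[i]^o.

(** * Complex manifolds given by atlases *)

(* [differentiable] is Frechet differentiability over the scalar field, here
   the complex numbers [R[i]]; on an open set this is holomorphy. *)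
Definition holomorphic_on (R : realType) (n m : nat) (U : set 'rV[R[i]]_n)
    (G : 'rV[R[i]]_n -> 'rV[R[i]]_m) : Prop :=
  open U /\ forall v, U v -> differentiable G v.

(* Only the values of [coord] on [dom] matter. *)
Record chart (R : realType) (T : Type) (n : nat) := Chart {
  dom : set T;
  coord :> T -> 'rV[R[i]]_n }.

Section Manifolds.
Context {R : realType} {T : topologicalType}.

Definition open_in (S A : set T) : Prop :=
  exists2 O : set T, open O & A = S `&` O.

(* [x] is a homeomorphism from [dom x], an open subset of the subspace [S],
   onto an open subset of C^n. *)
Definition chart_on (n : nat) (S : set T) (x : chart R T n) : Prop :=
  [/\ open_in S (dom x),
      {in dom x &, injective x} &
      forall A, A `<=` dom x -> (open_in S A <-> open (x @` A))].

Definition holo_transition (n m : nat) (x : chart R T n) (y : chart R T m) :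
    Prop :=
  exists2 G : 'rV[R[i]]_n -> 'rV[R[i]]_m,
    holomorphic_on (x @` (dom x `&` dom y)) G &
    forall p, dom x p -> dom y p -> G (x p) = y p.

(* The maximal atlas of the complex structure defined on [S] by [atlas]. *)
Definition holo_chart (n : nat) (S : set T) (atlas : set (chart R T n))
    (x : chart R T n) : Prop :=
  chart_on S x /\
  forall y, atlas y -> holo_transition x y /\ holo_transition y x.

Section Submanifolds.
Context {n : nat} (atlas : set (chart R T n)) (M : set T) (k : nat).

(* [atlas] is an atlas of the whole of [T] and [M] is an open subset of [T]:
   a slice chart maps [S] to the subspace C^k x {0} of C^n. *)
Definition slice_chart (S : set T) (x : chart R T n) : Prop :=
  [/\ holo_chart setT atlas x, dom x `<=` M &
      forall p, dom x p ->
        (S p <-> forall j : 'I_n, (k <= j)%N -> x p 0 j = 0)].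

Definition embedded_submanifold (S : set T) : Prop :=
  [/\ S `<=` M, (k <= n)%N &
      forall p, S p -> exists2 x, slice_chart S x & dom x p].

(* The first [k] coordinates of the slice charts, restricted to [S];
   multiplication by [pid_mx k : 'M_(n, k)] is the projection C^n -> C^k. *)
Definition submanifold_atlas (S : set T) : set (chart R T k) :=
  [set Chart (S `&` dom x) (fun p => x p *m pid_mx k) | x in slice_chart S].

End Submanifolds.

(* The rank at [p] of a holomorphic map [F : S -> C^m], read in a holomorphic
   chart of [S] at [p] (the choice of which is irrelevant). *)
Definition has_rank_at (n m : nat) (S : set T) (atlas : set (chart R T n))
    (F : T -> 'rV[R[i]]_m) (p : T) (r : nat) : Prop :=
  exists x : chart R T n, exists G : 'rV[R[i]]_n -> 'rV[R[i]]_m,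
    [/\ holo_chart S atlas x, dom x p, holomorphic_on (x @` dom x) G,
        forall q, dom x q -> G (x q) = F q &
        \rank (jacobian G (x p)) = r].

End Manifolds.

Arguments embedded_submanifold {R T n} atlas M k S.
Arguments submanifold_atlas {R T n} atlas M k S.

(** * Complex projective spaces *)

Section Projective.
Context (R : realType) (n : nat).

Definition nonzero_vectors : set 'rV[R[i]]_n := [set v | v != 0].

(* Equality of the lines spanned by [u] and [v]. *)
Definition same_line (u v : nonzero_vectors) : bool :=
  (set_val u == set_val v)%MS.

Lemma same_line_equiv : equiv_class_of same_line.
Proof.
split=> [u|u v|v u w]; rewrite /same_line.
- by rewrite submx_refl.
- exact: andbC.
- move=> /andP[uv vu] /andP[vw wv].
  by rewrite (submx_trans uv vw) (submx_trans wv vu).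
Qed.

Canonical same_line_equivRel := EquivRelPack same_line_equiv.

(* The space of lines of C^n, with the quotient topology; it has dimension
   [n.-1]. *)
Definition proj_space : Type :=
  quotient_topology {eq_quot same_line_equivRel}.

HB.instance Definition _ := Topological.on proj_space.
HB.instance Definition _ := Quotient.on proj_space.

(* Homogeneous coordinates of a point (a nonzero vector of the line). *)
Definition hcoord (p : proj_space) : 'rV[R[i]]_n := set_val (repr p).

(* [v_0 : ... : v_(n-1)] |-> (v_j / v_i)_(j != i), where v_i != 0 *)
Definition affine_chart (i : 'I_n) : chart R proj_space n.-1 :=
  Chart [set p | hcoord p 0 i != 0]
        (fun p => col' i ((hcoord p 0 i)^-1 *: hcoord p)).

Definition proj_atlas : set (chart R proj_space n.-1) := range affine_chart.

End Projective.

Arguments nonzero_vectors R n : clear implicits.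
Arguments proj_atlas R n : clear implicits.

(** * Rational maps *)

(* The Riemann sphere as the projective line: [z0 : z1] is the point z0 / z1,
   and [1 : 0] is the point at infinity. *)
Definition sphere (R : realType) : Type := proj_space R 2.
HB.instance Definition _ (R : realType) := Topological.on (sphere R).

Section RationalMaps.
Context {R : realType} {d : nat}.

(* A point [a_0 : ... : a_d : b_0 : ... : b_d] encodes the fraction of
   \sum_i a_i z^i by \sum_i b_i z^i. *)
Local Notation coefs := (proj_space R (d.+1 + d.+1)).

Definition numer (f : coefs) : {poly R[i]} := rVpoly (lsubmx (hcoord f)).
Definition denom (f : coefs) : {poly R[i]} := rVpoly (rsubmx (hcoord f)).

Definition RatMaps : set coefs :=
  [set f | coprimep (numer f) (denom f) /\
           maxn (size (numer f)) (size (denom f)) = d.+1].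

(* z1^d * p(z0 / z1) *)
Definition homog_eval (p : {poly R[i]}) (z : 'rV[R[i]]_2) : R[i] :=
  \sum_(i < d.+1) p`_i * z 0 0 ^+ i * z 0 1 ^+ (d - i).

(* For [f] outside [RatMaps] the value may be ill-defined, and is then [z]. *)
Definition ratmap (f : coefs) (z : sphere R) : sphere R :=
  \pi_(proj_space R 2) (insubd (repr (z : proj_space R 2))
    (\row_(j < 2) homog_eval (if j == 0 then numer f else denom f) (hcoord z))).

(* The order of vanishing at [z] of [p], seen as a form of degree [d]; its
   order at infinity is d - deg p. *)
Definition order_at (p : {poly R[i]}) (z : sphere R) : nat :=
  let v := hcoord z in
  if v 0 1 == 0 then (d - (size p).-1)%N else mup (v 0 0 / v 0 1) p.

(* The multiplicity of [z] as a solution of f = [w0 : w1], for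
   [w0 : w1] = f(z), an equation that reads w1 * numer f - w0 * denom f = 0. *)
Definition local_degree (f : coefs) (z : sphere R) : nat :=
  let w := hcoord (ratmap f z) in
  order_at (w 0 1 *: numer f - w 0 0 *: denom f) z.

Definition critical (f : coefs) (z : sphere R) : Prop :=
  (1 < local_degree f z)%N.

Section Passport.
Context {nu : nat} (mu : 'I_nu -> nat).

(* [c] enumerates without repetition the critical points of [f], with
   respective multiplicities [mu]. *)
Definition critical_enum (f : coefs) (c : 'I_nu -> sphere R) : Prop :=
  [/\ injective c,
      forall z, critical f z <-> exists i, c i = z &
      forall i, local_degree f (c i) = (mu i).+1].

Definition RatMaps_mu : set coefs :=
  [set f | RatMaps f /\ exists c, critical_enum f c].

(* [c] labels the critical points of the maps in the neighbourhood [W] of [f]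
   in [RatMaps_mu]: [c i g] is the only critical point of [g] in [D i]. *)
Definition local_labelling (D : 'I_nu -> set (sphere R)) (f : coefs)
    (W : set coefs) (c : 'I_nu -> coefs -> sphere R) : Prop :=
  [/\ open W, W f &
      forall g, W g -> RatMaps_mu g ->
        critical_enum g (c^~ g) /\
        forall i z, (D i z /\ critical g z) <-> z = c i g].

(* The critical values, read in charts [zeta i] of the Riemann sphere. *)
Definition critical_values (zeta : 'I_nu -> chart R (sphere R) 1)
    (c : 'I_nu -> coefs -> sphere R) (g : coefs) : 'rV[R[i]]_nu :=
  \row_(i < nu) zeta i (ratmap g (c i g)) 0 0.

End Passport.
End RationalMaps.

Arguments RatMaps R d : clear implicits.
Arguments RatMaps_mu R d {nu} mu.

(* Main.v *)
(* Let f have critical points c_i of multiplicity mu_i. In coordinates of the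
   source and of the target, write the maps near f as N / P, and put
   b_k = P N^[k] - N P^[k], where [k] is the k-th derivative divided by k!: the
   local degree at x exceeds m if and only if b_1, ..., b_m vanish at x. As
   b_(mu_i) has a simple zero at c_i, the implicit function theorem extends c_i to
   a holomorphic function of the map, and the stratum is given by the equations
   b_k(c_i) = 0, 0 < k < mu_i: the total multiplicity 2d - 2 leaves no room for
   other critical points. These functions, the nu critical values, and the values
   of three linear forms, are 2d + 1 functions on a space of dimension 2d + 1.
   They are local coordinates: a variation (dN, dP) killed by their differentials
   gives a form P dN - N dP of degree 2d which vanishes to order mu_i at c_i and
   also at three other points, hence vanishes, and the variation is trivial. *)
Require Import Defs.
From HB Require Import structures.
From mathcomp Require Import all_boot all_order all_algebra complex generic_quotient.
From mathcomp Require Import all_classical all_reals all_analysis.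
From mathcomp Require Import ring lra zify.

Set Implicit Arguments.
Unset Strict Implicit.
Unset Printing Implicit Defensive.

Import Order.TTheory GRing.Theory Num.Theory numFieldNormedType.Exports.

Local Open Scope quotient_scope.
Local Open Scope classical_set_scope.
Local Open Scope ring_scope.

(** Holomorphy is Frechet differentiability at each point of an open set, whereas inverting a map
    takes uniform control of difference quotients. Strict differentiability provides it at a single
    point, and a local inverse inherits it at the image of every nearby point where the map has it;
    continuity of derivatives never enters. Points at infinity are handled by reversing
    coefficients: polynomials stand for forms of a fixed degree, and orders of vanishing become
    divisibility statements in either coordinate. The implicit function theorem follows the zero of
    b_(mu_i), but off the stratum the critical point may split, and this zero need not be critical.
    Conversely, that every map near f has a critical point near c_i is out of its reach, as b_1 has
    a zero of order mu_i there; an estimate for polynomials without roots in a disc plays the role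
    of Rouche's theorem. The number three is what separates the 2d - 2 zeros given by the critical
    points from the 2d + 1 that force a form of degree 2d to vanish. *)

(** * Completeness of C^n, for geometric sequences *)

Section Completeness.
Context {R : realType}.
Local Open Scope complex_scope.
Local Notation C := R[i].

Lemma norm_coord n (v : 'rV[C]_n) j : `|v 0 j| <= `|v|.
Proof.
rewrite [`|v|]/Num.norm/= mx_normE.
have : (`|v 0 j|%:nng <= \big[Order.max/0%:nng]_i `|v i.1 i.2|%:nng)%O.
  exact: (le_bigmax _ (fun i : 'I_1 * 'I_n => `|v i.1 i.2|%:nng) (0, j)).
by [].
Qed.

Lemma norm_row_le n (v : 'rV[C]_n) e :
  0 <= e -> (forall j, `|v 0 j| <= e) -> `|v| <= e.
Proof.
move=> e0 ve; rewrite [`|v|]/Num.norm/= mx_normE.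
have -> : e = (NngNum e0)%:num by [].
rewrite num_le; apply/bigmax_leP; split=> [|[i j] _] /=; first by [].
by rewrite -num_le/= (ord1 i).
Qed.

Lemma nbhs_vP n (u : 'rV[C]_n) (U : set 'rV[C]_n) :
  nbhs u U <-> exists2 r, 0 < r & forall x, `|x - u| < r -> U x.
Proof.
rewrite -filter_from_ballE; split=> -[r r0 H]; exists r => //.
  by move=> x xr; apply: H; rewrite -ball_normE/= distrC.
by move=> x; rewrite -ball_normE/= distrC; exact: H.
Qed.

Lemma real_geom_cvg (a : nat -> R) (r : R) :
  (forall k, `|a k.+1 - a k| <= r / 2 ^+ k) ->
  exists l, forall k, `|a k - l| <= 2 * r / 2 ^+ k.
Proof.
move=> H.
have Hm k m : `|a (k + m)%N - a k| <= 2 * r / 2 ^+ k - 2 * r / 2 ^+ (k + m).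
  elim: m => [|m IH]; first by rewrite addn0 !subrr normr0.
  rewrite addnS; apply: (le_trans (ler_distD (a (k + m)%N) _ _)).
  have := H (k + m)%N; rewrite exprS invfM.
  by move=> h1; move: (lerD h1 IH) => /le_trans; apply; lra.
have r0 : 0 <= r by have := le_trans (normr_ge0 _) (H 0%N); rewrite expr0 divr1.
have Hm' k m : `|a (k + m)%N - a k| <= 2 * r / 2 ^+ k.
  apply: (le_trans (Hm k m)); rewrite gerBl.
  by rewrite divr_ge0 ?mulr_ge0 ?exprn_ge0.
have cv : cvgn a.
  apply/cauchy_cvgP; apply: cauchy_exP => e e0.
  have h : (4 * r * 2^-1 ^+ k) @[k --> \oo] --> (0 : R).
    by apply: (@cvg_geometric R (4 * r)); rewrite ger0_norm; lra.
  have [K _ HK] : \forall k \near \oo, 4 * r / 2 ^+ k < e.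
    move/cvgrPdist_lt : h => /(_ e e0); apply: filterS => k /=.
    by rewrite sub0r normrN exprVn => /(le_lt_trans (ler_norm _)).
  exists (a K); exists K => // n /= Kn; rewrite -ball_normE/= distrC.
  have := Hm' K (n - K)%N; rewrite subnKC// => /le_lt_trans; apply.
  by have := HK K (leqnn K); have : 0 <= r / 2 ^+ K; [rewrite divr_ge0 ?exprn_ge0|lra].
exists (limn a) => k; rewrite distrC.
have cva : a n @[n --> \oo] --> limn a by [].
apply/ler_addgt0Pr => e e0.
move/cvgrPdist_lt : cva => /(_ e e0) [N _ HN].
apply: (le_trans (ler_distD (a (k + N)%N) _ _)).
by rewrite addrC lerD// ltW// HN//= leq_addl.
Qed.

Lemma normC_ReIm (z : C) : `|z| <= (`|complex.Re z| + `|complex.Im z|)%:C.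
Proof.
case: z => a b; rewrite normc_def/= lecR.
rewrite -[leRHS]ger0_norm ?addr_ge0// -sqrtr_sqr ler_wsqrtr//.
rewrite sqrrD !real_normK ?num_real//.
by have := mulr_ge0 (normr_ge0 a) (normr_ge0 b); lra.
Qed.

Lemma norm_Re_le (z : C) : `|complex.Re z|%:C <= `|z|.
Proof.
case: z => a b; rewrite normc_def/= lecR -sqrtr_sqr ler_wsqrtr// lerDl.
exact: sqr_ge0.
Qed.

Lemma norm_Im_le (z : C) : `|complex.Im z|%:C <= `|z|.
Proof.
case: z => a b; rewrite normc_def/= lecR -sqrtr_sqr ler_wsqrtr// lerDr.
exact: sqr_ge0.
Qed.

Lemma rowvec_geom_cvg n (a : nat -> 'rV[C]_n) (r : R) :
  (forall k, `|a k.+1 - a k| <= (r / 2 ^+ k)%:C) ->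
  exists l, forall k, `|a k - l| <= (4 * r / 2 ^+ k)%:C.
Proof.
move=> H.
have r0 : 0 <= r.
  by have := le_trans (normr_ge0 _) (H 0%N); rewrite expr0 divr1 lecR.
have coordH (j : 'I_n) (k : nat) : `|a k.+1 0 j - a k 0 j| <= (r / 2 ^+ k)%:C.
  by apply: le_trans (H k); have := norm_coord (a k.+1 - a k) j; rewrite !mxE.
have /choice[lr Hlr] : forall j, exists l, forall k, `|complex.Re (a k 0 j) - l| <= 2 * r / 2 ^+ k.
  move=> j; apply: real_geom_cvg => k; rewrite -lecR.
  by apply: le_trans (coordH j k); rewrite -raddfB; exact: norm_Re_le.
have /choice[li Hli] : forall j, exists l, forall k, `|complex.Im (a k 0 j) - l| <= 2 * r / 2 ^+ k.
  move=> j; apply: real_geom_cvg => k; rewrite -lecR.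
  by apply: le_trans (coordH j k); rewrite -raddfB; exact: norm_Im_le.
exists (\row_j (lr j +i* li j)%C) => k.
apply: norm_row_le; first by rewrite lecR divr_ge0 ?mulr_ge0 ?exprn_ge0.
move=> j; rewrite !mxE; apply: (le_trans (normC_ReIm _)).
rewrite lecR !raddfB/=.
by have := lerD (Hlr j k) (Hli j k); move/le_trans; apply; lra.
Qed.

End Completeness.

(** * Strict differentiability: rules of calculus *)

Section StrictDifferentiability.
Context {R : realType}.
Local Notation C := R[i].
Local Notation K := (complex R).

Definition rv_scalar n (l : 'rV[C]_n -> C) : Prop :=
  forall a x y, l (a *: x + y) = a * l x + l y.

(* Strict differentiability at [u]: it passes to local inverses without any
   assumption on the derivative near [u]. *)
Definition sdiff n (f : 'rV[C]_n -> C) (u : 'rV[C]_n) (l : 'rV[C]_n -> C) :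
    Prop :=
  rv_scalar l /\ forall e, 0 < e -> exists2 U, nbhs u U &
    forall x y, U x -> U y -> `|f x - f y - l (x - y)| <= e * `|x - y|.

Lemma rv_scalarD n (l : 'rV[C]_n -> C) : rv_scalar l -> {morph l : x y / x + y}.
Proof. by move=> H x y; have := H 1 x y; rewrite scale1r mul1r. Qed.

Lemma rv_scalar0 n (l : 'rV[C]_n -> C) : rv_scalar l -> l 0 = 0.
Proof.
by move=> H; have /eqP := rv_scalarD H 0 0; rewrite addr0 eq_sym -subr_eq0 addrK => /eqP.
Qed.

Lemma rv_scalarZ n (l : 'rV[C]_n -> C) : rv_scalar l ->
  forall a x, l (a *: x) = a * l x.
Proof. by move=> H a x; have := H a x 0; rewrite !addr0 rv_scalar0// addr0. Qed.

Lemma rv_scalarB n (l : 'rV[C]_n -> C) : rv_scalar l -> {morph l : x y / x - y}.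
Proof.
by move=> H x y; rewrite rv_scalarD// -scaleN1r rv_scalarZ// mulN1r.
Qed.

Lemma rv_scalar_sum n (l : 'rV[C]_n -> C) : rv_scalar l ->
  forall x, l x = \sum_j x 0 j * l (delta_mx 0 j).
Proof.
move=> H x; rewrite {1}[x]row_sum_delta.
elim/big_ind2 : _ => [|a b c d <- <-|j _]; first exact: rv_scalar0.
- exact: rv_scalarD.
- exact: rv_scalarZ.
Qed.

Lemma rv_scalar_bound n (l : 'rV[C]_n -> C) : rv_scalar l ->
  exists2 M : C, 0 < M & forall x, `|l x| <= M * `|x|.
Proof.
move=> H; exists (1 + \sum_j `|l (delta_mx 0 j)|).
  by rewrite ltr_pwDl// sumr_ge0.
move=> x; rewrite (rv_scalar_sum H).
apply: (le_trans (ler_norm_sum _ _ _)).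
rewrite mulrDl mul1r mulr_suml.
apply: le_trans (_ : \sum_j `|l (delta_mx 0 j)| * `|x| <= _).
  by apply: ler_sum => j _; rewrite normrM mulrC ler_wpM2l// norm_coord.
by rewrite lerDr.
Qed.

Lemma sdiff_lin n (f : 'rV[C]_n -> C) u : rv_scalar f -> sdiff f u f.
Proof.
move=> fl; split=> // e e0; exists setT; first exact: filterT.
by move=> x y _ _; rewrite rv_scalarB// subrr normr0 mulr_ge0// ltW.
Qed.

Lemma sdiff_cst n (c : C) (u : 'rV[C]_n) : sdiff (fun=> c) u (fun=> 0).
Proof.
split; first by move=> *; rewrite mulr0 addr0.
move=> e e0; exists setT; first exact: filterT.
by move=> x y _ _; rewrite subrr subr0 normr0 mulr_ge0// ltW.
Qed.

Lemma sdiffD n (f g : 'rV[C]_n -> C) u l m :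
  sdiff f u l -> sdiff g u m ->
  sdiff (fun x => f x + g x) u (fun x => l x + m x).
Proof.
move=> [ll Hf] [lm Hg]; split.
  by move=> a x y; rewrite ll lm; ring.
move=> e e0; have e20 : 0 < e / 2 by rewrite divr_gt0.
have [U nU HU] := Hf _ e20; have [V nV HV] := Hg _ e20.
exists (U `&` V); first exact: filterI.
move=> x y [Ux Vx] [Uy Vy].
have -> : f x + g x - (f y + g y) - (l (x - y) + m (x - y)) =
  (f x - f y - l (x - y)) + (g x - g y - m (x - y)) by ring.
apply: (le_trans (ler_normD _ _)); rewrite [e]splitr mulrDl.
by rewrite lerD// ?HU ?HV.
Qed.

Lemma sdiff_lip n (f : 'rV[C]_n -> C) u l : sdiff f u l ->
  exists2 M : C, 0 < M & exists2 U, nbhs u U &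
    forall x y, U x -> U y -> `|f x - f y| <= M * `|x - y|.
Proof.
move=> [ll Hf]; have [M M0 HM] := rv_scalar_bound ll.
have [U nU HU] := Hf _ ltr01.
exists (1 + M); first by rewrite addr_gt0.
exists U => // x y Ux Uy.
rewrite -[f x - f y](subrK (l (x - y))) mulrDl.
apply: (le_trans (ler_normD _ _)).
by rewrite lerD// HU.
Qed.

Lemma sdiff_near n (f : 'rV[C]_n -> C) u l e : sdiff f u l -> 0 < e ->
  \forall x \near u, `|f x - f u| < e.
Proof.
move=> /sdiff_lip[M M0 [U nU HU]] e0.
have nV : \forall x \near u, `|x - u| < e / M.
  by apply/nbhs_vP; exists (e / M) => //; rewrite divr_gt0.
apply: filterS (filterI nU nV) => x [Ux Vx].
apply: (le_lt_trans (HU _ _ Ux (nbhs_singleton nU))).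
by rewrite mulrC -ltr_pdivlMr.
Qed.

Lemma sdiff_bounded n (f : 'rV[C]_n -> C) u l : sdiff f u l ->
  exists2 M : C, 0 < M & \forall x \near u, `|f x| <= M.
Proof.
move=> sf; exists (1 + `|f u|); first by rewrite ltr_pwDl.
apply: filterS (sdiff_near sf ltr01) => x h.
rewrite -[f x](subrK (f u)); apply: (le_trans (ler_normD _ _)).
by rewrite lerD2r ltW.
Qed.

Lemma sdiffM n (f g : 'rV[C]_n -> C) u l m :
  sdiff f u l -> sdiff g u m ->
  sdiff (fun x => f x * g x) u (fun h => f u * m h + l h * g u).
Proof.
move=> sf sg; have [ll Hf] := sf; have [lm Hg] := sg; split.
  by move=> a x y; rewrite ll lm; ring.
move=> e e0.
have [Mf Mf0 nMf] := sdiff_bounded sf; have [Mg Mg0 nMg] := sdiff_bounded sg.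
have [Kl Kl0 HKl] := rv_scalar_bound ll; have [Km Km0 HKm] := rv_scalar_bound lm.
(* The error splits into four products; each has one factor controlled by [e / D] and the other by
   one of these four bounds. *)
pose D := Mf + Mg + Kl + Km.
have D0 : 0 < D by rewrite /D !addr_gt0.
have eD : 0 < e / D by rewrite divr_gt0.
have [U nU HU] := Hf _ eD; have [V nV HV] := Hg _ eD.
have nf := sdiff_near sf eD; have ng := sdiff_near sg eD.
exists ((U `&` V) `&` ((fun x => `|f x| <= Mf) `&` (fun x => `|g x| <= Mg)) `&`
  ((fun x => `|f x - f u| < e / D) `&` (fun x => `|g x - g u| < e / D))).
  by do !apply: filterI.
move=> x y [[[Ux Vx] [fx gx]] [fux gux]] [[[Uy Vy] [fy gy]] [fuy guy]].
have -> : f x * g x - f y * g y - (f u * m (x - y) + l (x - y) * g u) =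
  f x * (g x - g y - m (x - y)) + (f x - f y - l (x - y)) * g y +
  (f x - f u) * m (x - y) + l (x - y) * (g y - g u) by ring.
apply: (le_trans (ler_normD _ _)).
have -> : e * `|x - y| = Mf * (e / D * `|x - y|) + (e / D * `|x - y|) * Mg +
   (e / D) * (Km * `|x - y|) + (Kl * `|x - y|) * (e / D).
  by rewrite /D; field; rewrite gt_eqF.
rewrite lerD//; last by rewrite normrM ler_pM// ltW.
apply: (le_trans (ler_normD _ _)).
rewrite lerD//; last by rewrite normrM ler_pM// ltW.
apply: (le_trans (ler_normD _ _)).
by rewrite lerD//; rewrite normrM ler_pM// ?HU ?HV.
Qed.

Lemma sdiffV n (f : 'rV[C]_n -> C) u l : sdiff f u l -> f u != 0 ->
  sdiff (fun x => (f x)^-1) u (fun h => - l h / f u ^+ 2).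
Proof.
move=> sf fu0; have [ll Hf] := sf; split.
  by move=> a x y; rewrite ll; ring.
move=> e e0.
have [M M0 [W nW HW]] := sdiff_lip sf.
pose a := `|f u|; have a0 : 0 < a by rewrite normr_gt0.
(* [B] bounds the inverse of [f] where [f] is within [a / 2] of [f u]. The error is that of [f]
   times [B ^+ 2] at most, plus an increment of [f] times two terms of order [B ^+ 3]; hence [D]. *)
pose B := 2 / a; have B0 : 0 < B by rewrite divr_gt0.
pose D := B ^+ 2 + 2 * M * B ^+ 3.
have D0 : 0 < D.
  by apply: addr_gt0; rewrite ?exprn_gt0// mulr_gt0 ?exprn_gt0// mulr_gt0.
have eD : 0 < e / D by rewrite divr_gt0.
have [U nU HU] := Hf _ eD.
have a20 : 0 < a / 2 by rewrite divr_gt0.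
have low x : `|f x - f u| < a / 2 -> f x != 0 /\ `|(f x)^-1| <= B.
  move=> h; have h2 : a / 2 <= `|f x|.
    have : a - `|f u - f x| <= `|f x|.
      by apply: le_trans (lerB_dist _ _) _; rewrite subKr.
    apply: le_trans; rewrite lerBrDr -lerBrDl distrC.
    by rewrite {1}[a]splitr addrK ltW.
  have fx0 : f x != 0 by rewrite -normr_gt0 (lt_le_trans a20).
  split=> //; rewrite normfV -[B]invrK lef_pV2 ?posrE ?invr_gt0 ?normr_gt0//.
  by rewrite /B invf_div.
exists ((U `&` W) `&` ((fun x => `|f x - f u| < a / 2) `&`
  (fun x => `|f x - f u| < e / D))).
  apply: filterI; first exact: filterI.
  by apply: filterI; exact: sdiff_near sf _.
move=> x y [[Ux Wx] [/low[fx0 fxB] fxe]] [[Uy Wy] [/low[fy0 fyB] fye]].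
have [_ fuB] : f u != 0 /\ `|(f u)^-1| <= B by apply: low; rewrite subrr normr0.
have -> : (f x)^-1 - (f y)^-1 - - l (x - y) / f u ^+ 2 =
  - ((f x - f y - l (x - y)) * ((f u)^-1 * (f u)^-1)) +
  (f x - f y) * ((f y - f u) * ((f x)^-1 * (f y)^-1 * (f u)^-1) +
     (f x - f u) * ((f x)^-1 * (f u)^-1 * (f u)^-1)).
  by field; rewrite fx0 fy0 fu0.
apply: (le_trans (ler_normD _ _)).
have -> : e * `|x - y| = (e / D * `|x - y|) * (B * B) +
   (M * `|x - y|) * ((e / D) * (B * B * B) + (e / D) * (B * B * B)).
  by rewrite /D; field; rewrite gt_eqF.
rewrite lerD// ?normrN ?normrM.
  by rewrite ler_pM ?mulr_ge0// ?HU// ler_pM.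
rewrite ler_pM ?HW//; apply: (le_trans (ler_normD _ _)).
have tri p q r : `|p| <= B -> `|q| <= B -> `|r| <= B -> `|p * q * r| <= B * B * B.
  by move=> pB qB rB; rewrite !normrM ler_pM ?mulr_ge0// ler_pM.
by apply: lerD; rewrite normrM; apply: ler_pM => //; [exact: ltW|exact: tri|exact: ltW|exact: tri].
Qed.

End StrictDifferentiability.

(** * The inverse function theorem *)

Section InverseFunction.
Context {R : realType}.
Local Notation C := R[i].

Lemma mulmx_bound n m (B : 'M[C]_(n, m)) :
  exists2 M : C, 0 < M & forall h : 'rV_n, `|h *m B| <= M * `|h|.
Proof.
have H (j : 'I_m) : exists M : C, 0 < M /\ forall h : 'rV_n, `|(h *m B) 0 j| <= M * `|h|.
  have [|M M0 HM] := @rv_scalar_bound R n (fun h => (h *m B) 0 j); last by exists M.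
  by move=> a x y; rewrite mulmxDl -scalemxAl !mxE.
have /choice[M HM] := H; exists (1 + \sum_j M j).
  by rewrite ltr_pwDl// sumr_ge0// => j _; have [/ltW] := HM j.
move=> h; have M0 j : 0 <= M j by have [/ltW] := HM j.
have S0 : 0 <= \sum_j M j by apply: sumr_ge0.
apply: norm_row_le; first by rewrite mulr_ge0 ?addr_ge0.
move=> j; have [_ /(_ h)/le_trans] := HM j; apply.
rewrite ler_wpM2r// (bigD1 j)//= addrCA lerDl addr_ge0//.
exact: sumr_ge0.
Qed.

(** Norms are complex numbers here; read on real parts, the bound yields to the Archimedean
    property, as 2^k exceeds k. *)
Lemma geom_bound0 n (z : 'rV[C]_n) (c : C) :
  (forall k, `|z| <= c / 2 ^+ k) -> z = 0.
Proof.
move=> H; apply/eqP; rewrite -normr_eq0; apply/eqP.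
have rz : (complex.Re `|z|)%:C%C = `|z| by rewrite RRe_real// normr_real.
have rc : (complex.Re c)%:C%C = c.
  rewrite RRe_real//; apply: ger0_real; have := H 0%N; rewrite expr0 divr1.
  exact/le_trans/normr_ge0.
set a := complex.Re `|z| in rz; set b := complex.Re c in rc.
have a0 : 0 <= a by rewrite -ler0c rz.
have Hk k : a <= b / 2 ^+ k.
  by have := H k; rewrite -rz -rc -[2]/(2%:R) -(rmorph_nat (real_complex R)) -rmorphXn -fmorphV -rmorphM/= lecR.
suff -> : `|z| = 0 by [].
rewrite -rz; congr (_%:C)%C; apply/eqP; rewrite eq_le a0 andbT leNgt; apply/negP => a_gt0.
have [k hk] : exists k : nat, b / a < k%:R.
  exists (Num.bound (b / a)); apply: archi_boundP; rewrite divr_ge0//.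
  by have := Hk 0%N; rewrite expr0 divr1; apply: le_trans.
have := Hk k; rewrite ler_pdivlMr ?exprn_gt0//.
apply/negP; rewrite -ltNge mulrC -ltr_pdivrMr//.
by apply: (lt_trans hk); rewrite -natrX ltr_nat ltn_expl.
Qed.

Lemma rowvec_geom_cvgC n (a : nat -> 'rV[C]_n) (r : C) :
  (forall k, `|a k.+1 - a k| <= r / 2 ^+ k) ->
  exists l, forall k, `|a k - l| <= 4 * r / 2 ^+ k.
Proof.
move=> H.
have rr : (complex.Re r)%:C%C = r.
  rewrite RRe_real//; apply: ger0_real; have := H 0%N; rewrite expr0 divr1.
  exact/le_trans/normr_ge0.
have E (x : R) k : (x / 2 ^+ k)%:C%C = x%:C%C / 2 ^+ k :> C.
  by rewrite rmorphM fmorphV rmorphXn rmorph_nat.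
have [k|l Hl] := @rowvec_geom_cvg R n a (complex.Re r); first by rewrite E rr H.
by exists l => k; have := Hl k; rewrite E rmorphM rmorph_nat /= rr.
Qed.

Definition dmx n m (l : 'I_m -> 'rV[C]_n -> C) : 'M[C]_(n, m) :=
  \matrix_(i, j) l j (delta_mx 0 i).

Lemma mul_dmx n m (l : 'I_m -> 'rV[C]_n -> C) : (forall j, rv_scalar (l j)) ->
  forall h, h *m dmx l = \row_j l j h.
Proof.
move=> H h; apply/rowP => j; rewrite !mxE (rv_scalar_sum (H j) h).
by apply: eq_bigr => i _; rewrite !mxE.
Qed.

Lemma sdiff_vec n m (F : 'rV[C]_n -> 'rV[C]_m) u (l : 'I_m -> 'rV[C]_n -> C) :
  (forall j, sdiff (fun x => F x 0 j) u (l j)) -> forall e, 0 < e ->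
  exists2 U, nbhs u U & forall x y, U x -> U y ->
    `|F x - F y - (x - y) *m dmx l| <= e * `|x - y|.
Proof.
move=> H e e0.
have /choice[U HU] : forall j, exists U, nbhs u U /\ forall x y, U x -> U y ->
    `|F x 0 j - F y 0 j - l j (x - y)| <= e * `|x - y|.
  by move=> j; have [_ /(_ e e0)[U ? ?]] := H j; exists U.
exists (fun x => forall j, U j x).
  exact: (@filter_forall _ _ U (nbhs u) _ (fun j => (HU j).1)).
move=> x y Ux Uy; apply: norm_row_le; first by rewrite mulr_ge0// ltW.
move=> j; rewrite mul_dmx; last by move=> k; have [] := H k.
by rewrite !mxE; have [_] := HU j; apply.
Qed.

(** Newton's method with fixed slope: followed by the inverse of its differential at [u0], the map
    differs from the identity by a map of Lipschitz constant 1/2 on a ball [U]. The last clause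
    concerns every point of [U] where [F] is strictly differentiable, so that it yields holomorphy
    of the inverse. *)
Lemma inverse_function n (F : 'rV[C]_n -> 'rV[C]_n) u0
    (l : 'I_n -> 'rV[C]_n -> C) :
  (forall j, sdiff (fun x => F x 0 j) u0 (l j)) ->
  (forall h, (forall j, l j h = 0) -> h = 0) ->
  exists U, [/\ open U, U u0,
    forall x y, U x -> U y -> F x = F y -> x = y,
    forall V, open V -> V `<=` U -> open (F @` V) &
    forall G x, (forall x, U x -> G (F x) = x) -> U x ->
      (forall j, exists m, sdiff (fun x => F x 0 j) x m) ->
      forall j, exists m, sdiff (fun y => G y 0 j) (F x) m].
Proof.
move=> HF Hl.
have ll j : rv_scalar (l j) by have [] := HF j.
pose A := dmx l.
have uA : A \in unitmx.
  rewrite -row_free_unit; apply: inj_row_free => v; rewrite mul_dmx// => /rowP v0.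
  by apply: Hl => j; have := v0 j; rewrite !mxE.
pose B := invmx A.
have [K K0 HK] := mulmx_bound B.
(* Multiplication by [B] turns this tolerance into 1/2. *)
have e0 : 0 < (2 * K)^-1 by rewrite invr_gt0 mulr_gt0.
have [U1 /nbhs_vP[r r0 rU1] HU1] := sdiff_vec HF e0.
pose U := [set x : 'rV[C]_n | `|x - u0| < r].
have oU : open U.
  rewrite openE => x /= xr; apply/nbhs_vP; exists (r - `|x - u0|).
    by rewrite subr_gt0.
  move=> y; rewrite ltrBrDr => h; apply: le_lt_trans h.
  exact: ler_distD.
pose P x := F x *m B.
have HP x y : U x -> U y -> `|P x - P y - (x - y)| <= `|x - y| / 2.
  move=> Ux Uy.
  have -> : P x - P y - (x - y) = (F x - F y - (x - y) *m A) *m B.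
    by rewrite [RHS]mulmxBl mulmxK// mulmxBl.
  apply: (le_trans (HK _)); have := HU1 _ _ (rU1 _ Ux) (rU1 _ Uy).
  rewrite -(ler_pM2l K0) => /le_trans; apply.
  by rewrite mulrA invfM [K * _]mulrC -[2^-1 * _ * _]mulrA mulVf ?gt_eqF// mulr1 mulrC.
have low x y : U x -> U y -> `|x - y| <= 2 * `|P x - P y|.
  move=> Ux Uy.
  have h : `|x - y| <= `|P x - P y| + `|x - y| / 2.
    rewrite -{1}[x - y](subKr (P x - P y)).
    by apply: (le_trans (ler_normB _ _)); rewrite lerD2l HP.
  move: h; rewrite {1}[`|x - y|]splitr lerD2r ler_pdivrMr// mulrC => h.
  by rewrite h.
have PE x y : `|P x - P y| <= K * `|F x - F y| by rewrite -mulmxBl.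
have lowF x y : U x -> U y -> `|x - y| <= 2 * K * `|F x - F y|.
  by move=> Ux Uy; apply: (le_trans (low _ _ Ux Uy)); rewrite -mulrA ler_pM2l.
have opF V : open V -> V `<=` U -> open (F @` V).
  move=> oV VU; rewrite openE => _ [x0 Vx0 <-].
  have /nbhs_vP[rho rho0 Hrho] : nbhs x0 V by apply: open_nbhs_nbhs.
  apply/nbhs_vP; exists (rho / (4 * K)); first by rewrite divr_gt0// mulr_gt0.
  move=> y; rewrite ltr_pdivlMr ?mulr_gt0// mulrC => yr.
  pose s := K * `|y - F x0|.
  have s0 : 0 <= s by rewrite mulr_ge0// ltW.
  have srho : 4 * s < rho by rewrite /s mulrA.
  (* A contraction of ratio 1/2 on [U], whose fixed points are the solutions of [F x = y]. *)
  pose T x := x - P x + y *m B.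
  pose a k := iter k T x0.
  have TT x z : T x - T z = - (P x - P z - (x - z)).
    by rewrite /T; move: (P x) (P z) (y *m B) => p q t; apply/rowP=> j; rewrite !mxE; ring.
  have inV x : `|x - x0| < rho -> V x by exact: Hrho.
  have nn j : 0 <= 2 * s / 2 ^+ j.
    by apply: divr_ge0; [exact: mulr_ge0|exact: exprn_ge0].
  have s24 : 2 * s <= 4 * s by rewrite ler_wpM2r// ler_nat.
  (* The two bounds go together: staying within [2 * s] of [x0] keeps the iterates in [V], where the
     next step contracts. *)
  have main k : `|a k - x0| <= 2 * s - 2 * s / 2 ^+ k /\
      `|a k.+1 - a k| <= s / 2 ^+ k.
    elim: k => [|k [IH1 IH2]].
      rewrite expr0 !divr1 !subrr normr0; split=> //.
      have -> : a 1%N - a 0%N = (y - F x0) *m B.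
        rewrite mulmxBl -/(P x0) /a/= /T.
        by move: (P x0) (y *m B) => p t; apply/rowP=> j; rewrite !mxE; ring.
      exact: HK.
    have h1 : `|a k.+1 - x0| <= 2 * s - 2 * s / 2 ^+ k.+1.
      apply: (le_trans (ler_distD (a k) _ _)); apply: (le_trans (lerD IH2 IH1)).
      rewrite exprS le_eqVlt; apply/orP; left; apply/eqP.
      have : (2 : C) ^+ k != 0 by rewrite expf_neq0.
      by move: (2 ^+ k) => q q0; field.
    have lt_rho j t : t <= 2 * s - 2 * s / 2 ^+ j -> t < rho.
      move=> /le_lt_trans; apply; apply: le_lt_trans srho.
      by rewrite lerBlDr; apply: ler_wpDr.
    split=> //.
    have -> : a k.+2 - a k.+1 = T (a k.+1) - T (a k) by [].
    rewrite TT normrN.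
    apply: (le_trans (HP _ _ (VU _ (inV _ (lt_rho _ _ h1))) (VU _ (inV _ (lt_rho _ _ IH1))))).
    by rewrite exprS invfM [s * _]mulrCA mulrC ler_pM2l ?invr_gt0.
  have [x Hx] := rowvec_geom_cvgC (fun k => (main k).2).
  have Vx : V x.
    apply: inV; rewrite distrC; apply: le_lt_trans (Hx 0%N) _.
    by rewrite expr0 divr1.
  have Va k : V (a k).
    have [h _] := main k; apply: inV; apply: (le_lt_trans h).
    apply: le_lt_trans srho; by rewrite lerBlDr; apply: ler_wpDr.
  have Tx : T x = x.
    apply/eqP; rewrite -subr_eq0; apply/eqP; apply: (@geom_bound0 _ _ (4 * s)) => k.
    apply: (le_trans (ler_distD (T (a k)) _ _)).
    rewrite [4 * s / _]splitr lerD//.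
      rewrite TT normrN; apply: (le_trans (HP _ _ (VU _ Vx) (VU _ (Va k)))).
      by rewrite ler_pM2r ?invr_gt0// distrC.
    have := Hx k.+1; rewrite exprS invfM => /le_trans; apply.
    by rewrite mulrCA mulrC.
  exists x => //.
  have : P x = y *m B.
    by apply/eqP; rewrite -subr_eq0 -oppr_eq0 opprB addrC; move/eqP: Tx; rewrite /T -addrA eq_sym -subr_eq0 opprD addNKr oppr_eq0.
  by move/(congr1 (mulmx^~ A)); rewrite /P/= !mulmxKV.
exists U; split=> //; first by rewrite /U/= subrr normr0.
  move=> x y Ux Uy Fxy; apply/eqP; rewrite -subr_eq0 -normr_le0.
  by have := lowF x y Ux Uy; rewrite Fxy subrr normr0 mulr0.
move=> G x HG Ux /choice[m Hm].
have lm j : rv_scalar (m j) by have [] := Hm j.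
have e1 : 0 < (4 * K)^-1 by rewrite invr_gt0 mulr_gt0.
have K20 : 0 < 2 * K by rewrite mulr_gt0.
(* Along a short multiple [w] of a nonzero kernel vector, [F] would move by at most [|w| / (4 * K)],
   while [lowF] bounds [|w|] by [2 * K] times this displacement. *)
have uM : dmx m \in unitmx.
  rewrite -row_free_unit; apply: inj_row_free => v v0.
  have [V nV HV] := sdiff_vec Hm e1.
  have /nbhs_vP[t t0 Ht] : nbhs x (V `&` U).
    by apply: filterI => //; exact: open_nbhs_nbhs.
  have [->//|vn0] := eqVneq v 0.
  have v1 : 0 < `|v| by rewrite normr_gt0.
  pose w := (t / (2 * `|v|)) *: v.
  have w0 : w *m dmx m = 0 by rewrite -scalemxAl v0 scaler0.
  have nw : `|w| = t / 2.
    rewrite normrZ ger0_norm; first by field; rewrite gt_eqF.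
    by apply: ltW; rewrite divr_gt0// mulr_gt0.
  have xw : (V `&` U) (x + w).
    by apply: Ht; rewrite addrAC subrr add0r nw ltr_pdivrMr// ltr_pMr// ltr1n.
  have xx : (V `&` U) x by apply: Ht; rewrite subrr normr0.
  have := HV _ _ xw.1 xx.1; rewrite [x + w]addrC addrK w0 subr0 => h1.
  have := lowF _ _ xw.2 xx.2; rewrite [x + w]addrC addrK => h2.
  have := le_trans h2 (ler_wpM2l (ltW K20) h1).
  have -> : 2 * K * ((4 * K)^-1 * `|w|) = `|w| / 2 by field; rewrite gt_eqF.
  rewrite {1}[`|w|]splitr gerDl nw pmulr_lle0 ?invr_gt0// pmulr_lle0 ?invr_gt0//.
  by move/(lt_le_trans t0); rewrite ltxx.
have [K1 K10 HK1] := mulmx_bound (invmx (dmx m)).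
move=> j; exists (fun h => (h *m invmx (dmx m)) 0 j); split.
  by move=> a y z; rewrite mulmxDl -scalemxAl !mxE.
move=> e e0'.
(* [K1] bounds the inverse matrix and [2 * K] is a Lipschitz constant of the local inverse. *)
have e2 : 0 < e / (2 * K * K1) by rewrite divr_gt0// !mulr_gt0.
have [V nV HV] := sdiff_vec Hm e2.
exists (F @` (V^° `&` U)).
  apply: open_nbhs_nbhs; split.
    by apply: opF => [|? []//]; apply: openI => //; exact: open_interior.
  by exists x.
move=> _ _ [a [/interior_subset Va Ua] <-] [b [/interior_subset Vb Ub] <-].
rewrite !HG//.
have := norm_coord (a - b - (F a - F b) *m invmx (dmx m)) j.
rewrite !mxE => /le_trans; apply.
have -> : a - b - (F a - F b) *m invmx (dmx m) =
   - ((F a - F b - (a - b) *m dmx m) *m invmx (dmx m)).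
  by rewrite [in RHS]mulmxBl mulmxK// opprB.
rewrite normrN; apply: (le_trans (HK1 _)).
have := HV _ _ Va Vb; rewrite -(ler_pM2l K10) => /le_trans; apply.
apply: (le_trans (ler_wpM2l (ltW K10) (ler_wpM2l (ltW e2) (lowF _ _ Ua Ub)))).
by rewrite le_eqVlt; apply/orP; left; apply/eqP; field; rewrite !(gt_eqF K0, gt_eqF K10).
Qed.

End InverseFunction.

(** * More strict differentials, and Frechet differentiability *)

Section Differentiability.
Context {R : realType}.
Local Notation C := R[i].

Lemma sdiff_eq n (f g : 'rV[C]_n -> C) u l m :
  sdiff f u l -> f =1 g -> l =1 m -> sdiff g u m.
Proof. by move=> H /funext <- /funext <-. Qed.

Lemma sdiff_sum n (I : finType) (f l : I -> 'rV[C]_n -> C) u :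
  (forall i, sdiff (f i) u (l i)) ->
  sdiff (fun x => \sum_i f i x) u (fun h => \sum_i l i h).
Proof.
move=> H; suff K (s : seq I) : sdiff (fun x => \sum_(i <- s) f i x) u (fun h => \sum_(i <- s) l i h).
  exact: K.
elim: s => [|i s IH].
  by apply: sdiff_eq (sdiff_cst 0 u) _ _ => x; rewrite big_nil.
by apply: sdiff_eq (sdiffD (H i) IH) _ _ => x; rewrite big_cons.
Qed.

Lemma sdiffN n (f : 'rV[C]_n -> C) u l : sdiff f u l ->
  sdiff (fun x => - f x) u (fun h => - l h).
Proof.
move=> sf; apply: sdiff_eq (sdiffM (sdiff_cst (-1) u) sf) _ _ => x.
  by rewrite mulN1r.
by rewrite mulN1r mul0r addr0.
Qed.

Lemma sdiffB n (f g : 'rV[C]_n -> C) u l m :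
  sdiff f u l -> sdiff g u m ->
  sdiff (fun x => f x - g x) u (fun x => l x - m x).
Proof. by move=> sf sg; exact: sdiffD sf (sdiffN sg). Qed.

Lemma sdiffX n (f : 'rV[C]_n -> C) u l k : sdiff f u l ->
  sdiff (fun x => f x ^+ k) u (fun h => f u ^+ k.-1 *+ k * l h).
Proof.
move=> sf; elim: k => [|k IH].
  by apply: sdiff_eq (sdiff_cst 1 u) _ _ => x; rewrite ?expr0// mulr0n mul0r.
apply: sdiff_eq (sdiffM sf IH) _ _ => x; first by rewrite exprS.
case: k IH => [|k] _ /=; first by rewrite !expr0 mulr1n; ring.
rewrite -[f u ^+ k *+ k.+1]mulr_natr -[f u ^+ k.+1 *+ k.+2]mulr_natr -[k.+2%:R]natr1 exprS.
by move: (k.+1%:R) (f u ^+ k) => a b; ring.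
Qed.

(** Both the polynomial and the point move; the uniform bound [N] makes the value a fixed finite sum
    of products. *)
Lemma sdiff_horner n N (p dp : 'rV[C]_n -> {poly C}) t dt u :
  (forall x, (size (p x) <= N)%N) -> (forall h, (size (dp h) <= N)%N) ->
  (forall i, sdiff (fun x => (p x)`_i) u (fun h => (dp h)`_i)) ->
  sdiff t u dt ->
  sdiff (fun x => (p x).[t x]) u
    (fun h => (dp h).[t u] + (p u)^`().[t u] * dt h).
Proof.
move=> Np Ndp Hp Ht.
pose f (i : 'I_N) x := (p x)`_i * t x ^+ i.
have Hf (i : 'I_N) := sdiffM (Hp i) (sdiffX i Ht).
apply: sdiff_eq (sdiff_sum Hf) _ _ => h.
  by rewrite (horner_coef_wide _ (Np h)).
rewrite (horner_coef_wide _ (Ndp h)).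
have -> : p u = \sum_(i < N) (p u)`_i *: 'X^i.
  rewrite -poly_def; apply/polyP => i; rewrite coef_poly; case: ltnP => // h1.
  by rewrite nth_default// (leq_trans (Np u)).
rewrite raddf_sum horner_sum mulr_suml -big_split/=; apply: eq_bigr => i _.
rewrite coef_sum (bigD1 i)//= big1 ?addr0; last first.
  by move=> j ji; rewrite coefZ coefXn eq_sym (negbTE ji : (j == i :> nat) = false) mulr0.
rewrite coefZ coefXn eqxx mulr1 derivZ derivXn hornerZ hornerMn hornerXn.
by rewrite addrC mulrA.
Qed.

Lemma mulmx_continuous n m (A : 'M[C]_(n, m)) :
  continuous (fun x : 'rV[C]_n => x *m A).
Proof.
move=> x B /nbhs_vP[r r0 Hr]; have [M M0 HM] := mulmx_bound A.
apply/nbhs_vP; exists (r / M); first by rewrite divr_gt0.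
move=> y yr; apply: Hr; rewrite -mulmxBl; apply: le_lt_trans (HM _) _.
by rewrite mulrC -ltr_pdivlMr.
Qed.

Lemma differentiable_near n m (f g : 'rV[C]_n -> 'rV[C]_m) u :
  (\forall x \near u, f x = g x) -> differentiable f u -> differentiable g u.
Proof.
move=> fg df; have /diff_locallyP[dc /eqaddoP dE] := df.
have main e : 0 < e ->
    \forall x \near (0 : 'rV[C]_n), `|g (x + u) - (g u + 'd f u x)| <= e * `|x|.
  move=> e0; have := dE e e0.
  have : \forall x \near 0, f (x + u) = g (x + u).
    move/nbhs_vP : fg => [r r0 Hr]; apply/nbhs_vP; exists r => // x.
    by rewrite subr0 => xr; apply: Hr; rewrite addrK.
  apply: filterS2 => x fgx h.
  have : `|f (x + u) - (f u + 'd f u x)| <= e * `|x| by exact: h.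
  by rewrite fgx (nbhs_singleton fg).
have dgu : 'd g u = 'd f u :> (_ -> _).
  by apply: diff_unique => //; apply/eqaddoP => e e0; exact: main.
apply/diff_locallyP; rewrite dgu; split; first exact: dc.
by apply/eqaddoP => e e0; exact: main.
Qed.

Lemma sdiff_differentiable n m (F : 'rV[C]_n -> 'rV[C]_m) u :
  (forall j, exists l, sdiff (fun x => F x 0 j) u l) -> differentiable F u.
Proof.
move=> /choice[l Hl].
pose df : {linear 'rV[C]_n -> 'rV[C]_m} := mulmxr (dmx l).
have dc : continuous df by exact: mulmx_continuous.
have main e : 0 < e ->
    \forall x \near (0 : 'rV[C]_n), `|F (x + u) - (F u + df x)| <= e * `|x|.
  move=> e0; have [U /nbhs_vP[r r0 Hr] HU] := sdiff_vec Hl e0.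
  apply/nbhs_vP; exists r => // x; rewrite subr0 => xr /=.
  have := HU (x + u) u; rewrite addrK => HH.
  rewrite opprD addrA.
  by apply: HH; apply: Hr; rewrite ?addrK// subrr normr0.
have dFu : 'd F u = df :> (_ -> _).
  by apply: diff_unique => //; apply/eqaddoP => e e0; exact: main.
by apply/diff_locallyP; rewrite dFu; split=> //; apply/eqaddoP => e e0; exact: main.
Qed.

Lemma differentiable_mulmx n m (A : 'M[C]_(n, m)) u :
  differentiable (fun x : 'rV[C]_n => x *m A) u.
Proof.
apply: sdiff_differentiable => j; exists (fun x => (x *m A) 0 j).
by apply: sdiff_lin => a x y; rewrite mulmxDl -scalemxAl !mxE.
Qed.

Lemma diff_mulmx n m (A : 'M[C]_(n, m)) u :
  jacobian (fun x : 'rV[C]_n => x *m A) u = A.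
Proof.
have E : (fun x : 'rV[C]_n => x *m A) = (mulmxr A : {linear 'rV[C]_n -> 'rV[C]_m}) by [].
apply/matrixP => i j; rewrite /jacobian mxE E diff_lin; last exact: mulmx_continuous.
by rewrite /= -rowE mxE.
Qed.

End Differentiability.

(** * Charts, compositions and slices *)

Section Charts.
Context {R : realType} {T : topologicalType}.
Local Notation C := R[i].

Lemma open_inI (S A B : set T) : open_in S A -> open_in S B -> open_in S (A `&` B).
Proof.
move=> [Q oO ->] [P oP ->]; exists (Q `&` P); first exact: openI.
by rewrite setIACA setIid.
Qed.

Lemma open_in_sub (S A : set T) : open_in S A -> A `<=` S.
Proof. by move=> [Q _ ->] x []. Qed.

Lemma open_inO (S A Q : set T) : open_in S A -> open Q -> open_in S (A `&` Q).
Proof. by move=> [P oP ->] oO; exists (P `&` Q); [exact: openI|rewrite setIA]. Qed.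

Lemma open_in_setT (A : set T) : open_in setT A <-> open A.
Proof.
by split=> [[Q oO ->]|oA]; [rewrite setTI|exists A => //; rewrite setTI].
Qed.

Lemma chart_inj n (S : set T) (x : chart R T n) p q :
  chart_on S x -> dom x p -> dom x q -> x p = x q -> p = q.
Proof. by move=> [_ xi _] xp xq; apply: xi; rewrite inE. Qed.

(* The values of [G] off the domain are irrelevant: being a transition
   function is a local property. *)
Lemma holo_transition_local n m (S : set T) (x : chart R T n) (y : chart R T m) :
  chart_on S x -> open_in S (dom y) ->
  (forall p, dom x p -> dom y p -> exists G : 'rV[C]_n -> 'rV[C]_m,
     differentiable G (x p) /\ exists2 Q, open Q & Q p /\
       forall q, Q q -> dom x q -> dom y q -> G (x q) = y q) ->
  holo_transition x y.
Proof.
move=> cx oy H; have [ox xi xo] := cx.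
pose G (v : 'rV[C]_n) : 'rV[C]_m :=
  xget 0 [set w | exists p, [/\ dom x p, dom y p, x p = v & y p = w]].
have HG p : dom x p -> dom y p -> G (x p) = y p.
  move=> xp yp; rewrite /G; case: xgetP => [_ -> [q [xq yq xqp <-]]|].
    by rewrite (chart_inj cx xq xp).
  by move=> /(_ (y p)) []; exists p.
have oxy Q : open Q -> open (x @` (dom x `&` dom y `&` Q)).
  move=> oO; apply/xo; first by move=> p [[]].
  by apply: open_inO => //; exact: open_inI.
exists G => //; split; first by have := oxy _ openT; rewrite setIT.
move=> _ [p [xp yp] <-]; have [K [dK [Q oO [Op HK]]]] := H p xp yp.
apply: differentiable_near dK.
have : nbhs (x p) (x @` (dom x `&` dom y `&` Q)).
  by apply: open_nbhs_nbhs; split; [exact: oxy|exists p].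
by apply: filterS => _ [q [[xq yq] Oq] <-]; rewrite HK// HG.
Qed.

Lemma holo_transition_trans n m k (S : set T) (x : chart R T n)
    (z : chart R T k) (y : chart R T m) p :
  open_in S (dom x) -> open_in S (dom z) -> open_in S (dom y) ->
  holo_transition x z -> holo_transition z y ->
  dom x p -> dom y p -> dom z p ->
  exists G : 'rV[C]_n -> 'rV[C]_m,
     differentiable G (x p) /\ exists2 Q, open Q & Q p /\
       forall q, Q q -> dom x q -> dom y q -> G (x q) = y q.
Proof.
move=> ox [Q oO zO] oy [G [oG dG] HG] [K [oK dK] HK] xp yp zp.
exists (K \o G); split.
  apply: differentiable_comp; first by apply: dG; exists p.
  by rewrite HG//; apply: dK; exists p.
exists Q => //; split; first by move: zp; rewrite zO => -[].
move=> q Oq xq yq; have zq : dom z q by rewrite zO; split=> //; exact: (open_in_sub ox).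
by rewrite /= HG// HK.
Qed.

Section Atlas.
Context {n : nat} (atlas : set (chart R T n)).
Hypothesis atlas_holo : forall y, atlas y -> holo_chart setT atlas y.
Hypothesis atlas_cover : forall p, exists2 y, atlas y & dom y p.

Lemma holo_chart_dom_open (x : chart R T n) :
  holo_chart setT atlas x -> open (dom x).
Proof. by move=> [[/open_in_setT]]. Qed.

Lemma holo_chart_trans (x y : chart R T n) :
  holo_chart setT atlas x -> holo_chart setT atlas y -> holo_transition x y.
Proof.
move=> hx hy; have [cx Hx] := hx; have [cy Hy] := hy.
have [ox _ _] := cx; have [oy _ _] := cy.
apply: (holo_transition_local cx) => // p xp yp.
have [z az zp] := atlas_cover p; have [[oz _ _] _] := atlas_holo az.
have [xz _] := Hx _ az; have [_ zy] := Hy _ az.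
exact: (holo_transition_trans ox oz oy xz zy).
Qed.

(** A chart may be followed by a biholomorphic map. This serves for the map given by the inverse
    function theorem, and again to pass from affine charts of the target to arbitrary ones. *)
Lemma holo_chart_comp (x : chart R T n) (U : set 'rV[C]_n)
    (F : 'rV[C]_n -> 'rV[C]_n) (G : 'rV[C]_n -> 'rV[C]_n) :
  holo_chart setT atlas x -> open U ->
  (forall u, U u -> G (F u) = u) ->
  (forall u, U u -> differentiable F u) ->
  (forall u, U u -> differentiable G (F u)) ->
  (forall V, open V -> V `<=` U -> open (F @` V)) ->
  holo_chart setT atlas (Chart (dom x `&` x @^-1` U) (F \o x)).
Proof.
move=> hx oU GF dF dG oF; have [cx Hx] := hx; have [/open_in_setT ox xi xo] := cx.
have odom : open (dom x `&` x @^-1` U).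
  apply/open_in_setT/xo; first by move=> p [].
  have -> : x @` (dom x `&` x @^-1` U) = x @` dom x `&` U.
    by apply/seteqP; split=> [_ [p [xp Up] <-]|_ [[p xp <-] Up]]; [split=> //; exists p|exists p].
  by apply: openI => //; apply/xo => //; exact/open_in_setT.
have cxF : chart_on setT (Chart (dom x `&` x @^-1` U) (F \o x)).
  split=> /=; first exact/open_in_setT.
    move=> p q; rewrite !inE => -[xp Up] [xq Uq] /(congr1 G).
    by rewrite !GF// => /(chart_inj cx xp xq).
  move=> A AU; have AX : A `<=` dom x by move=> p /AU[].
  rewrite (xo A AX); have E : (F \o x) @` A = F @` (x @` A) by rewrite image_comp.
  split=> [oxA|]; rewrite E.
    by apply: oF => // _ [p /AU[_ ?] <-].
  move=> oFA.
  (* Injectivity of [F] on [U] lets openness be pulled back by continuity. *)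
  have -> : x @` A = U `&` F @^-1` (F @` (x @` A)).
    apply/seteqP; split=> [_ [p Ap <-]|u [Uu [_ [p Ap <-]]]].
      by split; [have [_] := AU _ Ap|exists (x p) => //; exists p].
    have [_ Uxp] := AU _ Ap.
    by move=> /(congr1 G); rewrite !GF// => <-; exists p.
  rewrite openE => u [Uu Fu]; apply: filterI; first exact: open_nbhs_nbhs.
  have /differentiable_continuous := dF _ Uu; apply.
  exact: open_nbhs_nbhs.
split=> // y ay; have [xy yx] := Hx _ ay; have [[/open_in_setT oy _ _] _] := atlas_holo ay.
have [cy _] := atlas_holo ay.
split.
- apply: (holo_transition_local cxF); first exact/open_in_setT.
  move=> p [/= xp Up] yp; have [H [oH dH] HH] := xy.
  exists (H \o G); split.
    by apply: differentiable_comp; [exact: dG|rewrite GF//; apply: dH; exists p].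
  by exists setT; [exact: openT|split=> // q _ [/= xq Uq] yq; rewrite GF// HH].
- apply: (holo_transition_local cy); first exact/open_in_setT.
  move=> p yp [/= xp Up]; have [H [oH dH] HH] := yx.
  exists (F \o H); split.
    by apply: differentiable_comp; [apply: dH; exists p|rewrite HH//; exact: dF].
  by exists setT; [exact: openT|split=> // q _ yq [/= xq Uq]; rewrite HH].
Qed.

Section Slices.
Context (M S : set T) (k : nat) (kn : (k <= n)%N).

Definition slice_restr (x : chart R T n) : chart R T k :=
  Chart (S `&` dom x) (fun p => x p *m pid_mx k).

(** The coordinates dropped by the projection to C^k vanish on [S]. *)
Lemma slice_pid (x : chart R T n) p : slice_chart atlas M k S x -> S p -> dom x p ->
  x p *m (pid_mx k : 'M[C]_(n, k)) *m (pid_mx k : 'M[C]_(k, n)) = x p.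
Proof.
move=> [_ _ Hx] Sp xp; rewrite -mulmxA pid_mx_id//; apply/rowP => j.
rewrite mxE (bigD1 j)//= mxE eqxx/= big1 ?addr0; last first.
  by move=> i ij; rewrite mxE (negbTE ij : (i == j :> nat) = false) mulr0.
case: ltnP => [|kj]; first by rewrite mulr1.
by rewrite ((Hx p xp).1 Sp)// mul0r.
Qed.

Lemma slice_chart_on (x : chart R T n) :
  slice_chart atlas M k S x -> chart_on S (slice_restr x).
Proof.
move=> sx; have [[cx Hx] xM HS] := sx; have [/open_in_setT ox xi xo] := cx.
split.
- by exists (dom x).
- move=> p q; rewrite !inE => -[Sp xp] [Sq xq] /= E.
  by apply: (chart_inj cx) => //; rewrite -(slice_pid sx Sp xp) E slice_pid.
- move=> A AS; split=> [[Q oO AO]|oA].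
    (* The image is the trace on C^k of an open set of C^n: by the slice condition, a point of
       [dom x] sent into C^k belongs to [S]. *)
    have -> : slice_restr x @` A =
        (fun v : 'rV[C]_k => v *m (pid_mx k : 'M[C]_(k, n))) @^-1` (x @` (dom x `&` Q)).
      apply/seteqP; split=> [_ [p Ap <-]|v [p [xp Op] E]] /=.
        have [Sp xp] := AS _ Ap; rewrite slice_pid//; exists p => //; split=> //.
        by move: Ap; rewrite AO => -[].
      have Sp : S p.
        apply/(HS p xp) => j kj; rewrite E mxE big1// => i _.
        by rewrite mxE [_ == _](_ : _ = false) ?mulr0//; apply/negbTE; rewrite neq_ltn (leq_trans (ltn_ord i) kj).
      exists p; first by rewrite AO.
      by rewrite /= E -mulmxA pid_mx_id// pid_mx_1 mulmx1.
    move/continuousP : (@mulmx_continuous R k n (pid_mx k)); apply.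
    by apply/xo; [move=> p []|apply/open_in_setT; exact: openI].
  pose Q := dom x `&` x @^-1` ((fun u : 'rV[C]_n => u *m (pid_mx k : 'M[C]_(n, k))) @^-1` (slice_restr x @` A)).
  have oO : open Q.
    apply/open_in_setT/xo; first by move=> p [].
    have -> : x @` Q = x @` dom x `&` (fun u : 'rV[C]_n => u *m (pid_mx k : 'M[C]_(n, k))) @^-1` (slice_restr x @` A).
      by apply/seteqP; split=> [_ [p [xp Up] <-]|_ [[p xp <-] Up]]; [split=> //; exists p|exists p].
    apply: openI; first by apply/xo => //; exact/open_in_setT.
    by move/continuousP : (@mulmx_continuous R n k (pid_mx k)); apply.
  exists Q => //; apply/seteqP; split=> [p Ap|p [Sp [xp [q Aq E]]]].
    by have [Sp xp] := AS _ Ap; split=> //; split=> //; exists p.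
  have [Sq xq] := AS _ Aq.
  suff -> : p = q by [].
  by apply: (chart_inj cx) => //; rewrite -(slice_pid sx Sp xp) -(slice_pid sx Sq xq); congr (_ *m _).
Qed.

(** Inclusion of C^k, then the ambient transition, then projection. *)
Lemma slice_transition (x y : chart R T n) :
  slice_chart atlas M k S x -> slice_chart atlas M k S y ->
  holo_transition (slice_restr x) (slice_restr y).
Proof.
move=> sx sy; have [hx _ _] := sx; have [hy _ _] := sy.
have [G [oG dG] HG] := holo_chart_trans hx hy.
have [oy _ _] := slice_chart_on sy.
apply: (holo_transition_local (slice_chart_on sx)) => // p [Sp xp] [_ yp].
pose i (v : 'rV[C]_k) := v *m (pid_mx k : 'M[C]_(k, n)).
pose o (v : 'rV[C]_n) := v *m (pid_mx k : 'M[C]_(n, k)).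
have ixp : i (slice_restr x p) = x p by rewrite /i slice_pid.
exists (o \o (G \o i)); split.
  apply: differentiable_comp; last exact: differentiable_mulmx.
  apply: differentiable_comp; first exact: differentiable_mulmx.
  by rewrite ixp; apply: dG; exists p.
exists setT; [exact: openT|split=> // q _ [Sq xq] [_ yq] /=].
by rewrite /i slice_pid// HG.
Qed.

Lemma slice_holo_chart (x : chart R T n) : slice_chart atlas M k S x ->
  holo_chart S (submanifold_atlas atlas M k S) (slice_restr x).
Proof.
move=> sx; split; first exact: slice_chart_on.
by move=> _ [y sy <-]; split; exact: slice_transition.
Qed.

End Slices.
End Atlas.
End Charts.

(** * Projective space and its affine atlas *)

Section ProjectiveSpace.
Context {R : realType} {n : nat}.
Local Notation C := R[i].
Local Notation PS := (proj_space R n).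

Definition proj_pt (v : 'rV[C]_n) (v0 : v != 0) : PS :=
  \pi_PS (exist _ v (mem_set v0) : nonzero_vectors R n).

Lemma hcoord_neq0 (p : PS) : hcoord p != 0.
Proof. by rewrite /hcoord; have := set_mem (valP (repr p)). Qed.

Lemma same_lineP (u v : nonzero_vectors R n) :
  reflect (exists2 a, a != 0 & set_val u = a *: set_val v) (same_line u v).
Proof.
apply: (iffP idP) => [/andP[/sub_rVP[a ua] _]|[a a0 uv]].
  exists a => //; apply: contraTneq (valP u) => a0.
  by rewrite -set_valE ua a0 scale0r; apply/negP => /set_mem; rewrite /nonzero_vectors/= eqxx.
rewrite /same_line uv; apply/andP; split; first exact: scalemx_sub.
by rewrite eqmx_scale// submx_refl.
Qed.

Lemma hcoord_pt (v : 'rV[C]_n) (v0 : v != 0) :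
  exists2 a, a != 0 & hcoord (proj_pt v0) = a *: v.
Proof.
have : repr (proj_pt v0) = (exist _ v (mem_set v0) : nonzero_vectors R n) %[mod {eq_quot (same_line_equivRel R n)}].
  exact: reprK.
by move/eqmodP/same_lineP.
Qed.

Lemma proj_eq (p q : PS) a : hcoord p = a *: hcoord q -> p = q.
Proof.
move=> pq; rewrite -[p]reprK -[q]reprK.
apply/eqmodP/same_lineP; exists a => //.
by apply: contra_neq (hcoord_neq0 p) => a0; rewrite pq a0 scale0r.
Qed.

Lemma proj_pt_eq (u v : 'rV[C]_n) (u0 : u != 0) (v0 : v != 0) a :
  a != 0 -> u = a *: v -> proj_pt u0 = proj_pt v0.
Proof.
move=> a0 uv; have [b b0 Hb] := hcoord_pt u0; have [c c0 Hc] := hcoord_pt v0.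
apply: (@proj_eq _ _ (b * a / c)).
by rewrite Hb Hc uv !scalerA mulfVK.
Qed.

Lemma proj_pt_hcoord (p : PS) (v : 'rV[C]_n) (v0 : v != 0) a :
  a != 0 -> v = a *: hcoord p -> proj_pt v0 = p.
Proof.
move=> a0 vp; have [b b0 Hb] := hcoord_pt v0.
by apply: (@proj_eq _ _ (b * a)); rewrite Hb vp scalerA.
Qed.

(** An affine lift of the affine chart, so that computations take place on coefficient vectors, on
    which the polynomials depend linearly. *)
Definition ins (i : 'I_n) (u : 'rV[C]_n.-1) : 'rV[C]_n :=
  \row_j (if unlift i j is Some k then u 0 k else 1).

Lemma insE i u : ins i u 0 i = 1.
Proof. by rewrite mxE unlift_none. Qed.

Lemma ins_lift i u k : ins i u 0 (lift i k) = u 0 k.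
Proof. by rewrite mxE liftK. Qed.

Lemma ins_neq0 i u : ins i u != 0.
Proof.
by apply/eqP => /rowP /(_ i); rewrite insE mxE => /eqP; rewrite oner_eq0.
Qed.

Lemma col'_ins i u : col' i (ins i u) = u.
Proof. by apply/rowP => k; rewrite mxE ins_lift. Qed.

Lemma ins_col' i (v : 'rV[C]_n) : v 0 i = 1 -> ins i (col' i v) = v.
Proof.
move=> vi; apply/rowP => j; rewrite mxE; case: unliftP => [k ->|->//].
by rewrite mxE.
Qed.

Definition affine_pt i u : PS := proj_pt (ins_neq0 i u).

Definition affc (i : 'I_n) (v : 'rV[C]_n) : 'rV[C]_n.-1 := col' i ((v 0 i)^-1 *: v).

Lemma affcZ i a (v : 'rV[C]_n) : a != 0 -> affc i (a *: v) = affc i v.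
Proof.
move=> a0; rewrite /affc mxE scalerA invfM mulrAC mulVf// mul1r //.
Qed.

Lemma affine_chartE i p : affine_chart R i p = affc i (hcoord p).
Proof. by []. Qed.

Lemma affine_chart_pt i (v : 'rV[C]_n) (v0 : v != 0) :
  affine_chart R i (proj_pt v0) = affc i v.
Proof. by rewrite affine_chartE; have [a a0 ->] := hcoord_pt v0; rewrite affcZ. Qed.

Lemma dom_affine_pt' i (v : 'rV[C]_n) (v0 : v != 0) :
  dom (affine_chart R i) (proj_pt v0) <-> v 0 i != 0.
Proof.
have [a a0 E] := hcoord_pt v0; rewrite /= E mxE mulf_eq0 (negbTE a0); tauto.
Qed.

Lemma affine_ptK i u : affine_chart R i (affine_pt i u) = u.
Proof. by rewrite affine_chart_pt /affc insE invr1 scale1r col'_ins. Qed.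

Lemma ins_affine_chart i p : dom (affine_chart R i) p ->
  ins i (affine_chart R i p) = (hcoord p 0 i)^-1 *: hcoord p.
Proof. by move=> pi; rewrite ins_col'// mxE mulVf. Qed.

Lemma affine_chartK i p : dom (affine_chart R i) p ->
  affine_pt i (affine_chart R i p) = p.
Proof.
move=> pi; apply: (@proj_pt_hcoord _ _ _ (hcoord p 0 i)^-1).
  by rewrite invr_eq0.
by rewrite -ins_affine_chart.
Qed.

Lemma hcoord_ins i p : dom (affine_chart R i) p ->
  hcoord p = hcoord p 0 i *: ins i (affine_chart R i p).
Proof. by move=> pi; rewrite ins_affine_chart// scalerA mulfV// scale1r. Qed.

(** The quotient topology made usable: openness is tested on the cone over [A]. *)
Lemma proj_openP (A : set PS) : open A <->
  exists2 Q : set 'rV[C]_n, open Q &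
    forall v (v0 : v != 0), Q v <-> A (proj_pt v0).
Proof.
split=> [[Q oQ QA]|[Q oQ QA]]; exists Q => //.
  move=> v v0; have /= := congr1 (fun B : set (nonzero_vectors R n) => B (exist _ v (mem_set v0))) QA.
  by move=> E; rewrite /proj_pt -[A _]E.
have E (x : nonzero_vectors R n) : \pi_PS x = proj_pt (set_mem (valP x)).
  case: x => v v0; rewrite /proj_pt; congr (\pi_PS (exist _ v _)).
  exact: bool_irrelevance.
apply/seteqP; split=> x; rewrite /preimage/mkset E => Qx; exact/(QA _ (set_mem (valP x))).
Qed.

Lemma ins_continuous i : continuous (ins i).
Proof.
move=> x B /nbhs_vP[r r0 Hr]; apply/nbhs_vP; exists r => // y yr; apply: Hr.
apply: le_lt_trans yr; apply: norm_row_le => // j; rewrite !mxE.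
case: unliftP => [k _|_]; last by rewrite subrr normr0.
by have := norm_coord (y - x) k; rewrite !mxE.
Qed.

Lemma affine_pt_continuous i (A : set PS) : open A -> open (affine_pt i @^-1` A).
Proof.
move=> /proj_openP[Q oQ QA].
have -> : affine_pt i @^-1` A = ins i @^-1` Q.
  by apply/seteqP; split=> u /(QA _ (ins_neq0 i u)).
by move/continuousP : (@ins_continuous i); apply.
Qed.

Lemma sdiff_coord m (j : 'I_m) (u : 'rV[C]_m) : sdiff (fun v => v 0 j) u (fun v => v 0 j).
Proof. by apply: sdiff_lin => a x y; rewrite !mxE. Qed.

Lemma affc_differentiable i (v : 'rV[C]_n) : v 0 i != 0 -> differentiable (affc i) v.
Proof.
move=> vi; apply: sdiff_differentiable => j.
have := sdiffM (sdiffV (sdiff_coord i v) vi) (sdiff_coord (lift i j) v).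
move=> H; eexists; apply: sdiff_eq H _ (fun=> erefl) => w.
by rewrite !mxE.
Qed.

Lemma coord_neq0_near (i : 'I_n) (v : 'rV[C]_n) : v 0 i != 0 -> \forall w \near v, (w : 'rV[C]_n) 0 i != 0.
Proof.
move=> vi; have h : 0 < `|v 0 i| by rewrite normr_gt0.
apply: filterS (sdiff_near (sdiff_coord i v) h) => w.
by apply: contraTneq => ->; rewrite sub0r normrN ltxx.
Qed.

Lemma dom_affine_open (i : 'I_n) : open (dom (affine_chart R i)).
Proof.
apply/proj_openP; exists [set v : 'rV[C]_n | v 0 i != 0].
  by rewrite openE => v /= vi; exact: coord_neq0_near.
by move=> v v0; split=> /dom_affine_pt'.
Qed.

Lemma affine_chart_inj (i : 'I_n) p q : dom (affine_chart R i) p -> dom (affine_chart R i) q ->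
  affine_chart R i p = affine_chart R i q -> p = q.
Proof. by move=> pi qi E; rewrite -(affine_chartK pi) E affine_chartK. Qed.

Lemma affine_chart_on (i : 'I_n) : chart_on setT (affine_chart R i).
Proof.
split; first by apply/open_in_setT; exact: dom_affine_open.
  by move=> p q; rewrite !inE; exact: affine_chart_inj.
move=> A AD; split=> [/open_in_setT oA|oA].
  have -> : affine_chart R i @` A = affine_pt i @^-1` A.
    apply/seteqP; split=> [_ [p Ap <-]|u Au].
      by rewrite /preimage/mkset affine_chartK//; exact: AD.
    by exists (affine_pt i u) => //; rewrite affine_ptK.
  exact: affine_pt_continuous.
apply/open_in_setT/proj_openP.
exists ([set v : 'rV[C]_n | v 0 i != 0] `&` affc i @^-1` (affine_chart R i @` A)).
  rewrite openE => v [/= vi vA]; apply: filterI; first exact: coord_neq0_near.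
  have /differentiable_continuous := affc_differentiable vi; apply.
  exact: open_nbhs_nbhs.
move=> v v0; split=> [[/= vi [p Ap E]]|Av].
  suff -> : proj_pt v0 = p by [].
  apply: (@affine_chart_inj i); [exact/dom_affine_pt'|exact: AD|].
  by rewrite affine_chart_pt.
split; first by apply/(dom_affine_pt' i v0)/AD.
by exists (proj_pt v0) => //; rewrite affine_chart_pt.
Qed.

Lemma affine_transition (i j : 'I_n) : holo_transition (affine_chart R i) (affine_chart R j).
Proof.
apply: (holo_transition_local (affine_chart_on i)).
  by apply/open_in_setT; exact: dom_affine_open.
move=> p pi pj; exists (affc j \o ins i); split.
  apply: differentiable_comp; last first.
    by apply: affc_differentiable; rewrite ins_affine_chart// mxE mulf_neq0// invr_neq0.
  apply: sdiff_differentiable => k; case: (unliftP i k) => [l ->|->].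
    eexists; apply: sdiff_eq (sdiff_coord l _) _ (fun=> erefl) => v.
    by rewrite ins_lift.
  by eexists; apply: sdiff_eq (sdiff_cst 1 _) _ (fun=> erefl) => v; rewrite insE.
exists setT; [exact: openT|split=> // q _ qi qj /=].
by rewrite ins_affine_chart// affcZ// invr_neq0.
Qed.

Lemma proj_atlas_holo x : proj_atlas R n x -> holo_chart setT (proj_atlas R n) x.
Proof.
move=> [i _ <-]; split; first exact: affine_chart_on.
by move=> _ [j _ <-]; split; exact: affine_transition.
Qed.

Lemma proj_atlas_cover p : exists2 x, proj_atlas R n x & dom x p.
Proof.
have := hcoord_neq0 p; apply: contraPP => H; apply/negP; rewrite negbK; apply/eqP/rowP => i.
rewrite [RHS]mxE; apply/eqP; apply: contrapT => /negP h; apply: H.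
by exists (affine_chart R i); [exists i|].
Qed.

End ProjectiveSpace.

(** * Reversed polynomials, orders of vanishing, Wronskians *)

Section ReversedPolynomials.
Context {F : fieldType}.
Implicit Types p q : {poly F}.

(** The polynomial z^n p(1/z), that is the form of degree [n] given by [p], seen from infinity; the
    degree of [p] itself may be smaller. *)
Definition revp n p : {poly F} := \poly_(i < n.+1) p`_(n - i).

Lemma coef_revp n p i : (revp n p)`_i = if (i <= n)%N then p`_(n - i) else 0.
Proof. by rewrite coef_poly ltnS. Qed.

Lemma size_revp n p : (size (revp n p) <= n.+1)%N.
Proof. exact: size_poly. Qed.

Lemma revpK n p : (size p <= n.+1)%N -> revp n (revp n p) = p.
Proof.
move=> sp; apply/polyP => i; rewrite !coef_revp leq_subr.
by case: leqP => [h|h]; [rewrite subKn|rewrite nth_default// (leq_trans sp)].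
Qed.

Lemma revpD n p q : revp n (p + q) = revp n p + revp n q.
Proof. by apply/polyP => i; rewrite !(coef_revp, coefD); case: leqP; rewrite ?addr0. Qed.

Lemma revpZ n a p : revp n (a *: p) = a *: revp n p.
Proof. by apply/polyP => i; rewrite !(coef_revp, coefZ); case: leqP; rewrite ?mulr0. Qed.

Lemma revp0 n : revp n 0 = 0.
Proof. by apply/polyP => i; rewrite !(coef_revp, coef0); case: leqP. Qed.

Lemma revpN n p : revp n (- p) = - revp n p.
Proof. by rewrite -scaleN1r revpZ scaleN1r. Qed.

Lemma revpB n p q : revp n (p - q) = revp n p - revp n q.
Proof. by rewrite revpD revpN. Qed.

Lemma revp_sum n (I : Type) (s : seq I) (P : pred I) (f : I -> {poly F}) :
  revp n (\sum_(i <- s | P i) f i) = \sum_(i <- s | P i) revp n (f i).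
Proof. exact: (big_morph _ (revpD n) (revp0 n)). Qed.

Lemma revpXn n i : (i <= n)%N -> revp n 'X^i = 'X^(n - i).
Proof.
move=> ni; apply/polyP => j; rewrite coef_revp !coefXn.
case: leqP => h; first by congr (_%:R); congr nat_of_bool; lia.
by case: eqP => //; lia.
Qed.

Lemma poly_wide n p : (size p <= n)%N -> p = \sum_(i < n) p`_i *: 'X^i.
Proof.
move=> sp; rewrite -poly_def; apply/polyP => i; rewrite coef_poly.
by case: ltnP => // h; rewrite nth_default// (leq_trans sp).
Qed.

Lemma revpM m n p q : (size p <= m.+1)%N -> (size q <= n.+1)%N ->
  revp (m + n) (p * q) = revp m p * revp n q.
Proof.
move=> sp sq; rewrite {1 2}(poly_wide sp) {1 2}(poly_wide sq).
rewrite mulr_suml !revp_sum mulr_suml; apply: eq_bigr => i _.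
rewrite !mulr_sumr !revp_sum; apply: eq_bigr => j _.
rewrite -scalerAl -scalerAr !revpZ -scalerAl -scalerAr -exprD.
have := ltn_ord i; have := ltn_ord j; rewrite !ltnS => nj mi.
rewrite !revpXn//; last by rewrite leq_add.
by rewrite -exprD; congr (_ *: (_ *: 'X^_)); lia.
Qed.

(** Reversal is multiplicative once degrees are tracked, and it turns X - a into a nonzero multiple
    of X - 1/a. *)
Lemma dvdp_revp n m p a : a != 0 -> (size p <= n.+1)%N ->
  ('X - a%:P) ^+ m %| p -> ('X - a^-1%:P) ^+ m %| revp n p.
Proof.
move=> a0 sp; have [->|p0] := eqVneq p 0; first by rewrite revp0 dvdp0.
case/dvdpP => q pq.
have q0 : q != 0 by apply: contraNneq p0 => q0; rewrite pq q0 mul0r.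
have sE : size p = (size q + m)%N.
  by rewrite pq size_Mmonic ?monic_exp ?monicXsubC// size_exp_XsubC addnS.
have sq1 : (0 < size q)%N by rewrite size_poly_gt0.
have mn : (m <= n)%N by rewrite sE in sp; lia.
have -> : n = (n - m + m)%N by rewrite subnK.
rewrite pq revpM; [|by lia|by rewrite size_exp_XsubC].
apply: dvdp_mull.
have -> : revp m (('X - a%:P) ^+ m) = (revp 1 ('X - a%:P)) ^+ m.
  elim: m {pq sE mn sp} => [|m IH]; first by have := @revpXn 0 0 (leqnn 0); rewrite subnn !expr0.
  by rewrite !exprS -IH -(@revpM 1 m) ?size_XsubC ?size_exp_XsubC// add1n.
have -> : revp 1 ('X - a%:P) = - a *: ('X - a^-1%:P).
  apply/polyP => -[|[|i]]; rewrite coef_revp !(coefZ, coefB, coefX, coefC)/=.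
  - by rewrite sub0r mulrNN mulfV// subr0.
  - by rewrite subr0 mulr1 sub0r.
  - by rewrite subrr mulr0.
by rewrite exprZn dvdpZr ?expf_neq0 ?oppr_eq0.
Qed.

Lemma dvdp_revpE n m p a : a != 0 -> (size p <= n.+1)%N ->
  (('X - a%:P) ^+ m %| revp n p) = (('X - a^-1%:P) ^+ m %| p).
Proof.
move=> a0 sp; apply/idP/idP.
  by move/(dvdp_revp a0 (size_revp n p)); rewrite revpK.
by move/(dvdp_revp (invr_neq0 a0) sp); rewrite invrK.
Qed.

Lemma dvdXnP m p : reflect (forall i, (i < m)%N -> p`_i = 0) ('X^m %| p).
Proof.
apply: (iffP idP) => [/dvdpP[q ->] i im|H]; first by rewrite coefMXn im.
rewrite -[p](poly_take_drop m) (_ : take_poly m p = 0) ?add0r ?dvdp_mulIr//.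
by apply/polyP => i; rewrite coef_take_poly coef0; case: ltnP => // /H.
Qed.

Lemma dvdXn_revp n m p : (size p <= n.+1)%N -> p != 0 ->
  ('X^m %| revp n p) = (m <= n - (size p).-1)%N.
Proof.
move=> sp p0; have s1 : (0 < size p)%N by rewrite size_poly_gt0.
apply/dvdXnP/idP => [H|H i im]; last first.
  have h3 : (size p <= n - i)%N by lia.
  by rewrite coef_revp; case: leqP => // h; rewrite nth_default.
rewrite leqNgt; apply/negP => h.
have := H (n - (size p).-1)%N h; rewrite coef_revp leq_subr subKn; last by lia.
by apply/eqP; rewrite -lead_coefE lead_coef_eq0.
Qed.

Lemma prod_XsubC_exp_dvdp (I : eqType) (s : seq I) (a : I -> F) (m : I -> nat) p :
  uniq s -> {in s &, injective a} ->
  (forall i, i \in s -> ('X - (a i)%:P) ^+ m i %| p) ->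
  \prod_(i <- s) ('X - (a i)%:P) ^+ m i %| p.
Proof.
elim: s => [|i s IH]; first by rewrite big_nil dvd1p.
rewrite cons_uniq => /andP[i_s us] aI H; rewrite big_cons Gauss_dvdp.
  rewrite H ?mem_head//= IH// => [j k js ks|j js].
    by apply: aI; rewrite inE ?js ?ks orbT.
  by apply: H; rewrite inE js orbT.
rewrite big_seq; elim/big_ind : _ => [|p1 p2|j js]; first exact: coprimep1.
  by rewrite coprimepMr => -> ->.
rewrite coprimep_expl// coprimep_expr// coprimep_XsubC root_XsubC.
apply: contraNneq i_s => aij; suff <- : j = i by [].
by apply: aI => //; rewrite ?mem_head// inE js orbT.
Qed.

Lemma size_prod_XsubC_exp (I : Type) (s : seq I) (a : I -> F) (m : I -> nat) :
  size (\prod_(i <- s) ('X - (a i)%:P) ^+ m i) = (\sum_(i <- s) m i).+1.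
Proof.
elim: s => [|i s IH]; first by rewrite !big_nil size_poly1.
rewrite !big_cons size_monicM ?monic_exp ?monicXsubC//.
  by rewrite size_exp_XsubC IH addSn addnS.
by rewrite -size_poly_gt0 IH.
Qed.

(** Euler's identity for a form of degree [n]. *)
Lemma deriv_revp n p : (size p <= n.+1)%N ->
  'X * (revp n p)^`() = n%:R *: revp n p - revp n ('X * p^`()).
Proof.
move=> sp; apply/polyP => k.
rewrite coefB coefZ !coef_revp coefXM coef_deriv !coef_revp coefXM coef_deriv.
case: k => [|k] /=.
  rewrite subn0; case: n sp => [|n] sp /=; first by rewrite mul0r subrr.
  by rewrite mulr_natl subrr.
case: (ltnP k n) => h; last by rewrite mul0rn mulr0 subr0.
case: posnP => h2.
  have -> : n = k.+1 by lia.
  by rewrite subr0 mulr_natl.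
rewrite prednK// mulr_natl -mulrnBr; last by lia.
by congr (_ *+ _); lia.
Qed.

(** The numerator of the derivative of [p / q]. Exchanging [p] and [q] only changes its sign, so its
    zeros do not depend on the chart of the target. *)
Definition wronsk p q : {poly F} := q * p^`() - p * q^`().

Lemma wronskN p q : wronsk q p = - wronsk p q.
Proof. by rewrite /wronsk opprB. Qed.

(** The terms in [n] of Euler's identity cancel. The factor X avoids a division; [wronsk_revp]
    removes it once the degree is known. *)
Lemma wronsk_revp0 n p q : (size p <= n.+1)%N -> (size q <= n.+1)%N ->
  'X * wronsk (revp n p) (revp n q) = - revp (n + n) ('X * wronsk p q).
Proof.
move=> sp sq; rewrite /wronsk !mulrBr !mulrA ![_ * revp n _]mulrC -!mulrA !deriv_revp//.
have sd (r : {poly F}) : (size r <= n.+1)%N -> (size ('X * r^`())%R <= n.+1)%N.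
  move=> sr; apply/leq_sizeP => j nj; rewrite coefXM; case: j nj => // j nj /=.
  by rewrite coef_deriv nth_default ?mul0rn// (leq_trans sr).
rewrite revpB !mulrA ![_ * p]mulrC ![_ * q]mulrC -!mulrA !revpM ?sd//.
rewrite !mulrBr -!scalerAr; set A := revp n p; set B := revp n q.
by rewrite [B * A]mulrC; move: (n%:R *: _) => D; ring.
Qed.

(** Counting degrees only gives 2n - 1. The coefficient of index 2n - 1 vanishes because, up to
    sign, it is the constant term in [wronsk_revp0], whose left side is a multiple of X. *)
Lemma size_wronsk n p q : (size p <= n.+1)%N -> (size q <= n.+1)%N ->
  (size (wronsk p q) <= (n + n).-1)%N.
Proof.
move=> sp sq.
have sD (r t : {poly F}) : (size r <= n.+1)%N -> (size t <= n.+1)%N -> (size (r * t^`())%R <= n + n)%N.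
  move=> sr st; have [->|t0] := eqVneq t^`() 0; first by rewrite mulr0 size_poly0.
  have := size_polyMleq r t^`(); have tt : t != 0 by apply: contraNneq t0 => ->; rewrite deriv0.
  by have := lt_size_deriv tt; move: st sr; lia.
have s1 : (size (wronsk p q) <= n + n)%N.
  by apply: (leq_trans (size_polyD _ _)); rewrite geq_max size_polyN !sD.
apply/leq_sizeP => j nj.
have [h|h] := leqP (n + n) j; first by rewrite nth_default// (leq_trans s1).
have jn : j = (n + n).-1 by lia.
have := congr1 (fun r : {poly F} => r`_0) (wronsk_revp0 sp sq).
rewrite coefXM/= coefN coef_revp/= subn0 coefXM.
case: eqP => [|_]; first by lia.
by rewrite jn => /esym/eqP; rewrite oppr_eq0 => /eqP.
Qed.

Lemma wronsk_revp n p q : (0 < n)%N -> (size p <= n.+1)%N -> (size q <= n.+1)%N ->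
  wronsk (revp n p) (revp n q) = - revp (n + n).-2 (wronsk p q).
Proof.
move=> n0 sp sq; apply: (mulfI (negbT (polyX_eq0 F))).
rewrite (wronsk_revp0 sp sq) mulrN; congr (- _); apply/polyP => k.
rewrite coefXM !coef_revp coefXM.
have s1 := size_wronsk sp sq.
case: k => [|k] /=; last rewrite /=.
  rewrite subn0; case: eqP => // _; apply: nth_default; exact: s1.
case: (ltnP k (n + n)) => h; last by case: leqP => //; lia.
case: eqP => h2; first by case: leqP => //; lia.
case: leqP => h3; last by lia.
by congr (_`_ _); lia.
Qed.

Lemma deriv_nderivn p k : (p^`N(k))^`() = p^`N(k.+1) *+ k.+1.
Proof.
apply/polyP => i; rewrite coef_deriv coefMn !coef_nderivn -!mulrnA.
rewrite addnS addSn; congr (_ *+ _).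
have h := mul_bin_left (k + i).+1 k; rewrite mulnC [RHS]mulnC h.
by congr (_ * _)%N; lia.
Qed.

End ReversedPolynomials.

(** * Taylor coefficients and growth of complex polynomials *)

Section ComplexPolynomials.
Context {R : realType}.
Local Notation C := R[i].
Implicit Types p q : {poly C}.

Lemma poly_ext p q : (forall x, p.[x] = q.[x]) -> p = q.
Proof.
move=> H; apply/eqP; rewrite -subr_eq0; apply: contraT => r0.
have := max_poly_roots r0 (rs := [seq k%:R | k <- iota 0 (size (p - q))]).
rewrite size_map size_iota ltnn; apply.
  by apply/allP => _ /mapP[k _ ->]; rewrite rootE hornerD hornerN H subrr.
rewrite map_inj_uniq ?iota_uniq// => i j /eqP.
by rewrite eqr_nat => /eqP.
Qed.

Lemma taylor_poly p c :
  p \Po ('X + c%:P) = \poly_(i < size p) (p^`N(i)).[c].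
Proof.
apply: poly_ext => x; rewrite horner_comp hornerD hornerX hornerC addrC.
rewrite nderiv_taylor; last exact: mulrC.
by rewrite horner_poly.
Qed.

Lemma nderivn_eq0 p k : (size p <= k)%N -> p^`N(k) = 0.
Proof.
move=> sp; apply/polyP => i; rewrite coef_nderivn coef0 nth_default ?mul0rn//.
by rewrite (leq_trans sp)// leq_addr.
Qed.

(** Translation moves [c] to 0, where the order of vanishing is read on the coefficients. *)
Lemma dvdp_nderivnP p c m :
  reflect (forall k, (k < m)%N -> (p^`N(k)).[c] = 0) (('X - c%:P) ^+ m %| p).
Proof.
have E : (('X - c%:P) ^+ m %| p) = ('X^m %| p \Po ('X + c%:P)).
  apply/idP/idP => /dvdpP[q pq].
    rewrite pq comp_polyM; apply: dvdp_mull.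
    rewrite -[_ \Po _]/(comp_poly ('X + c%:P) _) rmorphXn/= comp_polyB comp_polyX comp_polyC.
    by rewrite addrK.
  have -> : p = (q \Po ('X - c%:P)) * ('X - c%:P) ^+ m.
    have := congr1 (comp_poly ('X - c%:P)) pq.
    rewrite -comp_polyA comp_polyD comp_polyX comp_polyC subrK comp_polyXr => ->.
    by rewrite comp_polyM -[_ \Po _ in X in _ * X]/(comp_poly ('X - c%:P) _) rmorphXn/= comp_polyX.
  exact: dvdp_mulIr.
rewrite E; apply: (iffP (dvdXnP _ _)) => H k km; have := H k km; rewrite taylor_poly coef_poly;
  case: ltnP => // sk; by rewrite nderivn_eq0// horner0.
Qed.

(** The values are compared factor by factor: for a root [z], the distance from [t] to [z] is at
    most |c - z| + |t - c|, and |t - c| is at most |c - z| |t - c| / rho. *)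
Lemma root_free_growth N (w : {poly C}) (c t rho : C) : 0 < rho ->
  (size w <= N.+1)%N -> (forall z, root w z -> rho <= `|z - c|) ->
  `|w.[t]| <= `|w.[c]| * (1 + `|t - c| / rho) ^+ N.
Proof.
move=> rho0 sw Hw; have [->|w0] := eqVneq w 0.
  by rewrite !horner0 normr0 mul0r.
have [r wE] := closed_field_poly_normal w.
have l0 : lead_coef w != 0 by rewrite lead_coef_eq0.
have sr : (size r <= N)%N.
  by have := sw; rewrite wE size_scale// size_prod_XsubC.
have Hr z : z \in r -> rho <= `|z - c|.
  by move=> zr; apply: Hw; rewrite wE rootZ// root_prod_XsubC.
set K := 1 + _ ; have K1 : 1 <= K by rewrite lerDl divr_ge0// ltW.
apply: le_trans (_ : `|w.[c]| * K ^+ size r <= _); last first.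
  by rewrite ler_wpM2l// ler_weXn2l.
rewrite wE !hornerZ !normrM -mulrA ler_wpM2l//.
elim: r {wE sr} Hr => [|z r IH] Hr; first by rewrite !big_nil expr0 mulr1 !hornerE.
rewrite !big_cons !hornerM !normrM exprS !hornerXsubC mulrACA.
apply: ler_pM => //; last by apply: IH => y yr; apply: Hr; rewrite inE yr orbT.
have zc := Hr z (mem_head _ _).
rewrite -[t - z](subrKA c) [`|c - z|]distrC; apply: (le_trans (ler_normD _ _)).
rewrite /K mulrDr mulr1 addrC [`|c - z|]distrC lerD2l mulrCA.
by rewrite ler_peMr// ler_pdivlMr// mul1r.
Qed.

End ComplexPolynomials.

(** * Points of the sphere and zeros of forms *)

Section Sphere.
Context {R : realType}.
Local Notation C := R[i].

Lemma ord2P (j : 'I_2) : j = 0 \/ j = 1.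
Proof. by case: j => [[|[|//]]] h; [left|right]; exact: val_inj. Qed.

(* [spt 1 t] is the finite point t, and [spt 0 t] is the point 1 / t. *)
Definition spt (s : 'I_2) (t : C) : sphere R := affine_pt s (const_mx t).

Definition svec (s : 'I_2) (t : C) : 'rV[C]_2 := ins s (const_mx t).

Lemma svecE (s : 'I_2) (t : C) (j : 'I_2) : svec s t 0 j = if j == s then 1 else t.
Proof.
rewrite mxE; case: unliftP => [k ->|->]; last by rewrite eqxx.
by rewrite mxE eq_sym (negbTE (neq_lift _ _)).
Qed.

Lemma svecZE a (s : 'I_2) (t : C) (j : 'I_2) :
  (a *: svec s t) 0 j = a * (if j == s then 1 else t).
Proof. by rewrite mxE svecE. Qed.

Lemma hcoord_spt s t : exists2 a, a != 0 & hcoord (spt s t : proj_space R 2) = a *: svec s t.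
Proof. exact: hcoord_pt. Qed.

Lemma spt_swap (t : C) : t != 0 -> spt 0 t = spt 1 t^-1.
Proof.
move=> t0; apply: (proj_pt_eq _ _ t0).
rewrite -/(svec 0 t) -/(svec 1 t^-1); apply/rowP => j; rewrite [RHS]mxE !svecE.
by case: (ord2P j) => ->; rewrite /= ?mulr1 ?mulfV.
Qed.

Lemma spt1_inj : injective (spt 1).
Proof.
move=> t u /(congr1 (affine_chart R (1 : 'I_2))).
rewrite !affine_ptK => /rowP /(_ (0 : 'I_1)); by rewrite !mxE.
Qed.

Lemma sphere_cases (z : sphere R) : (exists t, z = spt 1 t) \/ z = spt 0 0.
Proof.
have [z1|z1] := eqVneq (hcoord (z : proj_space R 2) 0 1) 0.
  right; symmetry; apply: (@proj_pt_hcoord _ _ z _ _ (hcoord (z : proj_space R 2) 0 0)^-1).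
    rewrite invr_eq0; apply: contraNneq (hcoord_neq0 (z : proj_space R 2)) => z0.
    by apply/eqP/rowP => j; rewrite [RHS]mxE; case: (ord2P j) => ->.
  rewrite -/(svec 0 0); apply/rowP => j; rewrite [RHS]mxE svecE.
  case: (ord2P j) => -> /=; last by rewrite z1 mulr0.
  rewrite mulVf//; apply: contraNneq (hcoord_neq0 (z : proj_space R 2)) => z0.
  by apply/eqP/rowP => k; rewrite [RHS]mxE; case: (ord2P k) => ->.
left; exists (affine_chart R (1 : 'I_2) z 0 0).
rewrite /spt -[LHS](@affine_chartK _ _ (1 : 'I_2))//; congr affine_pt.
by apply/rowP => j; rewrite [RHS]mxE; congr (affine_chart R 1 z 0 _); exact: ord1.
Qed.

(* The form of degree [n] given by [p], in the coordinate t of [spt s t]. *)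
Definition loc n (s : 'I_2) (p : {poly C}) := if s == 1 then p else revp n p.

Lemma size_loc n s (p : {poly C}) : (size p <= n.+1)%N -> (size (loc n s p) <= n.+1)%N.
Proof. by rewrite /loc; case: ifP => // _ _; exact: size_revp. Qed.

Lemma locD n s (p q : {poly C}) : loc n s (p + q) = loc n s p + loc n s q.
Proof. by rewrite /loc; case: ifP => // _; exact: revpD. Qed.

Lemma locB n s (p q : {poly C}) : loc n s (p - q) = loc n s p - loc n s q.
Proof. by rewrite /loc; case: ifP => // _; exact: revpB. Qed.

Lemma locZ n s a (p : {poly C}) : loc n s (a *: p) = a *: loc n s p.
Proof. by rewrite /loc; case: ifP => // _; exact: revpZ. Qed.

Lemma locM m n s (p q : {poly C}) : (size p <= m.+1)%N -> (size q <= n.+1)%N ->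
  loc (m + n) s (p * q) = loc m s p * loc n s q.
Proof. by rewrite /loc; case: ifP => // _; exact: revpM. Qed.

Lemma loc_wronsk n s (p q : {poly C}) : (0 < n)%N -> (size p <= n.+1)%N -> (size q <= n.+1)%N ->
  exists2 e : C, e != 0 &
    wronsk (loc n s p) (loc n s q) = e *: loc (n + n).-2 s (wronsk p q).
Proof.
move=> n0 sp sq; rewrite /loc; case: ifP => _.
  by exists 1; rewrite ?oner_eq0// scale1r.
by exists (-1); rewrite ?oppr_eq0 ?oner_eq0// wronsk_revp// scaleN1r.
Qed.

Lemma coef_loc_eq0 n s (p : {poly C}) : (size p <= n.+1)%N -> loc n s p = 0 -> p = 0.
Proof.
rewrite /loc; case: ifP => // _ sp /(congr1 (revp n)).
by rewrite revpK// revp0.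
Qed.

(** Gives the two clauses of [order_at] a common form, valid in either coordinate of the sphere. *)
Lemma order_at_spt n s (t : C) (p : {poly C}) m : p != 0 -> (size p <= n.+1)%N ->
  (m <= @order_at R n p (spt s t))%N = (('X - t%:P) ^+ m %| loc n s p).
Proof.
move=> p0 sp.
have fin u : (m <= @order_at R n p (spt 1%R u))%N = (('X - u%:P) ^+ m %| p).
  rewrite /order_at; have [a a0 ->] := hcoord_spt 1 u.
  rewrite !svecZE/= mulr1 (negbTE a0).
  by rewrite mulrAC mulfV// mul1r mup_geq.
case: (ord2P s) => ->; last exact: fin.
have [->|t0] := eqVneq t 0.
  rewrite /order_at; have [a a0 ->] := hcoord_spt 0 0.
  rewrite !svecZE/= mulr0 eqxx subr0.
  by rewrite /loc/= dvdXn_revp.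
by rewrite spt_swap// fin /loc/= dvdp_revpE.
Qed.

(** The finite zeros are bounded by the degree of [p], and the order at infinity by the gap between
    [n] and this degree. *)
Lemma form_zeros n (I : finType) (z : I -> sphere R) (m : I -> nat) (p : {poly C}) :
  injective z -> p != 0 -> (size p <= n.+1)%N ->
  (forall i, (m i <= @order_at R n p (z i))%N) -> (\sum_i m i <= n)%N.
Proof.
move=> zI p0 sp H.
have s1 : (0 < size p)%N by rewrite size_poly_gt0.
pose a i : C := affine_chart R (1 : 'I_2) (z i) 0 0.
pose fin := [pred i | z i != spt 0 0].
have za i : fin i -> z i = spt 1 (a i).
  move=> /eqP zi; have [[t zt]|//] := sphere_cases (z i).
  by rewrite /a zt affine_ptK mxE.
have infl : (\sum_(i | ~~ fin i) m i <= n - (size p).-1)%N.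
  case: (pickP (predC fin)) => [i0 /= i0inf|nof]; last first.
    by rewrite big_pred0.
  rewrite (bigD1 i0)//= big1 ?addn0; last first.
    move=> i /andP[]; rewrite !negbK => /eqP zi /eqP; case; apply: zI.
    by move: i0inf; rewrite negbK => /eqP ->.
  have := H i0; move: i0inf; rewrite negbK => /eqP ->.
  rewrite order_at_spt// /loc/= subr0 dvdXn_revp//.
have finl : (\sum_(i | fin i) m i <= (size p).-1)%N.
  rewrite -ltnS prednK// -(big_filter _ fin) -(size_prod_XsubC_exp _ a).
  apply: dvdp_leq => //; apply: prod_XsubC_exp_dvdp.
  - by rewrite filter_uniq// index_enum_uniq.
  - move=> i j; rewrite !mem_filter => /andP[fi _] /andP[fj _] aij.
    by apply: zI; rewrite (za _ fi) (za _ fj) aij.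
  - move=> i; rewrite mem_filter => /andP[fi _].
    by have := H i; rewrite (za _ fi) order_at_spt.
rewrite (bigID fin)/=; apply: (leq_trans (leq_add finl infl)).
by rewrite subnKC// -ltnS prednK.
Qed.

End Sphere.

(** * Rational maps in local coordinates; Riemann-Hurwitz *)

Section LocalExpressions.
Context {R : realType} {d : nat}.
Local Notation C := R[i].
Local Notation V := 'rV[C]_(d.+1 + d.+1).
Local Notation coefs := (proj_space R (d.+1 + d.+1)).

Definition cmp (j : 'I_2) (v : V) : {poly C} :=
  rVpoly (if j == 0 then lsubmx v else rsubmx v).

Lemma size_cmp j v : (size (cmp j v) <= d.+1)%N.
Proof. exact: size_poly. Qed.

Lemma cmpZ j a v : cmp j (a *: v) = a *: cmp j v.
Proof. by rewrite /cmp; case: ifP => _; rewrite !linearZ. Qed.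

Lemma cmpD j u v : cmp j (u + v) = cmp j u + cmp j v.
Proof. by rewrite /cmp; case: ifP => _; rewrite !raddfD. Qed.

Lemma cmp_eq0 v : cmp 0 v = 0 -> cmp 1 v = 0 -> v = 0.
Proof.
rewrite /cmp/= => /(congr1 (poly_rV : {poly C} -> 'rV_d.+1)) l0.
move=> /(congr1 (poly_rV : {poly C} -> 'rV_d.+1)) r0.
by rewrite -[v]hsubmxK -(rVpolyK (lsubmx v)) l0 -(rVpolyK (rsubmx v)) r0 !raddf0 row_mx0.
Qed.

(* The fraction [cmp 0 v / cmp 1 v], in the coordinate t of [spt s t], is
   [lcl s 0 v / lcl s 1 v]; and [lcl s (oth j) v / lcl s j v] reads it in the
   affine chart [j] of the target. *)
Definition lcl (s j : 'I_2) (v : V) : {poly C} := loc d s (cmp j v).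

Lemma size_lcl s j v : (size (lcl s j v) <= d.+1)%N.
Proof. by rewrite size_loc// size_cmp. Qed.

Lemma lclZ s j a v : lcl s j (a *: v) = a *: lcl s j v.
Proof. by rewrite /lcl cmpZ locZ. Qed.

Lemma lclD s j u v : lcl s j (u + v) = lcl s j u + lcl s j v.
Proof. by rewrite /lcl cmpD locD. Qed.

Definition oth (j : 'I_2) : 'I_2 := if j == 0 then 1 else 0.

Lemma lift_oth (j : 'I_2) (k : 'I_1) : lift j k = oth j.
Proof. by apply: val_inj; case: (ord2P j) => ->; rewrite /= /bump ord1. Qed.

Definition ratv (v : V) : Prop :=
  coprimep (cmp 0 v) (cmp 1 v) /\ maxn (size (cmp 0 v)) (size (cmp 1 v)) = d.+1.

Lemma RatMapsE (f : coefs) : RatMaps R d f <-> ratv (hcoord f).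
Proof. by []. Qed.

Lemma ratvZ a v : a != 0 -> ratv (a *: v) <-> ratv v.
Proof.
by move=> a0; rewrite /ratv !cmpZ coprimepZl// coprimepZr// !size_scale.
Qed.

(** Coprimality excludes common zeros at finite points. At infinity the two values are the
    coefficients of index [d], and one of them is nonzero as the larger degree is [d]. *)
Lemma ratv_lcl s v t : ratv v -> exists j, (lcl s j v).[t] != 0.
Proof.
move=> [cop ms]; apply: contrapT => H.
have H' j : (lcl s j v).[t] = 0 by apply/eqP; apply: contrapT => /negP h; apply: H; exists j.
have fin u : (cmp 0 v).[u] = 0 -> (cmp 1 v).[u] = 0 -> False.
  move=> r0 r1; have := coprimep_root cop; move=> /(_ u).
  by rewrite rootE r0 eqxx r1 eqxx => /(_ isT).
case: (ord2P s) => sE; last by apply: (fin t); [have := H' 0|have := H' 1]; rewrite /lcl sE.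
have [t0|t0] := eqVneq t 0.
  have top j : (cmp j v)`_d = 0.
    by have := H' j; rewrite /lcl sE t0 horner_coef0 coef_revp/= subn0.
  suff : (maxn (size (cmp 0%R v)) (size (cmp 1%R v)) <= d)%N by rewrite ms ltnn.
  have sj j : (size (cmp j v) <= d)%N.
    apply/leq_sizeP => k; rewrite leq_eqVlt => /orP[/eqP <-//|dk].
    by rewrite nth_default// (leq_trans (size_cmp _ _)).
  by rewrite geq_max !sj.
have rj j : (cmp j v).[t^-1] = 0.
  apply/eqP; rewrite -/(root _ _) -dvdp_XsubCl -[_ - _]expr1 -(@dvdp_revpE _ d)//; last exact: size_cmp.
  by rewrite expr1 dvdp_XsubCl rootE -[revp _ _]/(loc d 0 _) -sE -/(lcl _ _ _) H'.
exact: (fin t^-1).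
Qed.

Lemma homog_eval_svec (p : {poly C}) (a : C) s (t : C) : (size p <= d.+1)%N ->
  homog_eval (d := d) p (a *: svec s t) = a ^+ d * (loc d s p).[t].
Proof.
move=> sp; rewrite (horner_coef_wide _ (size_loc s sp)) mulr_sumr.
have E (i : 'I_d.+1) x y : (a * x) ^+ i * (a * y) ^+ (d - i) = a ^+ d * (x ^+ i * y ^+ (d - i)).
  have id : (i <= d)%N by rewrite -ltnS.
  by rewrite !exprMn mulrACA -exprD subnKC.
rewrite /homog_eval; under eq_bigr do rewrite !svecZE -mulrA E.
case: (ord2P s) => ->; rewrite /loc/=.
  rewrite [RHS](reindex_inj rev_ord_inj)/=; apply: eq_bigr => i _.
  have id : (i <= d)%N by rewrite -ltnS.
  rewrite coef_revp subSS leq_subr subKn// expr1n mul1r mulrCA//.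
by apply: eq_bigr => i _; rewrite expr1n mulr1 mulrCA.
Qed.

Variables (f : coefs) (v : V) (a : C).
Hypotheses (a0 : a != 0) (fv : hcoord f = a *: v) (rf : ratv v).

Definition lrow s t : 'rV[C]_2 := \row_j (lcl s j v).[t].

Lemma lrow_neq0 s t : lrow s t != 0.
Proof.
have [j] := ratv_lcl s t rf; apply: contraNneq => /rowP /(_ j).
by rewrite !mxE => ->.
Qed.

Lemma ratmap_spt s t :
  ratmap f (spt s t) = proj_pt (lrow_neq0 s t).
Proof.
have [b b0 zb] := hcoord_spt s t.
pose r : 'rV[C]_2 := \row_(j < 2) homog_eval (d := d) (if j == 0 then numer f else denom f) (hcoord (spt s t : proj_space R 2)).
have rE : r = (a * b ^+ d) *: lrow s t.
  apply/rowP => j; rewrite !mxE zb.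
  have -> : (if j == 0 then numer f else denom f) = cmp j (hcoord f).
    by case: (ord2P j) => ->.
  rewrite homog_eval_svec; last exact: size_cmp.
  by rewrite -/(lcl _ _ _) fv lclZ hornerZ mulrCA mulrA.
have r0 : r != 0 by rewrite rE scaler_eq0 mulf_eq0 negb_or (negbTE a0) expf_eq0 (negbTE b0) andbF lrow_neq0.
rewrite -(@proj_pt_eq _ _ _ _ r0 (lrow_neq0 s t) _ _ rE); last by rewrite mulf_neq0 ?expf_neq0.
(* As [r] is nonzero, [insubd] does not take its default value. *)
rewrite /ratmap /proj_pt; congr (\pi _); apply: val_inj.
rewrite val_insubd -/r /=; case: ifP => //.
by rewrite mem_set.
Qed.

Lemma ratmap_dom s t j :
  dom (affine_chart R j) (ratmap f (spt s t)) <-> (lcl s j v).[t] != 0.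
Proof. by rewrite ratmap_spt; apply: (iff_trans (dom_affine_pt' _ _)); rewrite mxE. Qed.

Lemma ratmap_coord s t j :
  affine_chart R j (ratmap f (spt s t)) = const_mx ((lcl s (oth j) v).[t] / (lcl s j v).[t]).
Proof.
rewrite ratmap_spt affine_chart_pt; apply/rowP => k.
by rewrite /affc !mxE lift_oth mulrC.
Qed.

(** The equation saying that the map takes the same value as at [spt s t]; its order of vanishing at
    [t] is the local degree. *)
Definition tangency s j t : {poly C} :=
  (lcl s j v).[t] *: lcl s (oth j) v - (lcl s (oth j) v).[t] *: lcl s j v.

Hypothesis d_gt0 : (0 < d)%N.

(** Coprime and proportional polynomials are constant, against [d > 0]. *)
Lemma ratv_lin_indep (x y : C) : x *: cmp 0 v = y *: cmp 1 v -> x = 0 /\ y = 0.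
Proof.
case: rf => cop ms xy.
suff K (p q : {poly C}) x' y' : coprimep p q -> maxn (size p) (size q) = d.+1 -> x' *: p = y' *: q -> x' = 0.
  split; first exact: (K _ _ _ _ cop ms xy).
  by apply: (K _ _ _ _ _ _ (esym xy)); rewrite 1?coprimep_sym 1?maxnC.
move=> {}cop {}ms {}xy; apply/eqP; apply: contrapT => /negP x0.
have pq : p = (y' / x') *: q by rewrite mulrC -scalerA -xy scalerA mulVf// scale1r.
have qp : q %| p by rewrite pq -mul_polyC dvdp_mull.
have q1 : size q = 1%N.
  apply/eqP; have := cop; rewrite /coprimep => /eqP c; rewrite -c.
  by rewrite (eqp_size (dvdp_gcd_idr qp)).
have : (size p <= 1)%N by rewrite pq -q1 size_scale_leq.
by move: ms d_gt0; rewrite q1; lia.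
Qed.

Lemma local_degree_spt s j t m :
  (m <= local_degree f (spt s t))%N = (('X - t%:P) ^+ m %| tangency s j t).
Proof.
rewrite /local_degree ratmap_spt.
have [b b0 ->] := hcoord_pt (lrow_neq0 s t).
have ab0 : a * b != 0 by rewrite mulf_neq0.
rewrite !mxE; set p := (X in order_at X _).
have pE : p = (a * b) *: ((lcl s 1 v).[t] *: cmp 0 v - (lcl s 0 v).[t] *: cmp 1 v).
  rewrite /p -[numer f]/(cmp 0 (hcoord f)) -[denom f]/(cmp 1 (hcoord f)) fv !cmpZ.
  rewrite scalerBr !scalerA; congr (_ *: _ - _ *: _); ring.
have p0 : p != 0.
  rewrite pE scaler_eq0 (negbTE ab0)/= subr_eq0; apply/eqP => /ratv_lin_indep[h1 h0].
  have [k] := ratv_lcl s t rf; by case: (ord2P k) => ->; rewrite ?h1 ?h0 eqxx.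
have sp : (size p <= d.+1)%N.
  rewrite pE (leq_trans (size_scale_leq _ _))// (leq_trans (size_polyD _ _))//.
  by rewrite geq_max size_polyN !(leq_trans (size_scale_leq _ _)) ?size_cmp.
rewrite order_at_spt// pE locZ dvdpZr// locB !locZ -!/(lcl _ _ _) /tangency.
by case: (ord2P j) => -> //=; rewrite -[LHS]dvdpNr opprB.
Qed.

(* The Taylor coefficients at [t] of [tangency s j t] when [u = v]; the first one
   is a Wronskian, so that its zeros are the critical points. *)
Definition bcoef s j k (u : V) t : C :=
  (lcl s j u).[t] * ((lcl s (oth j) u)^`N(k)).[t] -
  (lcl s (oth j) u).[t] * ((lcl s j u)^`N(k)).[t].

Lemma local_degree_bcoef s j t m :
  (m < local_degree f (spt s t))%N <-> forall k, (0 < k <= m)%N -> bcoef s j k v t = 0.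
Proof.
rewrite (local_degree_spt s j t).
have E k : ((tangency s j t)^`N(k)).[t] = bcoef s j k v t.
  by rewrite /tangency nderivnB !nderivnZ hornerD hornerN !hornerZ.
split=> [/dvdp_nderivnP H k /andP[_ km]|H]; first by rewrite -E H.
(* The coefficient of index 0 always vanishes, so [m] conditions give order at least [m + 1]. *)
apply/dvdp_nderivnP => k km; rewrite E; case: k km => [|k] km; last by rewrite H.
by rewrite /bcoef !nderivn0 mulrC subrr.
Qed.

Lemma bcoef1 s j u t : bcoef s j 1 u t = (wronsk (lcl s (oth j) u) (lcl s j u)).[t].
Proof. by rewrite /bcoef !nderivn1 /wronsk hornerD hornerN !hornerM. Qed.

(** Otherwise, by coprimality, each of the two polynomials would divide its own derivative, hence be
    constant in characteristic 0. *)
Lemma wronsk_neq0 : wronsk (cmp 0 v) (cmp 1 v) != 0.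
Proof.
case: rf => cop ms; apply/negP => /eqP; rewrite /wronsk => /eqP; rewrite subr_eq0 => /eqP W.
have K (p q : {poly C}) : coprimep p q -> q * p^`() = p * q^`() -> (size q <= 1)%N.
  move=> {}cop {}W; have : q %| q^`().
    by rewrite -(Gauss_dvdpr _ (_ : coprimep q p)) 1?coprimep_sym// -W dvdp_mulr.
  have [->|q0] := eqVneq q 0; first by rewrite size_poly0.
  have [q'0|q'0] := eqVneq q^`() 0.
    move=> _; apply/leq_sizeP => -[//|k] _.
    have /eqP := congr1 (fun r : {poly C} => r`_k) q'0.
    by rewrite coef_deriv coef0 mulrn_eq0/= => /eqP.
  by move/(dvdp_leq q'0); rewrite leqNgt lt_size_deriv.
have := K _ _ cop W; have := K (cmp 1 v) (cmp 0 v); rewrite coprimep_sym => /(_ cop (esym W)).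
by move: ms d_gt0; lia.
Qed.

(** The inequality of Riemann-Hurwitz: a point of local degree above [m i] is a zero of order at
    least [m i] of the Wronskian, a form of degree 2d - 2. *)
Lemma crit_count (I : finType) (z : I -> sphere R) (m : I -> nat) :
  injective z -> (forall i, (m i < local_degree f (z i))%N) ->
  (\sum_i m i <= 2 * d - 2)%N.
Proof.
move=> zI H; have -> : (2 * d - 2 = (d + d).-2)%N by lia.
have sW : (size (wronsk (cmp 0%R v) (cmp 1%R v)) <= (d + d).-2.+1)%N.
  by apply: (leq_trans (size_wronsk (size_cmp 0 v) (size_cmp 1 v))); lia.
apply: (form_zeros zI wronsk_neq0 sW) => i.
have [s [t zE]] : exists s t, z i = spt s t.
  by have [[t ->]|->] := sphere_cases (z i); [exists 1, t|exists 0, 0].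
have := H i; rewrite zE => Hi; rewrite order_at_spt ?wronsk_neq0//.
have [j j0] := ratv_lcl s t rf.
have [e e0 We] := loc_wronsk s d_gt0 (size_cmp 0 v) (size_cmp 1 v).
rewrite -(dvdpZr _ _ e0) -We -!/(lcl _ _ _).
suff : ('X - t%:P) ^+ m i %| wronsk (lcl s (oth j) v) (lcl s j v).
  by case: (ord2P j) => -> //=; rewrite wronskN dvdpNr.
move: Hi; rewrite (local_degree_spt s j) => D.
rewrite -(dvdpZr _ _ j0).
(* The Wronskian being alternating, the tangency polynomial can replace one argument at the cost of
   a constant; it vanishes to order [m i + 1] and its derivative to order [m i]. *)
have -> : (lcl s j v).[t] *: wronsk (lcl s (oth j) v) (lcl s j v) = wronsk (tangency s j t) (lcl s j v).
  rewrite /tangency /wronsk derivB !derivZ -!mul_polyC; ring.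
rewrite /wronsk; apply: dvdp_sub.
  apply: dvdp_mull; case/dvdpP : D => q ->; rewrite derivM deriv_exp derivXsubC mul1r/=.
  by rewrite exprS; apply: dvdp_add; rewrite ?dvdp_mull ?dvdp_mulIr// -mulr_natr dvdp_mulr.
by apply: dvdp_mulr; apply: dvdp_trans D; rewrite exprS dvdp_mulIr.
Qed.

End LocalExpressions.

(** * The implicit function theorem for one unknown *)

Section ImplicitFunction.
Context {R : realType}.
Local Notation C := R[i].

Definition sdiffable n (f : 'rV[C]_n -> C) (u : 'rV[C]_n) := exists l, sdiff f u l.

Lemma sdiffableM n (f g : 'rV[C]_n -> C) u : sdiffable f u -> sdiffable g u -> sdiffable (fun x => f x * g x) u.
Proof. by move=> [l Hl] [m Hm]; eexists; exact: sdiffM Hl Hm. Qed.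

Lemma sdiffable_sum n (I : finType) (f : I -> 'rV[C]_n -> C) u :
  (forall i, sdiffable (f i) u) -> sdiffable (fun x => \sum_i f i x) u.
Proof. by move=> /choice[l Hl]; eexists; exact: sdiff_sum Hl. Qed.

Lemma sdiffable_prod n (I : finType) (f : I -> 'rV[C]_n -> C) u :
  (forall i, sdiffable (f i) u) -> sdiffable (fun x => \prod_i f i x) u.
Proof.
move=> H; suff K (s : seq I) : sdiffable (fun x => \prod_(i <- s) f i x) u by exact: K.
elim: s => [|i s IH].
  have [l Hl] : sdiffable (fun=> 1) u by eexists; exact: sdiff_cst.
  by exists l; apply: sdiff_eq Hl _ (fun=> erefl) => x; rewrite big_nil.
have [l Hl] := sdiffableM (H i) IH.
by exists l; apply: sdiff_eq Hl _ (fun=> erefl) => x; rewrite big_cons.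
Qed.

Lemma sdiffable_det n m (M : 'rV[C]_n -> 'M[C]_m) u :
  (forall i j, sdiffable (fun x => M x i j) u) -> sdiffable (fun x => \det (M x)) u.
Proof.
move=> H; apply: sdiffable_sum => s; apply: sdiffableM; first by eexists; exact: sdiff_cst.
exact: sdiffable_prod.
Qed.

Lemma sdiffable_neq0_near n (f : 'rV[C]_n -> C) u : sdiffable f u -> f u != 0 ->
  \forall x \near u, f x != 0.
Proof.
move=> [l sf] fu; have h : 0 < `|f u| by rewrite normr_gt0.
apply: filterS (sdiff_near sf h) => w.
by apply: contraTneq => ->; rewrite sub0r normrN ltxx.
Qed.

Lemma sdiff_affine n (f l : 'rV[C]_n -> C) u : rv_scalar l ->
  (forall x y, f x - f y = l (x - y)) -> sdiff f u l.
Proof.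
move=> ll H; split=> // e e0; exists setT; first exact: filterT.
by move=> x y _ _; rewrite H subrr normr0 mulr_ge0// ltW.
Qed.

Lemma sdiff_comp_affine n m (g l : 'rV[C]_m -> C) (A : 'M[C]_(n, m)) b u :
  sdiff g (u *m A + b) l -> sdiff (fun x => g (x *m A + b)) u (fun h => l (h *m A)).
Proof.
move=> [ll Hg]; split; first by move=> a x y; rewrite mulmxDl -scalemxAl ll.
move=> e e0; have [M M0 HM] := mulmx_bound A.
have e1 : 0 < e / M by rewrite divr_gt0.
have [U nU HU] := Hg _ e1.
have AB x y : x *m A + b - (y *m A + b) = (x - y) *m A.
  by rewrite mulmxBl opprD addrACA subrr addr0.
exists ((fun x => x *m A + b) @^-1` U).
  move/nbhs_vP : nU => [r r0 Hr]; apply/nbhs_vP; exists (r / M); first by rewrite divr_gt0.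
  move=> x xr; apply: Hr; rewrite AB; apply: le_lt_trans (HM _) _.
  by rewrite mulrC -ltr_pdivlMr.
move=> x y Ux Uy; have := HU _ _ Ux Uy; rewrite AB => /le_trans; apply.
rewrite -mulrA ler_pM2l// mulrC ler_pdivrMr// mulrC; exact: HM.
Qed.

Lemma norm_row_lt n (v : 'rV[C]_n) r : 0 < r -> (forall j, `|v 0 j| < r) -> `|v| < r.
Proof.
move=> r0 H; have [->|v0] := eqVneq `|v| 0; first by [].
by have [[i j] /= E] := mx_norm_neq0 v0; rewrite [`|v|]E (ord1 i).
Qed.

(** The map (u, x) |-> (u, b u x) is locally invertible, and [c u] is the last coordinate of the
    inverse image of (u, 0). The last clause is uniqueness in a disc that does not depend on [u]. *)
Lemma implicit_root n (b : 'rV[C]_n -> C -> C) u0 x0 (l : 'rV[C]_(n + 1) -> C) :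
  let bw (w : 'rV[C]_(n + 1)) := b (lsubmx w) (w 0 (rshift n ord0)) in
  let w0 := row_mx u0 (const_mx x0) in
  sdiff bw w0 l -> l (row_mx 0 (const_mx 1)) != 0 ->
  (\forall w \near w0, sdiffable bw w) -> b u0 x0 = 0 ->
  exists c : 'rV[C]_n -> C, [/\ c u0 = x0,
    \forall u \near u0, sdiffable c u,
    \forall u \near u0, b u (c u) = 0 &
    exists2 r, 0 < r & \forall u \near u0, forall x, `|x - x0| < r -> b u x = 0 -> x = c u].
Proof.
move=> bw w0 sb l1 nb b0.
pose last : 'I_(n + 1) := rshift n ord0.
pose F (w : 'rV[C]_(n + 1)) : 'rV[C]_(n + 1) := row_mx (lsubmx w) (const_mx (bw w)).
pose L (q : 'I_(n + 1)) (h : 'rV[C]_(n + 1)) := if q == last then l h else h 0 q.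
have FE w q : F w 0 q = if q == last then bw w else w 0 q.
  rewrite /F; case: (split_ordP q) => k ->.
    by rewrite row_mxEl mxE eq_lrshift.
  by rewrite row_mxEr mxE (ord1 k) eqxx.
have HF q : sdiff (fun w => F w 0 q) w0 (L q).
  case: (eqVneq q last) => [->|ql].
    by apply: sdiff_eq sb _ _ => w; rewrite ?FE /L eqxx.
  by apply: sdiff_eq (sdiff_coord q w0) _ _ => w; rewrite ?FE /L (negbTE ql).
have HL h : (forall q, L q h = 0) -> h = 0.
  move=> H.
  have hq q : q != last -> h 0 q = 0 by move=> ql; have := H q; rewrite /L (negbTE ql).
  have hE : h = h 0 last *: row_mx 0 (const_mx 1).
    apply/rowP => q; rewrite [RHS]mxE; case: (split_ordP q) => k qk.
      by rewrite qk row_mxEl mxE mulr0 hq// eq_lrshift.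
    by rewrite qk row_mxEr mxE (ord1 k) mulr1.
  have ll : rv_scalar l by case: sb.
  have := H last; rewrite /L eqxx {1}hE rv_scalarZ// => /eqP.
  by rewrite mulf_eq0 (negbTE l1) orbF => /eqP h0; rewrite hE h0 scale0r.
have [U [oU Uw0 FI Fo FG]] := inverse_function HF HL.
have w0last : w0 0 last = x0 by rewrite /w0 row_mxEr mxE.
have w0l : lsubmx w0 = u0 by rewrite row_mxKl.
pose G y := xget w0 [set w | U w /\ F w = y].
have GF w : U w -> G (F w) = w.
  move=> Uw; rewrite /G; case: xgetP => [w' -> [Uw' E]|/(_ w)[]//].
  exact: FI.
pose E (u : 'rV[C]_n) : 'rV[C]_(n + 1) := u *m row_mx 1%:M 0 + 0.
have EE u : E u = row_mx u (const_mx 0).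
  by rewrite /E addr0 mul_mx_row mulmx1 mulmx0.
have Fw0 : F w0 = E u0 by rewrite EE /F w0l /bw w0l -/last w0last b0.
pose c u := G (E u) 0 last.
pose V := [set w : 'rV[C]_(n + 1) | U w /\ sdiffable bw w].
have nV : nbhs w0 V by apply: filterI => //; apply: open_nbhs_nbhs.
have oFV : open (F @` (V^°)).
  by apply: Fo; [exact: open_interior|move=> w /interior_subset[]].
have nE : \forall u \near u0, (F @` (V^°)) (E u).
  have : nbhs (E u0) (F @` (V^°)).
    by apply: open_nbhs_nbhs; split=> //; exists w0.
  move/nbhs_vP => [r r0 Hr]; apply/nbhs_vP; exists r => // u ur; apply: Hr.
  apply: le_lt_trans ur; apply: norm_row_le => // q; rewrite !EE mxE [X in _ + X]mxE.
  case: (split_ordP q) => k ->; rewrite ?row_mxEl ?row_mxEr.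
    by have := norm_coord (u - u0) k; rewrite !mxE.
  by rewrite !mxE subrr normr0.
have cE w : U w -> forall u, F w = E u -> lsubmx w = u /\ bw w = 0 /\ c u = w 0 last.
  move=> Uw u FE'; rewrite /c -FE' GF//; split.
    by have := congr1 lsubmx FE'; rewrite EE /F !row_mxKl.
  by have := congr1 (fun v : 'rV[C]_(n + 1) => v 0 last) FE'; rewrite EE /F !row_mxEr !mxE.
exists c; split.
- by rewrite /c -Fw0 GF.
- apply: filterS nE => u [w /interior_subset[Uw dw] Fw].
  have [|m Hm] := FG G w GF Uw _ last.
    move=> q; case: (eqVneq q last) => [->|ql].
      by case: dw => m Hm; exists m; apply: sdiff_eq Hm _ (fun=> erefl) => x; rewrite FE eqxx.
    by eexists; apply: sdiff_eq (sdiff_coord q w) _ (fun=> erefl) => x; rewrite FE (negbTE ql).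
  rewrite Fw in Hm.
  by exists (fun h => m (h *m row_mx 1%:M 0)); exact: sdiff_comp_affine Hm.
- apply: filterS nE => u [w /interior_subset[Uw _] Fw].
  by have [wl [bw0 cw]] := cE w Uw u Fw; rewrite cw -wl.
- have /nbhs_vP[r r0 Hr] : nbhs w0 U by apply: open_nbhs_nbhs.
  exists r => //; apply/nbhs_vP; exists r => // u ur x xr bux.
  have Uw : U (row_mx u (const_mx x)).
    apply: Hr; apply: norm_row_lt => // q; rewrite mxE [X in _ + X]mxE.
    case: (split_ordP q) => k ->; rewrite /w0 ?row_mxEl ?row_mxEr.
      by apply: le_lt_trans ur; have := norm_coord (u - u0) k; rewrite !mxE.
    by rewrite !mxE.
  have Fw : F (row_mx u (const_mx x)) = E u.
    by rewrite EE /F /bw row_mxKl row_mxEr mxE bux.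
  by have [_ [_ ->]] := cE _ Uw u Fw; rewrite row_mxEr mxE.
Qed.

End ImplicitFunction.

(** * Openness of the space of rational maps *)

Section RatOpen.
Context {R : realType} {d : nat}.
Local Notation C := R[i].
Local Notation V := 'rV[C]_(d.+1 + d.+1).

Lemma rVpoly_eq0 n (x : 'rV[C]_n) : rVpoly x = 0 -> x = 0.
Proof. by move=> /(congr1 (poly_rV : {poly C} -> 'rV_n)); rewrite rVpolyK raddf0. Qed.

(* The Sylvester map (A, B) |-> A * numerator + B * denominator on pairs of
   polynomials of degree < d: it is bijective exactly when the fraction has
   degree d. *)
Definition sylv_fun (v : V) (x : 'rV[C]_(d + d)) : 'rV[C]_(d + d) :=
  poly_rV (rVpoly (lsubmx x) * cmp 0 v + rVpoly (rsubmx x) * cmp 1 v).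

Fact sylv_linear v : linear (sylv_fun v).
Proof.
move=> a x y; rewrite /sylv_fun -linearP; congr poly_rV.
by rewrite !linearP/= !mulrDl -!scalerAl scalerDr addrACA.
Qed.
HB.instance Definition _ v := GRing.isLinear.Build C _ _ _ (sylv_fun v) (sylv_linear v).

Definition sylv v : 'M[C]_(d + d) := lin1_mx (sylv_fun v).

Lemma sylv_size (p : {poly C}) j (v : V) : (size p <= d)%N -> (size (p * cmp j v)%R <= d + d)%N.
Proof.
move=> sp; have := size_polyMleq p (cmp j v); have := size_cmp j v.
have [->|p0] := eqVneq p 0; first by rewrite mul0r size_poly0.
by move: sp; rewrite -size_poly_gt0 in p0; lia.
Qed.

Hypothesis d_gt0 : (0 < d)%N.

(** If A p + B q = 0 with p, q coprime and p of degree [d], then p divides B, of smaller degree; so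
    B = 0 and A = 0. Otherwise q has degree [d] and the roles are exchanged. *)
Lemma ratv_sylv v : ratv v -> \det (sylv v) != 0.
Proof.
move=> [cop ms]; apply/negP => /det0P[x x0]; rewrite mul_rV_lin1/= /sylv_fun => E.
have {}E : rVpoly (lsubmx x) * cmp 0 v + rVpoly (rsubmx x) * cmp 1 v = 0.
  have := congr1 rVpoly E; rewrite poly_rV_K ?raddf0//.
  by rewrite (leq_trans (size_polyD _ _))// geq_max !sylv_size// size_poly.
set A := rVpoly (lsubmx x) in E; set B := rVpoly (rsubmx x) in E.
have sA : (size A <= d)%N by exact: size_poly.
have sB : (size B <= d)%N by exact: size_poly.
suff [A0 B0] : A = 0 /\ B = 0.
  by move: x0; rewrite -[x]hsubmxK (rVpoly_eq0 A0) (rVpoly_eq0 B0) row_mx0 eqxx.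
have K (p q A' B' : {poly C}) : coprimep p q -> (size p = d.+1)%N -> (size B' <= d)%N ->
   A' * p + B' * q = 0 -> A' = 0 /\ B' = 0.
  move=> {}cop sp sB' {}E.
  have p0 : p != 0 by rewrite -size_poly_gt0 sp.
  have B0 : B' = 0.
    apply/eqP; apply: contraTT (sB') => B0; rewrite -ltnNge -sp.
    apply: dvdp_leq => //; rewrite -(Gauss_dvdpl _ cop).
    have -> : B' * q = - A' * p by apply/eqP; rewrite mulNr -addr_eq0 addrC E.
    exact: dvdp_mull.
  split=> //; move: E; rewrite B0 mul0r addr0 => /eqP.
  by rewrite mulf_eq0 (negbTE p0) orbF => /eqP.
have [s0|s0] := eqVneq (size (cmp 0%R v)) d.+1; first exact: (K _ _ _ _ cop s0 sB E).
have s1 : size (cmp 1%R v) = d.+1 by have := size_cmp 0 v; move: ms s0; lia.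
rewrite coprimep_sym in cop; rewrite addrC in E.
by have [] := K _ _ _ _ cop s1 sA E.
Qed.

(** A nonconstant common divisor g gives the kernel element (q / g, - p / g), and two degrees below
    [d] give (q, - p). *)
Lemma sylv_ratv v : \det (sylv v) != 0 -> ratv v.
Proof.
move=> dv.
have key (A B : {poly C}) : (size A <= d)%N -> (size B <= d)%N ->
    A * cmp 0 v + B * cmp 1 v = 0 -> A = 0 /\ B = 0.
  move=> sA sB E.
  have : row_mx (poly_rV A) (poly_rV B) *m sylv v = 0.
    by rewrite mul_rV_lin1/= /sylv_fun row_mxKl row_mxKr !poly_rV_K// E raddf0.
  have U : sylv v \in unitmx by rewrite unitmxE unitfE.
  move=> /(congr1 (mulmx^~ (invmx (sylv v)))); rewrite /= mulmxK// mul0mx => E0.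
  have := congr1 lsubmx E0; have := congr1 rsubmx E0.
  rewrite row_mxKl row_mxKr !raddf0 => rB rA.
  by rewrite -(poly_rV_K sA) -(poly_rV_K sB) rA rB !raddf0.
have nz : ~ (cmp 0 v = 0 /\ cmp 1 v = 0).
  move=> [n0 m0]; have s1 : (size (1%R : {poly C}) <= d)%N by rewrite size_poly1.
  have s0 : (size (0%R : {poly C}) <= d)%N by rewrite size_poly0.
  have [|/eqP] := key 1 0 s1 s0; first by rewrite n0 m0 !mulr0 addr0.
  by rewrite oner_eq0.
split.
  set g := gcdp (cmp 0 v) (cmp 1 v).
  have g0 : g != 0.
    by rewrite /g gcdp_eq0; apply/negP => /andP[/eqP ? /eqP ?]; apply: nz.
  apply: contrapT => /negP ncop.
  have sg : (1 < size g)%N.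
    by move: ncop; rewrite /coprimep -/g; have := size_poly_gt0 g; rewrite g0; lia.
  have d0 : g %| cmp 0 v by exact: dvdp_gcdl.
  have d1 : g %| cmp 1 v by exact: dvdp_gcdr.
  have s j : (size (cmp j v %/ g)%R <= d)%N.
    rewrite size_divp//; apply: leq_trans (leq_sub2r _ (size_cmp j v)) _.
    by case: (size g) sg => [|[|k]] // _; rewrite subSS leq_subr.
  have [|||B0 A0] := key (cmp 1 v %/ g) (- (cmp 0 v %/ g)); rewrite ?size_polyN ?s//.
    apply: (mulIf g0); rewrite mul0r.
    rewrite (_ : _ * g = (cmp 1 v %/ g * g) * cmp 0 v - (cmp 0 v %/ g * g) * cmp 1 v).
      by rewrite !divpK// mulrC subrr.
    by ring.
  apply: nz; rewrite -(divpK d0) -(divpK d1) B0.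
  by move/eqP : A0; rewrite oppr_eq0 => /eqP ->; rewrite !mul0r.
apply/eqP; rewrite eqn_leq geq_max !size_cmp/= ltnNge; apply/negP; rewrite geq_max => /andP[s0 s1].
have [|||B0 A0] := key (cmp 1 v) (- cmp 0 v); rewrite ?size_polyN//.
  by rewrite mulNr mulrC subrr.
apply: nz; split=> //.
by move/eqP : A0; rewrite oppr_eq0 => /eqP.
Qed.

Lemma ratv_near (v0 : V) : ratv v0 -> \forall v \near v0, ratv v.
Proof.
move=> /ratv_sylv dv.
have H : sdiffable (fun v => \det (sylv v)) v0.
  apply: sdiffable_det => i j; eexists; apply: sdiff_lin => a x y.
  have E v : sylv v i j = (rVpoly (lsubmx (delta_mx 0 i)) * cmp 0 v +
      rVpoly (rsubmx (delta_mx 0 i)) * cmp 1 v)`_j by rewrite mxE [LHS]mxE.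
  rewrite !E.
  rewrite !cmpD !cmpZ !mulrDr -!scalerAr !(coefD, coefZ); ring.
by apply: filterS (sdiffable_neq0_near H dv) => v; exact: sylv_ratv.
Qed.

End RatOpen.

(** * Differentials of the tangency coefficients and of the values *)

Section TangencySdiff.
Context {R : realType} {d : nat}.
Local Notation C := R[i].
Local Notation V := 'rV[C]_(d.+1 + d.+1).
Variables (m : nat) (vv dv : 'rV[C]_m -> V) (t dt : 'rV[C]_m -> C) (u : 'rV[C]_m).
Hypotheses (dvl : forall a x y, dv (a *: x + y) = a *: dv x + dv y)
  (vvd : forall x y, vv x - vv y = dv (x - y)) (td : sdiff t u dt).

Lemma lclB s j (x y : V) : lcl s j (x - y) = lcl s j x - lcl s j y.
Proof. by rewrite -scaleN1r lclD lclZ scaleN1r. Qed.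

Lemma sdiff_lcl s j k :
  sdiff (fun w => ((lcl s j (vv w))^`N(k)).[t w]) u
    (fun h => ((lcl s j (dv h))^`N(k)).[t u] +
       (k.+1%:R * ((lcl s j (vv u))^`N(k.+1)).[t u]) * dt h).
Proof.
have := @sdiff_horner R m d.+1 (fun w => (lcl s j (vv w))^`N(k)) (fun h => (lcl s j (dv h))^`N(k)) t dt u.
have sz (w : V) : (size ((lcl s j w)^`N(k))%R <= d.+1)%N.
  apply/leq_sizeP => i di; rewrite coef_nderivn nth_default ?mul0rn//.
  exact: leq_trans (size_lcl s j w) (leq_trans di (leq_addl _ _)).
move=> /(_ (fun w => sz (vv w)) (fun h => sz (dv h)) _ td) H.
apply: sdiff_eq (H _) (fun=> erefl) _ => [i|h].
  apply: sdiff_affine => [a x y|x y].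
    by rewrite dvl lclD lclZ !coef_nderivn coefD coefZ mulrnDl mulrnAr.
  by rewrite -vvd lclB !coef_nderivn coefB mulrnBl.
by rewrite deriv_nderivn hornerMn mulr_natl.
Qed.

(** The factor of [dt] is the derivative in the point, the rest the variation of the map. The
    determinant in this factor vanishes, by [tangent_cross], at a point where b_1 and b_k do. *)
Definition dbcoef s j k (h : 'rV[C]_m) : C :=
  let P := lcl s j (vv u) in let N := lcl s (oth j) (vv u) in
  let dP := lcl s j (dv h) in let dN := lcl s (oth j) (dv h) in
  let x := t u in
  P.[x] * dN^`N(k).[x] - N.[x] * dP^`N(k).[x]
  + (dP.[x] * N^`N(k).[x] - dN.[x] * P^`N(k).[x])
  + (k.+1%:R * bcoef s j k.+1 (vv u) x +
     (P^`().[x] * N^`N(k).[x] - N^`().[x] * P^`N(k).[x])) * dt h.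

Lemma sdiff_bcoef s j k :
  sdiff (fun w => bcoef s j k (vv w) (t w)) u (dbcoef s j k).
Proof.
have H0 i := sdiff_lcl s i 0; have Hk i := sdiff_lcl s i k.
have := sdiffB (sdiffM (H0 j) (Hk (oth j))) (sdiffM (H0 (oth j)) (Hk j)).
move=> H; apply: sdiff_eq H _ _ => h; rewrite /bcoef /dbcoef/= ?nderivn0 ?nderivn1//.
rewrite /bcoef; move: (k.+1%:R) => K.
set a := (lcl s j (vv u)).[_]; set b := (lcl s (oth j) (vv u)).[_].
rewrite mul1r; ring.
Qed.

(** The factor of [dt] is b_1, so that to first order a critical value does not feel the motion of
    the critical point. *)
Lemma sdiff_value s j : (lcl s j (vv u)).[t u] != 0 ->
  sdiff (fun w => (lcl s (oth j) (vv w)).[t w] / (lcl s j (vv w)).[t w]) u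
    (fun h => ((lcl s j (vv u)).[t u] * (lcl s (oth j) (dv h)).[t u] -
       (lcl s (oth j) (vv u)).[t u] * (lcl s j (dv h)).[t u] +
       bcoef s j 1 (vv u) (t u) * dt h) / (lcl s j (vv u)).[t u] ^+ 2).
Proof.
move=> P0; have H0 i := sdiff_lcl s i 0.
have P0' : ((lcl s j (vv u))^`N(0)).[t u] != 0 by rewrite nderivn0.
have H := sdiffM (H0 (oth j)) (sdiffV (H0 j) P0').
apply: sdiff_eq H _ _ => h; rewrite !nderivn0// !nderivn1 /bcoef !nderivn1 !mul1r.
by field.
Qed.

End TangencySdiff.

(** * Separation of points of the sphere *)

Section Separation.
Context {R : realType}.
Local Notation C := R[i].

Lemma spt_cross s1 s2 (x y : C) : spt s1 x = spt s2 y ->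
  svec s1 x 0 0 * svec s2 y 0 1 = svec s1 x 0 1 * svec s2 y 0 0.
Proof.
move=> E; have [a a0 Ha] := hcoord_spt s1 x; have [b b0 Hb] := hcoord_spt s2 y.
move: Ha; rewrite E Hb => ab.
have E' : svec s1 x = (b / a) *: svec s2 y by rewrite mulrC -scalerA ab scalerA mulVf// scale1r.
by rewrite E' !mxE; ring.
Qed.

Lemma cross_spt s1 s2 (x y : C) :
  svec s1 x 0 0 * svec s2 y 0 1 = svec s1 x 0 1 * svec s2 y 0 0 -> spt s1 x = spt s2 y.
Proof.
rewrite !svecE; case: (ord2P s1) => ->; case: (ord2P s2) => -> /=; rewrite ?mulr1 ?mul1r.
- by move=> ->.
- move=> xy; have x0 : x != 0 by apply: contra_eq_neq xy => ->; rewrite mul0r oner_neq0.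
  by rewrite spt_swap// -(mulKf x0 y) -xy mulr1.
- move=> xy; have y0 : y != 0 by apply/eqP => y0; move/eqP: xy; rewrite y0 mulr0 eq_sym oner_eq0.
  by rewrite (spt_swap y0) -(mulfK y0 x) xy mul1r.
- by move=> ->.
Qed.

(** Two points differ exactly when the determinant of their homogeneous coordinates is nonzero, an
    open condition. *)
Lemma spt_separated s1 s2 (x y : C) : spt s1 x <> spt s2 y ->
  exists2 r, 0 < r & forall x' y', `|x' - x| < r -> `|y' - y| < r ->
    spt s1 x' <> spt s2 y'.
Proof.
move=> ne.
pose co (s : 'I_2) (q : 'I_2) (j : 'I_2) (w : 'rV[C]_2) : C := if j == s then 1 else w 0 q.
pose fn w := co s1 0 0 w * co s2 1 1 w - co s1 0 1 w * co s2 1 0 w.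
pose w0 : 'rV[C]_2 := \row_j (if j == 0 then x else y).
have sco s q j : sdiffable (co s q j) w0.
  rewrite /co; case: eqP => _; first by eexists; exact: sdiff_cst.
  by eexists; exact: sdiff_coord.
have sfn : sdiffable fn w0.
  have [l1 H1] := sdiffableM (sco s1 0 0) (sco s2 1 1).
  have [l2 H2] := sdiffableM (sco s1 0 1) (sco s2 1 0).
  by eexists; exact: sdiffB H1 H2.
have fnE (w : 'rV[C]_2) : fn w = svec s1 (w 0 0) 0 0 * svec s2 (w 0 1) 0 1 - svec s1 (w 0 0) 0 1 * svec s2 (w 0 1) 0 0.
  by rewrite /fn /co !svecE.
have fn0 : fn w0 != 0.
  have w00 : w0 0 0 = x by rewrite mxE.
  have w01 : w0 0 1 = y by rewrite mxE.
  by rewrite fnE subr_eq0 w00 w01; apply/eqP => /cross_spt.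
have /nbhs_vP[r r0 Hr] := sdiffable_neq0_near sfn fn0.
exists r => // x' y' xr yr /spt_cross E.
pose w1 : 'rV[C]_2 := \row_j (if j == 0 then x' else y').
have w10 : w1 0 0 = x' by rewrite mxE.
have w11 : w1 0 1 = y' by rewrite mxE.
have := Hr w1; rewrite fnE w10 w11 E subrr eqxx => H.
suff : false by [].
apply: H; apply: norm_row_lt => // j; rewrite !mxE.
by case: ifP.
Qed.

End Separation.

(** * Common radii, auxiliary points, and a determinant *)

Section AvoidingPoints.
Context {R : realType}.
Local Notation C := R[i].

(** The order of C is partial; the inverse of 1 plus the sum of the inverses stands for a
    minimum. *)
Lemma pos_lower_bound (I : finType) (r : I -> C) : (forall i, 0 < r i) ->
  exists2 e : C, 0 < e & forall i, e <= r i.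
Proof.
move=> r0; have S0 : 0 <= \sum_i (r i)^-1 by apply: sumr_ge0 => i _; rewrite invr_ge0 ltW.
have e0 : 0 < (1 + \sum_i (r i)^-1)^-1 by rewrite invr_gt0 ltr_pwDl.
exists (1 + \sum_i (r i)^-1)^-1 => // i.
rewrite -[leRHS]invrK lef_pV2 ?posrE ?invr_gt0 ?r0//; last by rewrite ltr_pwDl.
rewrite (bigD1 i)//= addrCA lerDl addr_ge0//.
by apply: sumr_ge0 => k _; rewrite invr_ge0 ltW.
Qed.

Lemma fresh (s : seq C) : exists x, x \notin s.
Proof.
apply: contrapT => H.
have := @uniq_leq_size C [seq k%:R | k <- iota 0 (size s).+1] s.
rewrite size_map size_iota ltnn => K; suff : false by []; apply: K.
  rewrite map_inj_uniq ?iota_uniq// => i j /eqP.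
  by rewrite eqr_nat => /eqP.
by move=> x _; apply/negPn/negP => xs; apply: H; exists x.
Qed.

Lemma fresh3 (s : seq C) : exists2 x : 'I_3 -> C, injective x & forall e, x e \notin s.
Proof.
have [x1 h1] := fresh s; have [x2 h2] := fresh (x1 :: s).
have [x3 h3] := fresh (x2 :: x1 :: s).
move: h2 h3; rewrite !inE !negb_or => /andP[x21 h2] /and3P[x32 x31 h3].
exists (fun e : 'I_3 => nth 0 [:: x1; x2; x3] e); last by case=> [[|[|[|//]]]].
have u : uniq [:: x1; x2; x3].
  by rewrite /= !inE negb_or eq_sym x21 eq_sym x31 eq_sym x32.
by move=> [a ha] [b hb] /eqP; rewrite nth_uniq// => /eqP/= ab; apply: val_inj.
Qed.

(** [(P', N')] and [(Pk, Nk)] are both proportional to [(P, N)]. *)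
Lemma tangent_cross (P P' N N' Pk Nk : C) : P != 0 -> P * N' = N * P' ->
  P * Nk = N * Pk -> P' * Nk - N' * Pk = 0.
Proof.
move=> P0 h1 hk; apply: (mulfI P0); rewrite mulr0.
have -> : P * (P' * Nk - N' * Pk) = P' * (P * Nk) - (P * N') * Pk by ring.
by rewrite h1 hk; ring.
Qed.

End AvoidingPoints.

(** * The linear part of the lift [ins] *)

Section Insertion.
Context {R : realType} {n : nat}.
Local Notation C := R[i].

Definition insl (i : 'I_n) (u : 'rV[C]_n.-1) : 'rV[C]_n :=
  \row_j (if unlift i j is Some k then u 0 k else 0).

Lemma insl_linear i a x y : insl i (a *: x + y) = a *: insl i x + insl i y.
Proof.
apply/rowP => k; rewrite !mxE; case: unliftP => [l _|_]; first by rewrite !mxE.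
by rewrite mulr0 addr0.
Qed.

Lemma insB i x y : ins i x - ins i y = insl i (x - y).
Proof.
by apply/rowP => k; rewrite !mxE; case: unliftP => [l _|_]; rewrite ?mxE ?subrr.
Qed.

Lemma insl_eq0 i x : insl i x = 0 -> x = 0.
Proof.
move=> /rowP H; apply/rowP => k; have := H (lift i k).
by rewrite !mxE liftK.
Qed.

Lemma insl_at i x : insl i x 0 i = 0.
Proof. by rewrite mxE unlift_none. Qed.

End Insertion.

(** * The chart adapted to the stratum at a given map *)

Section LocalChart.
Context {R : realType} {d nu : nat} (mu : 'I_nu -> nat).
Local Notation C := R[i].
Local Notation V := 'rV[C]_(d.+1 + d.+1).
Local Notation coefs := (proj_space R (d.+1 + d.+1)).
Local Notation n := (d.+1 + d.+1).-1.
Hypotheses (d_ge2 : (2 <= d)%N) (mu_gt0 : forall i, (0 < mu i)%N)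
  (sum_mu : (\sum_(i < nu) mu i = 2 * d - 2)%N).
Variables (f0 : coefs) (c0 : 'I_nu -> sphere R).
Hypotheses (rf0 : RatMaps R d f0) (cr0 : critical_enum mu f0 c0).
Variables (i0 : 'I_(d.+1 + d.+1)) (s j : 'I_nu -> 'I_2) (t : 'I_nu -> C).
Hypothesis (f0i0 : dom (affine_chart R i0) f0).
Hypothesis (c0E : forall i, c0 i = spt (s i) (t i)).
Local Notation u0 := (affine_chart R i0 f0).
Local Notation vec := (ins i0).
Local Notation v0 := (vec u0).
Hypothesis P0 : forall i, (lcl (s i) (j i) v0).[t i] != 0.

Let d_gt0 : (0 < d)%N. Proof. exact: leq_trans d_ge2. Qed.

Definition bc (i : 'I_nu) (k : nat) (u : 'rV[C]_n) (x : C) : C := bcoef (s i) (j i) k (vec u) x.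

Lemma hcoord_vec (g : coefs) : dom (affine_chart R i0) g ->
  hcoord g = hcoord g 0 i0 *: vec (affine_chart R i0 g).
Proof. exact: hcoord_ins. Qed.

Lemma ratv_vec (g : coefs) : dom (affine_chart R i0) g ->
  RatMaps R d g <-> ratv (vec (affine_chart R i0 g)).
Proof.
move=> gi; rewrite RatMapsE {1}(hcoord_vec gi); exact: ratvZ.
Qed.

Lemma local_degree_bc (g : coefs) i x m : dom (affine_chart R i0) g ->
  RatMaps R d g ->
  (m < local_degree g (spt (s i) x))%N <->
  forall k, (0 < k <= m)%N -> bc i k (affine_chart R i0 g) x = 0.
Proof.
move=> gi rg; exact: (local_degree_bcoef gi (hcoord_vec gi) ((ratv_vec gi).1 rg) d_gt0).
Qed.

Lemma bc_eq0 i k : (0 < k <= mu i)%N -> bc i k u0 (t i) = 0.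
Proof.
move=> km; have [_ _ H] := cr0; have := (local_degree_bc i (t i) (mu i) f0i0 rf0).1.
by rewrite -c0E H; apply.
Qed.

Lemma bc_neq0 i : bc i (mu i).+1 u0 (t i) != 0.
Proof.
apply/eqP => b0; have [_ _ H] := cr0.
have : (local_degree f0 (c0 i) <= (mu i).+1)%N by rewrite H.
rewrite leqNgt c0E; case/negP; apply/(local_degree_bc i (t i) _ f0i0 rf0) => k /andP[k0].
by rewrite leq_eqVlt => /orP[/eqP ->//|km]; apply: bc_eq0; rewrite k0.
Qed.

Lemma bc_base i k : (0 < k <= mu i)%N ->
  (lcl (s i) (j i) v0).[t i] * ((lcl (s i) (oth (j i)) v0)^`N(k)).[t i] =
  (lcl (s i) (oth (j i)) v0).[t i] * ((lcl (s i) (j i) v0)^`N(k)).[t i].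
Proof. by move=> /bc_eq0/eqP; rewrite /bc /bcoef subr_eq0 => /eqP. Qed.

Lemma base_cross i k : (0 < k <= mu i)%N ->
  (lcl (s i) (j i) v0)^`().[t i] * ((lcl (s i) (oth (j i)) v0)^`N(k)).[t i] -
  (lcl (s i) (oth (j i)) v0)^`().[t i] * ((lcl (s i) (j i) v0)^`N(k)).[t i] = 0.
Proof.
move=> km; have m1 : (0 < 1 <= mu i)%N by rewrite mu_gt0.
have := bc_base m1; rewrite !nderivn1 => h1.
exact: tangent_cross (P0 i) h1 (bc_base km).
Qed.

Lemma sdiff_bc2 i k (w : 'rV[C]_(n + 1)) :
  sdiff (fun w : 'rV[C]_(n + 1) => bc i k (lsubmx w) (w 0 (rshift n ord0))) w
    (dbcoef (fun w => vec (lsubmx w)) (fun h => insl i0 (lsubmx h))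
      (fun w => w 0 (rshift n ord0)) (fun h => h 0 (rshift n ord0)) w (s i) (j i) k).
Proof.
apply: sdiff_bcoef => [a x y|x y|]; last exact: sdiff_coord.
  by rewrite linearP insl_linear.
by rewrite insB raddfB.
Qed.

Lemma lcl0 s' j' : lcl s' j' (0 : V) = 0.
Proof. by rewrite -(scale0r 0) lclZ scale0r. Qed.

(** At [t i] the derivative of b_(mu i) in the point is [mu i + 1] times b_(mu i + 1), the other
    term vanishing by [base_cross]; it is nonzero as the local degree is exactly [mu i + 1]. *)
Lemma exists_root i : exists c : 'rV[C]_n -> C, [/\ c u0 = t i,
    \forall u \near u0, sdiffable c u,
    \forall u \near u0, bc i (mu i) u (c u) = 0 &
    exists2 r, 0 < r & \forall u \near u0, forall x,
      `|x - t i| < r -> bc i (mu i) u x = 0 -> x = c u].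
Proof.
apply: (implicit_root (sdiff_bc2 i (mu i) _)).
- have mm : (0 < mu i <= mu i)%N by rewrite mu_gt0 leqnn.
  rewrite /dbcoef !row_mxKl row_mxEr mxE.
  have -> : insl i0 (0 : 'rV[C]_n) = 0.
    by apply/rowP => k; rewrite !mxE; case: unliftP => [l _|_]; rewrite ?mxE.
  rewrite !lcl0 !linear0 !horner0 !(mulr0, mul0r, oppr0, add0r, addr0) row_mxEr !mxE.
  by rewrite base_cross// addr0 mulr1 mulf_neq0//; exact: bc_neq0.
- by apply/nbhs_vP; exists 1 => // w _; eexists; exact: sdiff_bc2.
- by apply: bc_eq0; rewrite mu_gt0 leqnn.
Qed.

Lemma near_vec (A : set V) : (\forall v \near v0, A v) -> \forall u \near u0, A (vec u).
Proof. exact: ins_continuous. Qed.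

Lemma near_pair i (A : 'rV[C]_n -> C -> Prop) :
  (\forall w \near row_mx u0 (const_mx (t i)) : 'rV[C]_(n + 1),
      A (lsubmx w) (w 0 (rshift n ord0))) ->
  exists2 r, 0 < r & \forall u \near u0, forall x, `|x - t i| < r -> A u x.
Proof.
move=> /nbhs_vP[r r0 Hr]; exists r => //; apply/nbhs_vP; exists r => // u ur x xr.
have := Hr (row_mx u (const_mx x)); rewrite row_mxKl row_mxEr mxE; apply.
apply: norm_row_lt => // q; rewrite mxE [X in _ + X]mxE.
case: (split_ordP q) => k ->; rewrite ?row_mxEl ?row_mxEr; last by rewrite !mxE.
by apply: le_lt_trans ur; have := norm_coord (u - u0) k; rewrite !mxE.
Qed.

Lemma bc_neq0_near i : exists2 r, 0 < r &
  \forall u \near u0, forall x, `|x - t i| < r -> bc i (mu i).+1 u x != 0.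
Proof.
apply: near_pair; apply: sdiffable_neq0_near; first by eexists; exact: sdiff_bc2.
by rewrite row_mxKl row_mxEr mxE bc_neq0.
Qed.

Lemma lwronsk_neq0 i : wronsk (lcl (s i) (oth (j i)) v0) (lcl (s i) (j i) v0) != 0.
Proof.
have rv : ratv v0 by apply/ratv_vec.
have [e e0 We] := loc_wronsk (s i) d_gt0 (size_cmp 0 v0) (size_cmp 1 v0).
suff W0 : wronsk (lcl (s i) 0 v0) (lcl (s i) 1 v0) != 0.
  by case: (ord2P (j i)) => -> //=; rewrite wronskN oppr_eq0.
rewrite /lcl We scaler_eq0 (negbTE e0)/=; apply/eqP => /coef_loc_eq0 W.
have sW : (size (wronsk (cmp 0%R v0) (cmp 1%R v0)) <= (d + d).-2.+1)%N.
  apply: (leq_trans (size_wronsk (size_cmp 0 v0) (size_cmp 1 v0))).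
  by move: d_gt0; lia.
have /eqP := wronsk_neq0 f0i0 rv d_gt0; apply; exact: W.
Qed.

(* If [u] had no critical point near [t i], then by [root_free_growth] its
   Wronskian would be bounded at [t1] by a constant times its value at [t i],
   which tends to 0, although the value at [t1] stays away from 0. *)
Lemma crit_near i r : 0 < r ->
  \forall u \near u0, exists2 x, `|x - t i| < r & bc i 1 u x = 0.
Proof.
move=> r0.
pose w (u : 'rV[C]_n) := wronsk (lcl (s i) (oth (j i)) (vec u)) (lcl (s i) (j i) (vec u)).
have wE u x : bc i 1 u x = (w u).[x] by rewrite /bc bcoef1.
have sw u : (size (w u) <= (d + d).+1)%N.
  apply: (leq_trans (size_wronsk (size_lcl _ _ _) (size_lcl _ _ _))); lia.
have [t1 w1] : exists t1, (w u0).[t1] != 0.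
  apply: contrapT => H; have /eqP := lwronsk_neq0 i; apply.
  apply: poly_ext => x; rewrite horner0; apply/eqP; apply: contrapT => /negP hx.
  by apply: H; exists x.
have ex x : sdiffable (fun u => (w u).[x]) u0.
  eexists; have := sdiff_bcoef (vv := vec) (dv := insl i0) (fun a x y => insl_linear i0 a x y) (fun x y => insB i0 x y) (sdiff_cst x u0) (s i) (j i) 1.
  move=> H; apply: sdiff_eq H _ (fun=> erefl) => u.
  by rewrite -wE.
pose K := (1 + `|t1 - t i| / r) ^+ (d + d).
have K0 : 0 < K by rewrite exprn_gt0// ltr_pwDl// divr_ge0// ltW.
have W0 : 0 < `|(w u0).[t1]| by rewrite normr_gt0.
have W2 : 0 < `|(w u0).[t1]| / 2 by rewrite divr_gt0.
have [l1 H1] := ex t1; have [l2 H2] := ex (t i).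
have W3 : 0 < `|(w u0).[t1]| / 2 / K by rewrite divr_gt0.
have wt : (w u0).[t i] = 0 by rewrite -wE bc_eq0// mu_gt0.
apply: filterS2 (sdiff_near H1 W2) (sdiff_near H2 W3) => u; rewrite wt subr0 => h1 h2.
apply: contrapT => H.
have Hz z : root (w u) z -> r <= `|z - t i|.
  move=> /eqP wz; rewrite (real_leNgt (gtr0_real r0) (normr_real _)); apply/negP => zr.
  by apply: H; exists z => //; rewrite wE.
have := root_free_growth t1 r0 (sw u) Hz; rewrite -/K => h3.
have h4 : `|(w u).[t1]| < `|(w u0).[t1]| / 2.
  by apply: le_lt_trans h3 _; rewrite -ltr_pdivlMr.
have : `|(w u0).[t1]| < `|(w u0).[t1]|.
  rewrite -{1}[(w u0).[t1]](subKr (w u).[t1]).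
  apply: le_lt_trans (ler_normB _ _) _; rewrite [ltRHS]splitr.
  by rewrite ltrD.
by rewrite ltxx.
Qed.

Variables (e : 'I_3 -> C).
Hypotheses (eI : injective e) (ec0 : forall a i, spt 1 (e a) <> c0 i).

Definition xtra (a : 'I_3) (v : V) : C :=
  (cmp 0 v).[e a] * (cmp 1 v0).[e a] - (cmp 0 v0).[e a] * (cmp 1 v).[e a].

Lemma sdiff_xtra a u : sdiff (fun u => xtra a (vec u)) u (fun h => xtra a (insl i0 h)).
Proof.
have E (x y : V) : xtra a x - xtra a y = xtra a (x - y).
  have -> : x - y = (-1) *: y + x by rewrite scaleN1r addrC.
  by rewrite /xtra !cmpD !cmpZ !hornerD !hornerZ; ring.
apply: sdiff_affine => [b x y|x y]; last by rewrite E insB.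
by rewrite insl_linear /xtra !cmpD !cmpZ !hornerD !hornerZ; ring.
Qed.

Local Notation K := {i : 'I_nu & 'I_(mu i).-1}.
Local Notation J := ('I_nu + 'I_3 + K)%type.

(* The derivatives at [u0] of the functions [coordf] below, up to nonzero
   factors. The variation of [c i] does not contribute, being multiplied by the
   derivative in [x] of N / P or of [bc i k u0 x] for [k < mu i], which vanishes
   at [t i]. *)
Definition dcoordf (q : J) (h : 'rV[C]_n) : C :=
  match q with
  | inl (inl i) => (lcl (s i) (j i) v0).[t i] * (lcl (s i) (oth (j i)) (insl i0 h)).[t i] -
       (lcl (s i) (oth (j i)) v0).[t i] * (lcl (s i) (j i) (insl i0 h)).[t i]
  | inl (inr a) => xtra a (insl i0 h)
  | inr k => let i := tag k in let m := (tagged k).+1 in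
      (lcl (s i) (j i) v0).[t i] * ((lcl (s i) (oth (j i)) (insl i0 h))^`N(m)).[t i] -
      (lcl (s i) (oth (j i)) v0).[t i] * ((lcl (s i) (j i) (insl i0 h))^`N(m)).[t i] +
      ((lcl (s i) (j i) (insl i0 h)).[t i] * ((lcl (s i) (oth (j i)) v0)^`N(m)).[t i] -
       (lcl (s i) (oth (j i)) (insl i0 h)).[t i] * ((lcl (s i) (j i) v0)^`N(m)).[t i])
  end.

(** By coprimality the components of [v] divide those of [w], with the same quotient; as one
    component of [v] has degree [d], this quotient is constant. *)
Lemma ratv_colinear (v w : V) : ratv v -> cmp 0 w * cmp 1 v = cmp 0 v * cmp 1 w ->
  exists a, w = a *: v.
Proof.
move=> [cop ms] E.
have d1 : cmp 0 v %| cmp 0 w by rewrite -(Gauss_dvdpl _ cop) E dvdp_mulr.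
have d2 : cmp 1 v %| cmp 1 w.
  by rewrite -(Gauss_dvdpr _ (_ : coprimep (cmp 1 v) (cmp 0 v))) 1?coprimep_sym// -E dvdp_mull.
case/dvdpP : d1 => p pE; case/dvdpP : d2 => q qE.
have key (p' q' : {poly C}) : (size q' = d.+1)%N -> (size (p' * q')%R <= d.+1)%N ->
    exists a, p' = a%:P.
  move=> sq; have [->|p0] := eqVneq p' 0; first by exists 0.
  have q0 : q' != 0 by rewrite -size_poly_gt0 sq.
  rewrite size_mul// sq addnS/= => h; exists p'`_0; apply: size1_polyC.
  by move: h; rewrite addnC -addn1 leq_add2l.
have s0 j' : (size (cmp j' w) <= d.+1)%N by exact: size_cmp.
have [z0|n0] := eqVneq (cmp 0 v) 0.
  have s1 : size (cmp 1%R v) = 1%N.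
    by have := cop; rewrite z0 coprime0p -size_poly_eq1 => /eqP.
  by exfalso; move: ms; rewrite z0 s1 size_poly0 max0n => -[dd]; move: d_gt0; rewrite -dd.
have [z1|n1] := eqVneq (cmp 1 v) 0.
  have s1 : size (cmp 0%R v) = 1%N.
    by have := cop; rewrite z1 coprimep0 -size_poly_eq1 => /eqP.
  by exfalso; move: ms; rewrite z1 s1 size_poly0 maxn0 => -[dd]; move: d_gt0; rewrite -dd.
have pq : p = q.
  apply: (mulIf (mulf_neq0 n0 n1)).
  by rewrite mulrA -pE E qE; ring.
have [a pa] : exists a, p = a%:P.
  have [h|h] := eqVneq (size (cmp 0%R v)) d.+1.
    by apply: (key _ _ h); rewrite -pE.
  have h1 : size (cmp 1%R v) = d.+1.
    by have := size_cmp 0 v; move: ms h; lia.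
  by apply: (key _ _ h1); rewrite pq -qE.
exists a; apply/eqP; rewrite -subr_eq0; apply/eqP; apply: cmp_eq0.
  by rewrite -scaleN1r cmpD !cmpZ pE pa mul_polyC scaleN1r subrr.
by rewrite -scaleN1r cmpD !cmpZ qE -pq pa mul_polyC scaleN1r subrr.
Qed.

(* [H] is a form of degree 2d. It vanishes to order [mu i] at [c0 i] and also at
   the three points [e a], in all 2d + 1 times, hence [H = 0]: the variation [w]
   is proportional to [v0], and then 0 in the affine chart. *)
Lemma dcoordf_kernel h : (forall q : J, dcoordf q h = 0) -> h = 0.
Proof.
move=> Hq; set w := insl i0 h.
have rv : ratv v0 by apply/ratv_vec.
pose H := cmp 0 w * cmp 1 v0 - cmp 0 v0 * cmp 1 w.
have sH : (size H <= (d + d).+1)%N.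
  apply: (leq_trans (size_polyD _ _)); rewrite geq_max size_polyN.
  have K1 i1 i2 (x y : V) : (size (cmp i1 x * cmp i2 y)%R <= (d + d).+1)%N.
    have := size_polyMleq (cmp i1 x) (cmp i2 y); have := size_cmp i1 x; have := size_cmp i2 y.
    by lia.
  by rewrite !K1.
suff H0 : H = 0.
  have [a wa] := ratv_colinear rv (eqP (etrans (esym (subr_eq0 _ _)) (introT eqP H0))).
  apply: (@insl_eq0 _ _ i0); have := insl_at i0 h; rewrite -/w wa mxE insE mulr1 => ->.
  by rewrite scale0r.
apply: contrapT => /eqP H0.
pose z (q : 'I_nu + 'I_3) := match q with inl i => c0 i | inr a => spt 1 (e a) end.
pose m (q : 'I_nu + 'I_3) := match q with inl i => mu i | inr a => 1%N end.
have zI : injective z.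
  have [c0I _ _] := cr0.
  move=> [i|a] [i'|a'] /=.
  - by move/c0I => ->.
  - by move/esym/ec0.
  - by move/ec0.
  - by move/spt1_inj/eI => ->.
suff : (\sum_q m q <= d + d)%N.
  rewrite big_sumType/= sum_mu sum_nat_const card_ord.
  by move: d_ge2; clear; lia.
apply: (form_zeros zI H0 sH) => -[i|a] /=; last first.
  rewrite order_at_spt// expr1 dvdp_XsubCl rootE; apply/eqP.
  by have := Hq (inl (inr a)); rewrite /= /xtra /loc/= hornerD hornerN !hornerM.
rewrite c0E order_at_spt//.
set P := lcl (s i) (j i) v0; set N := lcl (s i) (oth (j i)) v0.
set dP := lcl (s i) (j i) w; set dN := lcl (s i) (oth (j i)) w.
have Pt : P.[t i] != 0 by exact: P0.
have A0 : P.[t i] * dN.[t i] = N.[t i] * dP.[t i].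
  by apply/eqP; rewrite -subr_eq0; apply/eqP; exact: (Hq (inl (inl i))).
have DA : ('X - (t i)%:P) ^+ mu i %| P.[t i] *: dN - N.[t i] *: dP.
  apply/dvdp_nderivnP => k km; rewrite nderivnB !nderivnZ hornerD hornerN !hornerZ.
  case: k km => [|k] km; first by rewrite !nderivn0 A0 subrr.
  have kk : (k < (mu i).-1)%N by rewrite -ltnS prednK.
  have := Hq (inr (Tagged (fun i => 'I_(mu i).-1) (Ordinal kk))); rewrite /= -/w -/P -/N -/dP -/dN => HH.
  (* The last bracket of [dcoordf] drops out: at [t i], both [(dP, dN)] and the divided derivatives
     of [(P, N)] are proportional to [(P, N)], by [A0] and [bk]. *)
  have bk : P.[t i] * N^`N(k.+1).[t i] = N.[t i] * P^`N(k.+1).[t i].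
    by apply: bc_base; rewrite (ltnW km).
  apply: (mulfI Pt); rewrite mulr0 -[RHS](mulr0 P.[t i]) -HH.
  rewrite [in RHS]mulrDr; set x := P.[t i] * (_ - _) in HH *; rewrite -[LHS]addr0; congr (_ + _).
  have -> : P.[t i] * (dP.[t i] * N^`N(k.+1).[t i] - dN.[t i] * P^`N(k.+1).[t i]) =
    dP.[t i] * (P.[t i] * N^`N(k.+1).[t i]) - (P.[t i] * dN.[t i]) * P^`N(k.+1).[t i] by ring.
  by rewrite bk A0; ring.
have DT : ('X - (t i)%:P) ^+ mu i %| P.[t i] *: N - N.[t i] *: P.
  apply/dvdp_nderivnP => k km; rewrite nderivnB !nderivnZ hornerD hornerN !hornerZ.
  case: k km => [|k] km; first by rewrite !nderivn0 mulrC subrr.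
  by rewrite bc_base ?subrr// (ltnW km).
have DH : ('X - (t i)%:P) ^+ mu i %| dN * P - N * dP.
  rewrite -(dvdpZr _ _ Pt).
  (* [DA] and [DT] apply to the two brackets on the right. *)
  have -> : P.[t i] *: (dN * P - N * dP) = (P.[t i] *: dN - N.[t i] *: dP) * P -
     (P.[t i] *: N - N.[t i] *: P) * dP.
    by rewrite -!mul_polyC; ring.
  by apply: dvdp_sub; apply: dvdp_mulr.
have -> : loc (d + d) (s i) H = lcl (s i) 0 w * lcl (s i) 1 v0 - lcl (s i) 0 v0 * lcl (s i) 1 w.
  by rewrite /H locB !(@locM _ d d) ?size_cmp.
move: DH; rewrite /N /P /dN /dP; case: (ord2P (j i)) => -> //=.
by rewrite -dvdpNr opprB [_ * lcl _ 0 w]mulrC [lcl _ 1 w * _]mulrC.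
Qed.

Variables (c : 'I_nu -> 'rV[C]_n -> C) (D : 'I_nu -> set (sphere R)).
Hypotheses (cu0 : forall i, c i u0 = t i).

(* The critical values, three functions completing them on the stratum, and the
   equations [bc i k u (c i u) = 0], for [0 < k < mu i], of the stratum itself. *)
Definition coordf (q : J) (u : 'rV[C]_n) : C :=
  match q with
  | inl (inl i) => (lcl (s i) (oth (j i)) (vec u)).[c i u] / (lcl (s i) (j i) (vec u)).[c i u]
  | inl (inr a) => xtra a (vec u)
  | inr k => bc (tag k) (tagged k).+1 u (c (tag k) u)
  end.

Lemma sdiffable_bc i k u : sdiffable (c i) u -> sdiffable (fun u => bc i k u (c i u)) u.
Proof.
move=> [l Hl]; eexists; apply: sdiff_bcoef Hl _ _ _; first by move=> a x y; exact: insl_linear.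
by move=> x y; exact: insB.
Qed.

Lemma sdiffable_den i u : sdiffable (c i) u -> sdiffable (fun u => (lcl (s i) (j i) (vec u)).[c i u]) u.
Proof.
move=> [l Hl]; have H := sdiff_lcl (fun a x y => insl_linear i0 a x y) (fun x y => insB i0 x y) Hl (s i) (j i) 0.
by eexists; apply: sdiff_eq H _ (fun=> erefl) => w; rewrite nderivn0.
Qed.

Lemma sdiffable_coordf q u : (forall i, sdiffable (c i) u) ->
  (forall i, (lcl (s i) (j i) (vec u)).[c i u] != 0) -> sdiffable (coordf q) u.
Proof.
move=> cs Pu; case: q => [[i|a]|k] /=.
- have [l Hl] := cs i; eexists.
  exact: (sdiff_value (fun a x y => insl_linear i0 a x y) (fun x y => insB i0 x y) Hl (Pu i)).
- by eexists; exact: sdiff_xtra.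
- exact: sdiffable_bc.
Qed.

Lemma coordf_base : (forall i, sdiffable (c i) u0) ->
  exists l : J -> 'rV[C]_n -> C, (forall q, sdiff (coordf q) u0 (l q)) /\
    forall h, (forall q, l q h = 0) -> h = 0.
Proof.
move=> cs.
have H q : exists l, sdiff (coordf q) u0 l /\ forall h, l h = 0 -> dcoordf q h = 0.
  case: q => [[i|a]|[i m]] /=.
  - have [l Hl] := cs i; eexists; split.
      apply: (sdiff_value (fun a x y => insl_linear i0 a x y) (fun x y => insB i0 x y) Hl).
      by rewrite cu0; exact: P0.
    move=> h; rewrite cu0 -/(bc i 1 u0 (t i)) bc_eq0 ?mu_gt0// mul0r addr0 => /eqP.
    by rewrite mulf_eq0 invr_eq0 expf_eq0/= (negbTE (P0 i)) orbF => /eqP.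
  - by eexists; split; [exact: sdiff_xtra|].
  - have [l Hl] := cs i; eexists; split.
      by apply: (sdiff_bcoef (fun a x y => insl_linear i0 a x y) (fun x y => insB i0 x y) Hl).
    move=> h; rewrite /dbcoef cu0 -/(bc i m.+2 u0 (t i)).
    (* The equations stop at index [mu i - 1], so the next coefficient, which multiplies the motion
       of the point, still vanishes. *)
    have m1 : (0 < m.+1 <= mu i)%N by have := ltn_ord m; have := mu_gt0 i; lia.
    have m2 : (0 < m.+2 <= mu i)%N by have := ltn_ord m; have := mu_gt0 i; lia.
    by rewrite bc_eq0// mulr0 add0r base_cross// mul0r addr0.
have [l Hl] := choice H; exists l; split=> [q|h Hh]; first by have [] := Hl q.
by apply: dcoordf_kernel => q; have [_] := Hl q; apply.
Qed.

(** The sum of the [mu i - 1] is 2d - 2 - nu; with nu + 3 it makes 2d + 1. *)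
Lemma card_J : n = (nu + 3 + #|{: K}|)%N.
Proof.
rewrite card_tagged sumnE big_map big_enum/=.
under eq_bigr do rewrite card_ord.
rewrite (eq_bigl xpredT)//.
have S1 : (\sum_(i < nu) 1 = nu)%N by rewrite sum1_card card_ord.
have E : (\sum_(i < nu) (mu i).-1 + \sum_(i < nu) 1 = \sum_(i < nu) mu i)%N.
  by rewrite -big_split/=; apply: eq_bigr => i _; rewrite addn1 prednK.
move: E; rewrite S1 sum_mu; move: (\sum_(i < nu) (mu i).-1)%N d_ge2 => S; clear; lia.
Qed.

(** The equations come last, as a slice chart requires, and the critical values first, where a
    projection reads them off. *)
Definition idx (q : 'I_n) : J :=
  match fintype.split (cast_ord card_J q) with
  | inl q1 => inl (fintype.split q1)
  | inr k => inr (enum_val k)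
  end.

Lemma idxl (x : 'I_nu + 'I_3) : exists q, idx q = inl x.
Proof.
exists (cast_ord (esym card_J) (lshift _ (unsplit x))).
by rewrite /idx cast_ordKV -[lshift _ _]/(unsplit (inl _)) unsplitK unsplitK.
Qed.

Lemma idxr (k : K) : exists2 q : 'I_n, (nu + 3 <= q)%N & idx q = inr k.
Proof.
exists (cast_ord (esym card_J) (rshift _ (enum_rank k))); first by rewrite /= leq_addr.
by rewrite /idx cast_ordKV -[rshift _ _]/(unsplit (inr _)) unsplitK enum_rankK.
Qed.

Lemma idx_ge (q : 'I_n) : (nu + 3 <= q)%N -> exists k, idx q = inr k.
Proof.
move=> hq; rewrite /idx; case: (split_ordP (cast_ord card_J q)) => k kE; last by exists (enum_val k).
have := congr1 val kE; rewrite /= => qk.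
by have := ltn_ord k; rewrite -qk ltnNge hq.
Qed.

Lemma idx_lt (q : 'I_n) (i : 'I_nu) : val q = val i -> idx q = inl (inl i).
Proof.
move=> qi; rewrite /idx.
have -> : cast_ord card_J q = lshift _ (lshift _ i) by apply: val_inj.
by rewrite -[lshift _ (lshift _ _)]/(unsplit (inl _)) unsplitK -[lshift _ _]/(unsplit (inl _)) unsplitK.
Qed.

Definition Phi (u : 'rV[C]_n) : 'rV[C]_n := \row_q coordf (idx q) u.

Lemma Phi_inverse : (\forall u \near u0, forall i, sdiffable (c i) u) ->
  (\forall u \near u0, forall i, (lcl (s i) (j i) (vec u)).[c i u] != 0) ->
  exists U, [/\ open U, U u0,
    forall x y, U x -> U y -> Phi x = Phi y -> x = y,
    forall Y, open Y -> Y `<=` U -> open (Phi @` Y) &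
    forall x, U x -> differentiable Phi x /\
      forall G, (forall x, U x -> G (Phi x) = x) -> differentiable G (Phi x)].
Proof.
move=> n1 n2.
have PhiE q : (fun x => Phi x 0 q) = coordf (idx q) by apply/funext => x; rewrite mxE.
have [l [Hl lk]] := coordf_base (nbhs_singleton n1).
have [|h Hh|U [oU Uu0 UI Uo UG]] := @inverse_function R n Phi u0 (fun q => l (idx q)).
- by move=> q; rewrite PhiE.
- apply: lk => -[x|k].
    by have [q <-] := idxl x.
  by have [q _ <-] := idxr k.
pose A := [set u | (forall i, sdiffable (c i) u) /\ forall i, (lcl (s i) (j i) (vec u)).[c i u] != 0].
have nA : nbhs u0 A by exact: filterI n1 n2.
have sd x : A x -> forall q, sdiffable (fun x => Phi x 0 q) x.
  by move=> [a1 a2] q; rewrite PhiE; exact: sdiffable_coordf.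
exists (U `&` A^°); split=> //.
- by apply: openI => //; exact: open_interior.
- by move=> x y [Ux _] [Uy _]; exact: UI.
- by move=> Y oY YU; apply: Uo => // y /YU[].
- move=> x [Ux iAx]; have Ax := interior_subset iAx; split.
    by apply: sdiff_differentiable; exact: sd.
  move=> G HG.
  (* [UG] asks for a left inverse on all of [U], and [G] is one on a smaller set only; the two agree
     near [Phi x]. *)
  pose G' y := xget x [set w | U w /\ Phi w = y].
  have G'K w : U w -> G' (Phi w) = w.
    by move=> Uw; rewrite /G'; case: xgetP => [w' -> [Uw' E]|/(_ w)[]//]; exact: UI.
  have dG' : differentiable G' (Phi x).
    by apply: sdiff_differentiable; apply: (UG G' x G'K Ux); exact: sd.
  apply: differentiable_near dG'.
  have : nbhs (Phi x) (Phi @` (U `&` A^°)).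
    apply: open_nbhs_nbhs; split; last by exists x.
    by apply: Uo => [|w []//]; apply: openI => //; exact: open_interior.
  by apply: filterS => _ [w [Uw Aw] <-]; rewrite G'K// HG.
Qed.

Variable rho : C.
Hypotheses (sep : forall i k x y, i != k -> `|x - t i| < rho -> `|y - t k| < rho ->
    spt (s i) x <> spt (s k) y).

Section NearbyMap.
Variables (g : coefs) (x : 'I_nu -> C).
Hypothesis gi : dom (affine_chart R i0) g.
Local Notation u := (affine_chart R i0 g).
Hypotheses (rg : RatMaps R d g) (xt : forall i, `|x i - t i| < rho)
  (xuniq : forall i y, `|y - t i| < rho -> bc i (mu i) u y = 0 -> y = x i)
  (bc_top : forall i y, `|y - t i| < rho -> bc i (mu i).+1 u y != 0)
  (crit_ex : forall i, exists2 y, `|y - t i| < rho & bc i 1 u y = 0).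

Lemma local_degree_le i y : `|y - t i| < rho ->
  (local_degree g (spt (s i) y) <= (mu i).+1)%N.
Proof.
move=> yt; rewrite leqNgt; apply/negP => /(local_degree_bc _ _ _ gi rg) H.
by have := bc_top yt; rewrite H ?leqnn// eqxx.
Qed.

(* The map [g] has a critical point near each of the [nu] points [t i], of
   multiplicity at most [mu i]; the multiplicities of [g] having the same sum,
   all these bounds are equalities. *)
Lemma zero_of_crit c' : critical_enum mu g c' ->
  forall i k, (0 < k <= mu i)%N -> bc i k u (x i) = 0.
Proof.
move=> [c'I c'crit c'deg].
have /choice[y Hy] : forall i, exists y, `|y - t i| < rho /\ bc i 1 u y = 0.
  by move=> i; have [y] := crit_ex i; exists y.
have /choice[sg Hsg] : forall i, exists k, c' k = spt (s i) (y i).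
  move=> i; apply/c'crit; rewrite /critical; apply/(local_degree_bc _ _ _ gi rg) => k.
  by case: k => [|[|k]]// _; have [] := Hy i.
have sgI : injective sg.
  move=> i k ik; apply/eqP; apply: contrapT => /negP nik.
  apply: (sep nik (Hy i).1 (Hy k).1).
  by rewrite -!Hsg ik.
have le i : (mu (sg i) <= mu i)%N.
  by have := local_degree_le (Hy i).1; rewrite -Hsg c'deg.
(* [sg] permutes the indices, so the two sides of [le] have the same sum, which forces equality for
   each [i]. *)
have eq i : mu (sg i) = mu i.
  have L k (_ : true) := leqif_eq (le k).
  have R0 : (\sum_k mu (sg k) = \sum_k mu k)%N by rewrite [RHS](reindex_inj sgI).
  have [_] := leqif_sum L; rewrite R0 eqxx => /esym/forallP/(_ i).
  by move=> /= /eqP.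
have deg i : local_degree g (spt (s i) (y i)) = (mu i).+1 by rewrite -Hsg c'deg eq.
have zero i : forall k, (0 < k <= mu i)%N -> bc i k u (y i) = 0.
  by apply/(local_degree_bc _ _ _ gi rg); rewrite deg.
move=> i k km; have <- : y i = x i; last exact: zero.
by apply: xuniq; [exact: (Hy i).1|apply: zero; rewrite mu_gt0 leqnn].
Qed.

(** One more critical point [z] would bring the total multiplicity to 2d - 1, against
    [crit_count]. *)
Lemma crit_of_zero : (forall i k, (0 < k <= mu i)%N -> bc i k u (x i) = 0) ->
  critical_enum mu g (fun i => spt (s i) (x i)).
Proof.
move=> zero.
have zI : injective (fun i => spt (s i) (x i)).
  move=> i k; have [//|ik] := eqVneq i k.
  by move/(sep ik (xt i) (xt k)).
have degl i : (mu i < local_degree g (spt (s i) (x i)))%N.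
  by apply/(local_degree_bc _ _ _ gi rg) => k; exact: zero.
have deg i : local_degree g (spt (s i) (x i)) = (mu i).+1.
  by apply/eqP; rewrite eqn_leq degl local_degree_le.
split=> // z; split=> [zc|[i <-]]; last by rewrite /critical deg ltnS.
apply: contrapT => nz.
pose zz (q : 'I_nu + unit) := match q with inl i => spt (s i) (x i) | inr _ => z end.
pose mm (q : 'I_nu + unit) := match q with inl i => mu i | inr _ => 1%N end.
have zzI : injective zz.
  move=> [i|[]] [k|[]] //=.
  - by move/zI => ->.
  - by move=> zi; case: nz; exists i.
  - by move=> zi; case: nz; exists k.
have rv : ratv (vec u) by apply/ratv_vec.
have := crit_count gi (hcoord_vec gi) rv d_gt0 zzI (m := mm).
rewrite big_sumType/= sum_mu sum_nat_const card_unit => H.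
suff : (2 * d - 2 + 1 * 1 <= 2 * d - 2)%N by move: d_ge2; clear; lia.
by apply: H => -[i|[]]; [exact: degl|exact: zc].
Qed.

End NearbyMap.

Hypotheses (nc : forall i, \forall u \near u0, sdiffable (c i) u)
  (nb : forall i, \forall u \near u0, bc i (mu i) u (c i u) = 0)
  (nu_ : forall i, \forall u \near u0, forall y, `|y - t i| < rho ->
      bc i (mu i) u y = 0 -> y = c i u)
  (nt : forall i, \forall u \near u0, forall y, `|y - t i| < rho ->
      bc i (mu i).+1 u y != 0)
  (rho0 : 0 < rho)
  (HD : forall i y, `|y - t i| < rho -> D i (spt (s i) y)).

(** The chart is [Phi] read in the affine chart, restricted to where all conditions valid near [u0]
    hold at once. There [zero_of_crit] and [crit_of_zero] are the two directions of the slice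
    condition. *)
Lemma local_chart_aux :
  exists (X : chart R coefs n), [/\
    slice_chart (proj_atlas R _) (RatMaps R d) (nu + 3)%N (RatMaps_mu R d mu) X,
    dom X f0,
    dom X `<=` dom (affine_chart R i0),
    (forall g, dom X g -> RatMaps_mu R d mu g ->
       critical_enum mu g (fun i => spt (s i) (c i (affine_chart R i0 g))) /\
       forall i, D i (spt (s i) (c i (affine_chart R i0 g)))) &
    (forall g i, dom X g ->
       dom (affine_chart R (j i)) (ratmap g (spt (s i) (c i (affine_chart R i0 g)))) /\
       forall q : 'I_n, val q = val i ->
       affine_chart R (j i) (ratmap g (spt (s i) (c i (affine_chart R i0 g)))) =
       const_mx (X g 0 q))].
Proof.
have nP i : \forall u \near u0, (lcl (s i) (j i) (vec u)).[c i u] != 0.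
  apply: sdiffable_neq0_near; first by apply: sdiffable_den; exact: nbhs_singleton (nc i).
  by rewrite cu0; exact: P0.
have n6 i : \forall u \near u0, `|c i u - t i| < rho.
  have [l Hl] := nbhs_singleton (nc i).
  by have := sdiff_near Hl rho0; rewrite cu0.
have nr : \forall u \near u0, ratv (vec u).
  by apply: near_vec; apply: ratv_near => //; apply/ratv_vec.
have n9 i : \forall u \near u0, exists2 y, `|y - t i| < rho & bc i 1 u y = 0.
  exact: crit_near.
have [|| U [oU Uu0 UI Uo Ud]] := Phi_inverse.
- exact: (@filter_forall _ _ (fun i u => sdiffable (c i) u) (nbhs u0) _ nc).
- exact: (@filter_forall _ _ (fun i u => (lcl (s i) (j i) (vec u)).[c i u] != 0) (nbhs u0) _ nP).
pose A := [set u | [/\ ratv (vec u),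
  forall i, bc i (mu i) u (c i u) = 0,
  forall i, (forall y, `|y - t i| < rho -> bc i (mu i) u y = 0 -> y = c i u) /\
    (forall y, `|y - t i| < rho -> bc i (mu i).+1 u y != 0),
  forall i, (exists2 y, `|y - t i| < rho & bc i 1 u y = 0) /\ `|c i u - t i| < rho &
  forall i, (lcl (s i) (j i) (vec u)).[c i u] != 0]].
have nA : nbhs u0 A.
  pose B i := [set u | (bc i (mu i) u (c i u) = 0 /\
      (forall y, `|y - t i| < rho -> bc i (mu i) u y = 0 -> y = c i u)) /\
      ((forall y, `|y - t i| < rho -> bc i (mu i).+1 u y != 0) /\
      ((exists2 y, `|y - t i| < rho & bc i 1 u y = 0) /\
      (`|c i u - t i| < rho /\ (lcl (s i) (j i) (vec u)).[c i u] != 0)))].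
  have nB i : nbhs u0 (B i).
    apply: filterI; first exact: filterI (nb i) (nu_ i).
    exact: filterI (nt i) (filterI (n9 i) (filterI (n6 i) (nP i))).
  have all4 := @filter_forall _ _ B (nbhs u0) (nbhs_filter u0) nB.
  apply: filterS2 nr all4 => u ru H; split=> // i; have [[h1 h2] [h3 [h4 [h5 h6]]]] := H i => //.
pose U' := U `&` A^°.
have oU' : open U' by apply: openI => //; exact: open_interior.
have [G HG] : exists G, forall u, U u -> G (Phi u) = u.
  exists (fun y => xget u0 [set u | U u /\ Phi u = y]) => u Uu.
  by case: xgetP => [w -> [Uw E]|/(_ u)[]//]; exact: UI.
have hX := holo_chart_comp (@proj_atlas_holo R _) (proj_atlas_holo (x := affine_chart R i0) (ex_intro2 _ _ _ Logic.I erefl)) oU' (fun u Uu => HG u Uu.1).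
exists (Chart (dom (affine_chart R i0) `&` affine_chart R i0 @^-1` U') (Phi \o affine_chart R i0)).
have XA g : (dom (affine_chart R i0) `&` affine_chart R i0 @^-1` U') g ->
   dom (affine_chart R i0) g /\ A (affine_chart R i0 g).
  by move=> [gi [_ /interior_subset]].
split.
- split.
  + apply: hX.
    * by move=> u [Uu _]; have [] := Ud u Uu.
    * by move=> u [Uu _]; have [_] := Ud u Uu; apply.
    * by move=> Y oY YU; apply: Uo => // y /YU[].
  + by move=> g /XA[gi [rv _ _ _ _]]; apply/ratv_vec.
  + move=> g /XA[gi [rv g2 g78 g96 gP]].
    have rg : RatMaps R d g by apply/ratv_vec.
    split=> [[_ [c' Hc']] q hq|H].
      have Z : forall i k, (0 < k <= mu i)%N ->
          bc i k (affine_chart R i0 g) (c i (affine_chart R i0 g)) = 0.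
        apply: (zero_of_crit gi rg _ _ _ Hc').
        * by move=> k y; have [+ _] := g78 k; apply.
        * by move=> k y; have [_ +] := g78 k; apply.
        * by move=> k; have [] := g96 k.
      rewrite [LHS]mxE; have [[i m] ->] := idx_ge hq; apply: Z.
      by rewrite /=; have := ltn_ord m; have := mu_gt0 i; lia.
    split=> //; eexists; apply: (crit_of_zero gi rg).
    * by move=> k; have [_] := g96 k; apply.
    * by move=> k y; have [_ +] := g78 k; apply.
    (* The equation of index [mu i] holds by the choice of [c i]; the lower ones are the last
       coordinates, numbered from 0, whence [k.-1]. *)
    move=> i k /andP[k0]; rewrite leq_eqVlt => /orP[/eqP ->//|km].
    have kk : (k.-1 < (mu i).-1)%N by move: km k0; clear; lia.
    have [q hq qE] := idxr (Tagged (fun i => 'I_(mu i).-1) (Ordinal kk)).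
    have := H q hq; rewrite [LHS]mxE qE; have {2}-> : k = (k.-1).+1 by rewrite prednK.
    exact.
- by split=> //; split=> //; exact: nA.
- by move=> g /XA[].
- move=> g /XA[gi [rv g2 g78 g96 gP]] [rg [c' Hc']]; split; last first.
    by move=> i; apply: HD; have [] := g96 i.
  apply: (crit_of_zero gi rg).
  * by move=> k; have [_] := g96 k; apply.
  * by move=> k y; have [_ +] := g78 k; apply.
  * apply: (zero_of_crit gi rg _ _ _ Hc').
    - by move=> k y; have [+ _] := g78 k; apply.
    - by move=> k y; have [_ +] := g78 k; apply.
    - by move=> k; have [] := g96 k.
- move=> g i /XA[gi [rv g2 g78 g96 gP]]; split.
    by apply/(ratmap_dom gi (hcoord_vec gi) rv); exact: gP.
  move=> q qi; rewrite (ratmap_coord gi (hcoord_vec gi) rv) /=.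
  by rewrite mxE (idx_lt qi).
Qed.

End LocalChart.

(** * Choice of the auxiliary data *)

Section Main.
Context {R : realType}.
Local Notation C := R[i].

Lemma spt_open_near (s : 'I_2) (t : C) (D : set (sphere R)) : open D -> D (spt s t) ->
  exists2 r, 0 < r & forall x, `|x - t| < r -> D (spt s x).
Proof.
move=> oD Dt; have oU := affine_pt_continuous (i := s) oD.
have /nbhs_vP[r r0 Hr] : nbhs (const_mx t : 'rV[C]_1) (affine_pt s @^-1` D).
  exact: open_nbhs_nbhs.
exists r => // x xr; apply: (Hr (const_mx x)).
by apply: norm_row_lt => // k; rewrite !mxE.
Qed.

Lemma local_chart (d nu : nat) (mu : 'I_nu -> nat)
    (d_ge2 : (2 <= d)%N) (mu_gt0 : forall i, (0 < mu i)%N)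
    (sum_mu : (\sum_(i < nu) mu i = 2 * d - 2)%N)
    (f : proj_space R (d.+1 + d.+1)) (c0 : 'I_nu -> sphere R) (D : 'I_nu -> set (sphere R)) :
  RatMaps R d f -> critical_enum mu f c0 -> (forall i, open (D i) /\ D i (c0 i)) ->
  exists (X : chart R (proj_space R (d.+1 + d.+1)) (d.+1 + d.+1).-1)
    (c : 'I_nu -> proj_space R (d.+1 + d.+1) -> sphere R) (j : 'I_nu -> 'I_2), [/\
    slice_chart (proj_atlas R _) (RatMaps R d) (nu + 3)%N (RatMaps_mu R d mu) X,
    dom X f,
    forall i, c i f = c0 i,
    forall g, dom X g -> RatMaps_mu R d mu g ->
       critical_enum mu g (c^~ g) /\ forall i, D i (c i g) &
    forall g i, dom X g ->
       dom (affine_chart R (j i)) (ratmap g (c i g)) /\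
       forall q : 'I_(d.+1 + d.+1).-1, val q = val i ->
       affine_chart R (j i) (ratmap g (c i g)) = const_mx (X g 0 q)].
Proof.
move=> rf cr HD.
have [_ [i0 _ <-] fi0] := proj_atlas_cover f.
pose u0 := affine_chart R i0 f; pose v0 := ins i0 u0.
have rv : ratv v0 by apply/(ratv_vec fi0).
have /choice[st Hst] : forall i, exists st : 'I_2 * C, c0 i = spt st.1 st.2.
  by move=> i; have [[t ->]|->] := sphere_cases (c0 i); [exists (1, t)|exists (0, 0)].
pose s i := (st i).1; pose t i := (st i).2.
have c0E i : c0 i = spt (s i) (t i) by exact: Hst.
have /choice[j Hj] : forall i, exists j, (lcl (s i) j v0).[t i] != 0.
  by move=> i; exact: ratv_lcl.
have [e eI He] := fresh3 [seq affine_chart R (1 : 'I_2) (c0 i) 0 0 | i <- enum 'I_nu].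
have ec0 a i : spt 1 (e a) <> c0 i.
  move=> E; have := He a; rewrite (_ : e a = affine_chart R (1 : 'I_2) (c0 i) 0 0).
    by apply/negP; rewrite negbK; apply/mapP; exists i => //; rewrite mem_enum.
  by rewrite -E affine_ptK mxE.
have Hc := exists_root d_ge2 mu_gt0 rf cr fi0 c0E Hj.
have /choice[c Hc'] := Hc.
have /choice[r1 Hr1] : forall i, exists r, 0 < r /\ \forall u \near u0, forall x,
      `|x - t i| < r -> bc i0 s j i (mu i) u x = 0 -> x = c i u.
  by move=> i; have [_ _ _ [r r0 Hr]] := Hc' i; exists r.
have /choice[r2 Hr2] : forall i, exists r, 0 < r /\ \forall u \near u0, forall x,
      `|x - t i| < r -> bc i0 s j i (mu i).+1 u x != 0.
  by move=> i; have [r r0 Hr] := bc_neq0_near d_ge2 rf cr j fi0 c0E i; exists r.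
have /choice[r3 Hr3] : forall i, exists r, 0 < r /\ forall x, `|x - t i| < r -> D i (spt (s i) x).
  move=> i; have [oD Di] := HD i; rewrite c0E in Di.
  by have [r r0 Hr] := spt_open_near oD Di; exists r.
have [c0I _ _] := cr.
have /choice[r4 Hr4] : forall ik : 'I_nu * 'I_nu, exists r, 0 < r /\ (ik.1 != ik.2 ->
    forall x y, `|x - t ik.1| < r -> `|y - t ik.2| < r -> spt (s ik.1) x <> spt (s ik.2) y).
  move=> [i k] /=; have [->|ik] := eqVneq i k; first by exists 1.
  have ne : spt (s i) (t i) <> spt (s k) (t k).
    by rewrite -!c0E => /c0I E; rewrite E eqxx in ik.
  by have [r r0 Hr] := spt_separated ne; exists r.
(* One radius for four purposes: uniqueness of the root, nonvanishing of the next coefficient,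
   staying in [D i], keeping the points apart. *)
pose fam (x : 'I_nu + 'I_nu + ('I_nu + 'I_nu * 'I_nu)) : C :=
  match x with inl (inl i) => r1 i | inl (inr i) => r2 i | inr (inl i) => r3 i | inr (inr ik) => r4 ik end.
have fam0 x : 0 < fam x.
  by case: x => [[i|i]|[i|ik]] /=; [case: (Hr1 i)|case: (Hr2 i)|case: (Hr3 i)|case: (Hr4 ik)].
have [rho rho0 Hrho] := pos_lower_bound fam0.
have cu0 i : c i u0 = t i by case: (Hc' i).
have sep i k x y : i != k -> `|x - t i| < rho -> `|y - t k| < rho -> spt (s i) x <> spt (s k) y.
  move=> ik xr yr; have [_ H] := Hr4 (i, k); apply: (H ik).
    exact: lt_le_trans xr (Hrho (inr (inr (i, k)))).
  exact: lt_le_trans yr (Hrho (inr (inr (i, k)))).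
have [||||| X [sX Xf _ Xc Xv]] := local_chart_aux d_ge2 mu_gt0 sum_mu rf cr fi0 c0E Hj eI ec0 (D := D) cu0 sep _ _ _ _ rho0.
- by move=> i; case: (Hc' i).
- by move=> i; case: (Hc' i).
- move=> i; have [_ H] := Hr1 i; apply: filterS H => u H y yr; apply: H.
  exact: lt_le_trans yr (Hrho (inl (inl i))).
- move=> i; have [_ H] := Hr2 i; apply: filterS H => u H y yr; apply: H.
  exact: lt_le_trans yr (Hrho (inl (inr i))).
- move=> i y yr; have [_ H] := Hr3 i; apply: H.
  exact: lt_le_trans yr (Hrho (inr (inl i))).
exists X, (fun i g => spt (s i) (c i (affine_chart R i0 g))), j; split=> //.
by move=> i; rewrite cu0.
Qed.

(** * Changes of variables acting on each coordinate separately *)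

Section CoordinateChange.
Context {n : nat}.
Local Notation line := 'rV[C]_1.

(** A vector of length 1, the kind of value taken by charts of the sphere. *)
Definition crd (q : 'I_n) (v : 'rV[C]_n) : line := v *m delta_mx q 0.

Lemma crdE q v : crd q v = const_mx (v 0 q).
Proof.
apply/rowP => k; rewrite /crd !mxE (bigD1 q)//= mxE eqxx (ord1 k) eqxx mulr1.
by rewrite big1 ?addr0// => i iq; rewrite mxE (negbTE iq) mulr0.
Qed.

Definition cmap (G : 'I_n -> line -> line) (v : 'rV[C]_n) : 'rV[C]_n :=
  \sum_q G q (crd q v) *m delta_mx 0 q.

Lemma cmapE G v q : cmap G v 0 q = G q (crd q v) 0 0.
Proof.
rewrite /cmap summxE (bigD1 q)//= big1 ?addr0.
  by rewrite mxE big_ord1 mxE !eqxx mulr1.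
by move=> i iq; rewrite mxE big_ord1 [X in _ * X]mxE eqxx/= [q == i]eq_sym (negbTE iq) mulr0.
Qed.

Lemma crd_cmap G v q : crd q (cmap G v) = G q (crd q v).
Proof. by rewrite crdE cmapE; apply/rowP => k; rewrite mxE (ord1 k). Qed.

Lemma cmap_differentiable G v : (forall q, differentiable (G q) (crd q v)) ->
  differentiable (cmap G) v.
Proof.
move=> H.
have -> : cmap G = \sum_q ((fun w : line => w *m delta_mx 0 q) \o (G q \o crd q)).
  by apply/funext => w; rewrite /cmap fct_sumE.
apply: differentiable_sum => q.
apply: differentiable_comp; last exact: differentiable_mulmx.
by apply: differentiable_comp; [exact: differentiable_mulmx|exact: H].
Qed.

Variables (A B : 'I_n -> set line) (G H : 'I_n -> line -> line).
Hypotheses (oA : forall q, open (A q)) (oB : forall q, open (B q))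
  (dG : forall q a, A q a -> differentiable (G q) a)
  (dH : forall q b, B q b -> differentiable (H q) b)
  (GB : forall q a, A q a -> B q (G q a)) (HA : forall q b, B q b -> A q (H q b))
  (GK : forall q a, A q a -> H q (G q a) = a) (HK : forall q b, B q b -> G q (H q b) = b).

Definition cset (A : 'I_n -> set line) := [set v : 'rV[C]_n | forall q, A q (crd q v)].

Lemma cset_open (A' : 'I_n -> set line) : (forall q, open (A' q)) -> open (cset A').
Proof.
move=> oA'; rewrite openE => v Av.
apply: (@filter_forall _ _ (fun q v => A' q (crd q v)) (nbhs v) (nbhs_filter v)) => q.
apply: (@mulmx_continuous R n 1 (delta_mx q 0)).
exact: open_nbhs_nbhs.
Qed.

Lemma cmapK v : cset A v -> cmap H (cmap G v) = v.
Proof.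
by move=> Av; apply/rowP => q; rewrite cmapE crd_cmap GK// crdE mxE.
Qed.

Lemma cmap_open V : open V -> V `<=` cset A -> open (cmap G @` V).
Proof.
move=> oV VA.
have -> : cmap G @` V = cset B `&` cmap H @^-1` V.
  apply/seteqP; split=> [_ [v Vv <-]|w [Bw Vw]].
    split; last by rewrite /preimage/mkset cmapK//; exact: VA.
    by move=> q; rewrite crd_cmap; apply: GB; exact: (VA _ Vv q).
  exists (cmap H w) => //; apply/rowP => q; rewrite cmapE crd_cmap HK//.
  by rewrite crdE mxE.
rewrite openE => w [Bw Vw]; apply: filterI.
  by apply: open_nbhs_nbhs; split=> //; exact: cset_open.
have /differentiable_continuous : differentiable (cmap H) w.
  by apply: cmap_differentiable => q; exact: dH.
by apply; exact: open_nbhs_nbhs.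
Qed.

End CoordinateChange.

Lemma mul_pid_mx_l n k (kn : (k <= n)%N) (v : 'rV[C]_n) (i : 'I_k) (q : 'I_n) : val q = val i ->
  (v *m (pid_mx k : 'M[C]_(n, k))) 0 i = v 0 q.
Proof.
move=> qi; rewrite mxE (bigD1 q)//= mxE big1 ?addr0.
  by rewrite qi eqxx ltn_ord mulr1.
move=> l lq; rewrite mxE (_ : (l == i :> nat) = false) ?mulr0//.
by apply/negbTE; rewrite -qi.
Qed.

End Main.

Theorem theorem2p1 (R : realType) (d nu : nat) (mu : 'I_nu -> nat)
  (d_ge2 : (2 <= d)%N) (mu_gt0 : forall i, (0 < mu i)%N)
  (sum_mu : (\sum_(i < nu) mu i = 2 * d - 2)%N) :
  embedded_submanifold (proj_atlas R (d.+1 + d.+1)) (RatMaps R d) (nu + 3)%N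
    (RatMaps_mu R d mu) /\
  let atlas_mu := submanifold_atlas (proj_atlas R (d.+1 + d.+1)) (RatMaps R d)
    (nu + 3)%N (RatMaps_mu R d mu) in
  forall (f : proj_space R (d.+1 + d.+1)) (c0 : 'I_nu -> sphere R),
    RatMaps R d f -> critical_enum mu f c0 ->
  forall D : 'I_nu -> set (sphere R),
    (forall i, open (D i) /\ D i (c0 i)) -> trivIset setT D ->
  exists W c, local_labelling mu D f W c /\
  forall zeta : 'I_nu -> chart R (sphere R) 1,
    (forall i, holo_chart setT (proj_atlas R 2) (zeta i) /\
               dom (zeta i) (ratmap f (c0 i))) ->
  exists x : chart R (proj_space R (d.+1 + d.+1)) (nu + 3)%N,
    [/\ holo_chart (RatMaps_mu R d mu) atlas_mu x,
        dom x f,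
        dom x `<=` W,
        forall g, dom x g ->
          (forall i, dom (zeta i) (ratmap g (c i g))) /\
          lsubmx (x g) = critical_values zeta c g &
        forall g, dom x g ->
          has_rank_at (RatMaps_mu R d mu) atlas_mu (critical_values zeta c) g nu].
Proof.
(* Each [mu i] being positive, nu is at most 2d - 2. *)
have kn : (nu + 3 <= (d.+1 + d.+1).-1)%N.
  have : (\sum_(i < nu) 1 <= \sum_(i < nu) mu i)%N by apply: leq_sum => i _; exact: mu_gt0.
  by rewrite sum_mu sum1_card card_ord => h; clear -h d_ge2; lia.
split.
  split=> // [g []//|f [rf [c0 cr]]].
  have HD i : open (setT : set (sphere R)) /\ setT (c0 i) by split=> //; exact: openT.
  have [X [c [j [sX Xf _ _ _]]]] := local_chart d_ge2 mu_gt0 sum_mu (D := fun=> setT) rf cr HD.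
  by exists X.
move=> atlas_mu f c0 rf cr D HD tD.
have [X [c [j [sX Xf cf Xc Xv]]]] := local_chart d_ge2 mu_gt0 sum_mu rf cr HD.
have [hX XM XS] := sX.
exists (dom X), c; split.
  split=> //; first exact: holo_chart_dom_open hX.
  move=> g Xg Sg; have [ce cD] := Xc g Xg Sg; split=> // i z.
  have [_ cc _] := ce; split=> [[Dz /cc[k kz]]|->]; last first.
    by split; [exact: cD|apply/cc; exists i].
  rewrite -kz; congr (c _ g); apply: (tD k i Logic.I Logic.I).
  by exists z; split=> //; rewrite -kz; exact: cD.
move=> zeta Hz.
(* [X] contains the critical values in affine charts; the transitions to the given charts [zeta i],
   holomorphic both ways, will be applied to these coordinates. *)
pose tau i : chart R (sphere R) 1 := affine_chart R (j i).
have atau i : proj_atlas R 2 (tau i) by exists (j i).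
have /choice[GH HGH] : forall i, exists GH : ('rV[R[i]]_1 -> 'rV[R[i]]_1) * ('rV[R[i]]_1 -> 'rV[R[i]]_1),
   (holomorphic_on (tau i @` (dom (tau i) `&` dom (zeta i))) GH.1 /\
    forall p, dom (tau i) p -> dom (zeta i) p -> GH.1 (tau i p) = zeta i p) /\
   (holomorphic_on (zeta i @` (dom (zeta i) `&` dom (tau i))) GH.2 /\
    forall p, dom (zeta i) p -> dom (tau i) p -> GH.2 (zeta i p) = tau i p).
  move=> i; have [[_ H] _] := Hz i; have [[H2 h2 h2'] [G2 g2 g2']] := H _ (atau i).
  by exists (G2, H2).
pose n := (d.+1 + d.+1).-1.
(* [insub] recognises the first [nu] coordinates; the others are left unchanged. *)
pose Aq (q : 'I_n) : set 'rV[R[i]]_1 :=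
  if insub (val q) is Some i then tau i @` (dom (tau i) `&` dom (zeta i)) else setT.
pose Bq (q : 'I_n) : set 'rV[R[i]]_1 :=
  if insub (val q) is Some i then zeta i @` (dom (zeta i) `&` dom (tau i)) else setT.
pose Gq (q : 'I_n) : 'rV[R[i]]_1 -> 'rV[R[i]]_1 :=
  if insub (val q) is Some i then (GH i).1 else id.
pose Hq (q : 'I_n) : 'rV[R[i]]_1 -> 'rV[R[i]]_1 :=
  if insub (val q) is Some i then (GH i).2 else id.
have oA q : open (Aq q).
  by rewrite /Aq; case: insub => [i|]; [have [[[]]] := HGH i|exact: openT].
have oB q : open (Bq q).
  by rewrite /Bq; case: insub => [i|]; [have [_ [[]]] := HGH i|exact: openT].
have did (a : 'rV[R[i]]_1) : differentiable id a.
  apply: differentiable_near (differentiable_mulmx 1%:M a).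
  by apply/nbhs_vP; exists 1 => // v _; rewrite mulmx1.
have dG q a : Aq q a -> differentiable (Gq q) a.
  by rewrite /Aq /Gq; case: insub => [i|_]; [have [[[_ +] _] _] := HGH i; apply|exact: did].
have dH q a : Bq q a -> differentiable (Hq q) a.
  by rewrite /Bq /Hq; case: insub => [i|_]; [have [_ [[_ +] _]] := HGH i; apply|exact: did].
have GB q a : Aq q a -> Bq q (Gq q a).
  rewrite /Aq /Bq /Gq; case: insub => [i|//] [p [tp zp] <-].
  by have [[_ E] _] := HGH i; rewrite E//; exists p.
have HA q a : Bq q a -> Aq q (Hq q a).
  rewrite /Aq /Bq /Hq; case: insub => [i|//] [p [tp zp] <-].
  by have [_ [_ E]] := HGH i; rewrite E//; exists p.
have GK q a : Aq q a -> Hq q (Gq q a) = a.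
  rewrite /Aq /Hq /Gq; case: insub => [i|//] [p [tp zp] <-].
  by have [[_ E] [_ E']] := HGH i; rewrite E// E'.
have HK q a : Bq q a -> Gq q (Hq q a) = a.
  rewrite /Bq /Hq /Gq; case: insub => [i|//] [p [tp zp] <-].
  by have [[_ E] [_ E']] := HGH i; rewrite E'// E.
have hX' := holo_chart_comp (@proj_atlas_holo R _) hX (cset_open oA) (cmapK GK)
  (fun u Au => cmap_differentiable (fun q => dG q _ (Au q)))
  (fun u Au => cmap_differentiable (fun q =>
     dH q _ (eq_ind_r (Bq q) (GB q _ (Au q)) (crd_cmap Gq u q)))) (cmap_open oB dH GB GK HK).
pose X' := Chart (dom X `&` X @^-1` cset Aq) (cmap Gq \o X).
have insub_i (q : 'I_n) (i : 'I_nu) : val q = val i -> insub (val q) = Some i.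
  by move=> ->; rewrite valK.
have sX' : slice_chart (proj_atlas R (d.+1 + d.+1)) (RatMaps R d) (nu + 3)%N (RatMaps_mu R d mu) X'.
  split=> //; first by move=> p [/XM].
  (* The coordinates that cut out the stratum are untouched, so [X'] is still a slice chart. *)
  have E p (q : 'I_n) : (nu + 3 <= q)%N -> X' p 0 q = X p 0 q.
    move=> kq; rewrite /X' /= cmapE /Gq insubN ?crdE ?mxE//.
    by rewrite -leqNgt (leq_trans _ kq)// leq_addr.
  move=> p [Xp _]; rewrite (XS p Xp).
  by split=> H q kq; move: (H q kq); rewrite E.
pose S := RatMaps_mu R d mu.
have Sf : S f by split=> //; exists c0.
have in_zeta g (q : 'I_n) i : dom X g -> cset Aq (X g) -> val q = val i ->
    dom (zeta i) (ratmap g (c i g)) /\ Gq q (crd q (X g)) = zeta i (ratmap g (c i g)).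
  move=> Xg Ag qi; have := Ag q; rewrite /Aq /Gq (insub_i _ _ qi).
  have [tg /(_ q qi) tgE] := Xv g i Xg; rewrite crdE -tgE => -[p [tp zp]].
  move=> /(affine_chart_inj tp tg) E; rewrite -E.
  by have [[_ +] _] := HGH i; move=> ->.
have Af : cset Aq (X f).
  move=> q; rewrite /Aq crdE; case: insubP => [i _ qi|//].
  have [tg tgE] := Xv f i Xf; rewrite -tgE//.
  by exists (ratmap f (c i f)) => //; split=> //; rewrite cf; have [] := Hz i.
pose x : chart R _ (nu + 3)%N := slice_restr S (nu + 3)%N X'.
have hx : holo_chart S atlas_mu x.
  exact: (slice_holo_chart (@proj_atlas_holo R _) (@proj_atlas_cover R _) kn sX').
have xE g : dom x g -> (forall i, dom (zeta i) (ratmap g (c i g))) /\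
    lsubmx (x g) = critical_values zeta c g.
  move=> [Sg [Xg Ag]]; pose qq i := widen_ord kn (lshift 3 i).
  split=> [i|]; first by have [] := in_zeta g (qq i) i Xg Ag erefl.
  apply/rowP => i; rewrite !mxE.
  have [_ <-] := in_zeta g (qq i) i Xg Ag erefl.
  have := mul_pid_mx_l kn (X' g) (i := lshift 3 i) (q := qq i) erefl.
  by rewrite mxE => ->; rewrite /X' /= cmapE.
exists x; split=> //.
- by move=> g [_ []].
(* Read in [x] itself, the critical values are a linear projection, of rank [nu] at every point. *)
- move=> g xg; exists x, (fun v => v *m (pid_mx nu : 'M[R[i]]_(nu + 3, nu))).
  have lE (v : 'rV[R[i]]_(nu + 3)) : v *m (pid_mx nu : 'M[R[i]]_(nu + 3, nu)) = lsubmx v.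
    apply/rowP => i; rewrite (mul_pid_mx_l (leq_addr _ _) _ (q := lshift 3 i))//.
    by rewrite !mxE.
  split=> //.
  + split=> [|v _]; last exact: differentiable_mulmx.
    have [[ox _ xo] _] := hx; exact/xo.
  + by move=> p xp; rewrite lE; have [] := xE p xp.
  + by rewrite diff_mulmx rank_pid_mx ?leq_addr.
Qed.
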